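(* The matrix $R(\beta)\equiv R(\beta,r)\in\mathrm{End}(\mathbb{C}^N)\otimes\mathrm{End}(\mathbb{C}^N)$ defined in the context satisfies the following identities of meromorphic matrix-valued functions of the spectral parameters: (i) Yang--Baxter equation: $R_{12}(\beta_1-\beta_2)\,R_{13}(\beta_1-\beta_3)\,R_{23}(\beta_2-\beta_3)=R_{23}(\beta_2-\beta_3)\,R_{13}(\beta_1-\beta_3)\,R_{12}(\beta_1-\beta_2)$; (ii) Unitarity: $R_{12}(\beta)\,R_{21}(-\beta)=1$; (iii) Crossing-symmetry: $R_{12}(\beta)^{t_2}\,R_{21}(-\beta+Ni\pi)^{t_2}=1$; (iv) Quasi-periodicity: $\widehat R_{12}(\beta-i\pi r)=(h\otimes\mathbb{I})^{-1}\,\widehat R_{21}(-\beta)^{-1}\,(h\otimes\mathbb{I})$, where $\widehat R_{12}(\beta)=\dfrac{\sin\frac{\pi-i\beta}{N}}{\sin\frac{i\beta}{N}}\,R_{12}(\beta)$.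
   Context: $N\ge 2$ is an integer, $\beta\in\mathbb{C}$ is the spectral parameter and $r$ is a fixed parameter, generic so that all functions below are defined (e.g. $\mathrm{Re}\,r>0$ and $1/r\notin\mathbb{Z}$). Double sine function: $\Gamma_2(x|\omega_1,\omega_2)=\exp\Big(\frac{\partial}{\partial s}\sum_{n_1,n_2\ge0}(x+n_1\omega_1+n_2\omega_2)^{-s}\Big|_{s=0}\Big)$ (analytically continued in $s$ and $x$) and $S_2(x|\omega_1,\omega_2)=\dfrac{\Gamma_2(\omega_1+\omega_2-x|\omega_1,\omega_2)}{\Gamma_2(x|\omega_1,\omega_2)}$. It satisfies $\frac{S_2(x+\omega_1|\omega_1,\omega_2)}{S_2(x|\omega_1,\omega_2)}=\frac{1}{2\sin(\pi x/\omega_2)}$ and $\frac{S_2(x+\omega_2|\omega_1,\omega_2)}{S_2(x|\omega_1,\omega_2)}=\frac{1}{2\sin(\pi x/\omega_1)}$. Define $$S_0(\beta)=\frac{S_2(-\frac{i\beta}{\pi}|r,N)\,S_2(1+\frac{i\beta}{\pi}|r,N)}{S_2(\frac{i\beta}{\pi}|r,N)\,S_2(1-\frac{i\beta}{\pi}|r,N)}.$$ The matrix is $R(\beta,r)=\sum_{a,b,c} R_{a,b}^{c,a+b-c}(\beta,r)\; e_a^c\otimes e_b^{a+b-c}$, where indices lie in $\mathbb{Z}_N$ (addition modulo $N$), $e_a^c$ is the $N\times N$ elementary matrix with $1$ in row $a$, column $c$, and $$R_{a,b}^{c,a+b-c}(\beta,r)=-\frac1N\,S_0(\beta)\,\frac{\sin\frac{i\beta+\pi+(b-a)\pi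 r}{Nr}}{\sin\frac{i\beta+(b-c)\pi r}{Nr}\,\sin\frac{\pi-(a-c)\pi r}{Nr}}\cdot\frac{\sin\frac{i\beta}{r}\,\sin\frac{\pi}{r}}{\sin\frac{i\beta+\pi}{r}}$$ (this is invariant under shifting any of $a,b,c$ by $N$). All other entries vanish. $h$ is the $N\times N$ matrix $h_{ij}=\delta_{i+1,j}$ with indices modulo $N$. $R_{jk}$ denotes $R$ acting on the $j$-th and $k$-th tensor factors (so $R_{21}=P R_{12}P$ with $P$ the flip), $t_2$ is transposition in the second factor, and $\mathbb{I}$ is the identity matrix. *)

(* Defs.v *)
(* The complex numbers are R[i] over an abstract R : realType. *)
From HB Require Import structures.
From mathcomp Require Export all_boot all_order all_algebra.
From mathcomp Require Export all_classical all_reals all_analysis.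
From mathcomp Require Export complex mxtens.

Set Implicit Arguments.
Unset Strict Implicit.
Unset Printing Implicit Defensive.

Export Order.TTheory GRing.Theory Num.Theory.
Export numFieldNormedType.Exports.

Local Open Scope classical_set_scope.
Local Open Scope ring_scope.
Local Open Scope complex_scope.

(* R[i] has no canonical topological structure in the libraries, whereas any
   numFieldType has the one given by its norm: the topological notions are
   hence stated over K : numFieldType, to be used with K := R[i]. *)
Section NumField.
Variable K : numFieldType.

Definition converges_to (u : nat -> K) (l : K) : Prop := u @ \oo --> l.

Definition derivative_at (f : K -> K) (z : K) : K := derive1 f z.

Definition analytic_at (f : K -> K) (z : K) : Prop :=
  exists a : nat -> K, \forall w \near z,
    converges_to (series (fun n => a n * (w - z) ^+ n)) (f w).

End NumField.

Section ComplexFunctions.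
Variable R : realType.
Local Notation C := R[i].

Definition piC : C := (pi : R)%:C.

Definition expC (z : C) : C :=
  (expR (complex.Re z))%:C * (cos (complex.Im z) +i* sin (complex.Im z)).

Definition sinC (z : C) : C := (expC ('i * z) - expC (- ('i * z))) / (2 * 'i).

(* The principal logarithm, on the half-plane Re z > 0 only (there
   arg z = atan (Im z / Re z)); it is never used outside this half-plane. *)
Definition logC (z : C) : C :=
  ln (Num.sqrt (complex.Re z ^+ 2 + complex.Im z ^+ 2))
    +i* atan (complex.Im z / complex.Re z).

Definition powC (z s : C) : C := expC (s * logC z).

(* Z is s |-> \sum_(n1, n2 >= 0) (x + n1 w1 + n2 w2)^(-s), continued to
   C \ {1, 2}, for x, w1, w2 in the right half-plane.  The double series
   converges absolutely for Re s > 2, so it may be summed over squares. *)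
Definition is_double_zeta (w1 w2 x : C) (Z : C -> C) : Prop :=
  (forall s : C, 2 < complex.Re s ->
     converges_to (fun n : nat => \sum_(n1 < n) \sum_(n2 < n)
       powC (x + n1%:R * w1 + n2%:R * w2) (- s)) (Z s)) /\
  (forall s : C, s != 1 -> s != 2 -> analytic_at Z s).

Definition quarter_lattice (w1 w2 : C) : set C :=
  [set z | exists n1 n2 : nat, z = n1%:R * w1 + n2%:R * w2].

(* G is Gamma_2( . | w1, w2), for w1, w2 in the right half-plane: given by
   zeta regularization for Re x > 0, and continued analytically in x to the
   complement of the set of poles { - n1 w1 - n2 w2 }, which is connected, so
   that G is determined there.  The values of G at its poles are irrelevant. *)
Definition is_double_gamma (w1 w2 : C) (G : C -> C) : Prop :=
  (forall x : C, 0 < complex.Re x ->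
     exists2 Z, is_double_zeta w1 w2 x Z & G x = expC (derivative_at Z 0)) /\
  (forall x : C, ~ quarter_lattice w1 w2 (- x) -> analytic_at G x).

(* In the following, G stands for Gamma_2( . | w1, w2). *)
Definition double_sine (G : C -> C) (w1 w2 x : C) : C := G (w1 + w2 - x) / G x.

(* x is neither a zero nor a pole of S_2( . | w1, w2). *)
Definition double_sine_regular (w1 w2 x : C) : Prop :=
  ~ quarter_lattice w1 w2 (- x) /\ ~ quarter_lattice w1 w2 (- (w1 + w2 - x)).

End ComplexFunctions.

Section TensorFactors.
Variables (K : fieldType) (N : nat).

(* The entry (i, k), (j, l) of X, i.e., the coefficient of e_i^j (x) e_k^l. *)
Definition tcoef (X : 'M[K]_(N * N)) (i j k l : 'I_N) : K :=
  X (mxtens_index (i, k)) (mxtens_index (j, l)).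

Definition flip_mx : 'M[K]_(N * N) :=
  \sum_(i < N) \sum_(j < N) (delta_mx i j *t delta_mx j i).

Definition leg21 (X : 'M[K]_(N * N)) : 'M[K]_(N * N) :=
  flip_mx *m X *m flip_mx.

Definition trmx2 (X : 'M[K]_(N * N)) : 'M[K]_(N * N) :=
  \sum_(i < N) \sum_(j < N) \sum_(k < N) \sum_(l < N)
    tcoef X i j k l *: (delta_mx i j *t (delta_mx k l)^T).

Definition leg12_3 (X : 'M[K]_(N * N)) : 'M[K]_(N * (N * N)) :=
  \sum_(i < N) \sum_(j < N) \sum_(k < N) \sum_(l < N)
    tcoef X i j k l *: (delta_mx i j *t (delta_mx k l *t 1%:M)).

Definition leg13_3 (X : 'M[K]_(N * N)) : 'M[K]_(N * (N * N)) :=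
  \sum_(i < N) \sum_(j < N) \sum_(k < N) \sum_(l < N)
    tcoef X i j k l *: (delta_mx i j *t (1%:M *t delta_mx k l)).

Definition leg23_3 (X : 'M[K]_(N * N)) : 'M[K]_(N * (N * N)) :=
  \sum_(i < N) \sum_(j < N) \sum_(k < N) \sum_(l < N)
    tcoef X i j k l *: (1%:M *t (delta_mx i j *t delta_mx k l)).

Definition shift_mx : 'M[K]_N :=
  \matrix_(i < N, j < N) (i.+1 == j %[mod N])%:R.

End TensorFactors.

Section RMatrix.
Variables (R : realType) (N : nat) (r : R[i]).
Local Notation C := R[i].
Local Notation NC := (N%:R : C).
Local Notation pi := (piC R).

(* G stands for Gamma_2( . | r, N). *)
Definition S0 (G : C -> C) (beta : C) : C :=
  let S2 := double_sine G r NC in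
  let x := 'i * beta / pi in
  (S2 (- x) * S2 (1 + x)) / (S2 x * S2 (1 - x)).

(* Indices in Z_N are represented by 0, ..., N - 1; the expression does not
   change when a, b or c is shifted by N. *)
Definition Rcoef (G : C -> C) (beta : C) (a b c : 'I_N) : C :=
  - (1 / NC) * S0 G beta
  * (sinC (('i * beta + pi + (b%:R - a%:R) * pi * r) / (NC * r))
     / (sinC (('i * beta + (b%:R - c%:R) * pi * r) / (NC * r))
        * sinC ((pi - (a%:R - c%:R) * pi * r) / (NC * r))))
  * (sinC ('i * beta / r) * sinC (pi / r) / sinC (('i * beta + pi) / r)).

Definition Rmx (G : C -> C) (beta : C) : 'M[C]_(N * N) :=
  \sum_(a < N) \sum_(b < N) \sum_(c < N)
    \sum_(d < N | (c + d == a + b %[mod N])%N)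
      Rcoef G beta a b c *: (delta_mx a c *t delta_mx b d).

(* All factors in the formula for R(beta) are defined, and those in
   denominators do not vanish.  The excluded beta form a closed discrete subset
   of C, the same for every G, so that an identity holding whenever its
   arguments are regular is an identity of meromorphic functions. *)
Definition Rmx_regular (beta : C) : Prop :=
  let x := 'i * beta / pi in
  [/\ [/\ double_sine_regular r NC (- x), double_sine_regular r NC (1 + x),
          double_sine_regular r NC x & double_sine_regular r NC (1 - x)],
      forall b c : 'I_N,
        sinC (('i * beta + (b%:R - c%:R) * pi * r) / (NC * r)) != 0,
      forall a c : 'I_N, sinC ((pi - (a%:R - c%:R) * pi * r) / (NC * r)) != 0
    & sinC (('i * beta + pi) / r) != 0].

Definition Rhat (G : C -> C) (beta : C) : 'M[C]_(N * N) :=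
  (sinC ((pi - 'i * beta) / NC) / sinC ('i * beta / NC)) *: Rmx G beta.

End RMatrix.

(* Main.v *)
Require Import Defs.
From mathcomp Require Import ring lra zify.

(** The R-matrix is a scalar times a matrix of sums of two cotangents: since
    sin (x + y) / (sin x * sin y) = cot x + cot y, its entries are
      kappa (cot (u + (b - c) pi / N) + cot (eta + (c - a) pi / N)),
    where u = i beta / (N r) and eta = pi / (N r) (Rcoef_cot).  Each identity thus
    splits into an identity between sums of cotangents over Z / N and a functional
    equation of the scalar.

    Trigonometric part.  In the Yang--Baxter equation the scalars are the same on
    both sides.  The addition formula reduces the difference of the two sums to
    terms that cancel by translations and reflections of the summation index
    (ybe_termwise, ybe_sum).  Unitarity and crossing symmetry are quadratic: they
    follow from the orthogonality relation
      sum_y cot (u + y pi / N) cot (u + (y + x) pi / N)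
        = - N + [x = 0] N^2 / sin^2 (N u)
    (ct_conv).  For quasi-periodicity, shifting beta by - i pi r adds pi / N to u,
    which amounts to a shift of an index by 1 (Rhat_shift).

    Scalar part.  The functional equations of S_0 (S0_mulN, S0_crossing, S0_shift)
    are consequences of the two difference equations of the double sine function
    (double_sine_shift), which have to be derived from the definition of Gamma_2
    by zeta regularization.  The difference of the double zeta functions at x and
    x + w1 is the Hurwitz series sum_n (x + n w2)^(-s) (double_zeta_diff).  The
    trapezoidal rule continues this series, multiplied by 1 - s, to a neighbourhood
    of Re s >= 0 as a locally uniform limit of explicit entire functions
    (hurwitz_J, hurwitz_J_step, hurwitz_limit), and the identity theorem along a
    segment from 3 + i to 0 identifies the derivative at s = 0.  This expresses
    Gamma_2 (x) / Gamma_2 (x + w1) as a Gauss product (gamma_ratio), for which the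
    functional equation (hurwitz_shift) and the reflection formula
    (hurwitz_reflection) come from the product formula of the sine (euler_sine) and
    from Stirling's formula, with its constant given by the Wallis product
    (stirling_cvg).  The results obtained for Re x > 0 extend along segments that
    avoid the poles (segment_avoid, gamma_eq).

    Complex analysis is developed from power series, without integration: the
    Cauchy estimates are averages over roots of unity (cauchy_estimate), and
    increments are bounded by the mean value theorem on real segments
    (cder_mvt). *)

Set Implicit Arguments.
Unset Strict Implicit.
Unset Printing Implicit Defensive.

Local Open Scope classical_set_scope.
Local Open Scope ring_scope.
Local Open Scope complex_scope.
Import Normc.

Local Notation Re := complex.Re.
Local Notation Im := complex.Im.

(** * Limits, derivatives and analyticity in terms of the modulus *)

Section NumFieldTopology.
Variable K : numFieldType.

Lemma converges_toP (u : nat -> K) (l : K) :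
  converges_to u l <-> forall e : K, 0 < e ->
    exists m : nat, forall n, (m <= n)%N -> `|l - u n| < e.
Proof.
split=> [/cvgrPdist_lt ul e e0|ul].
  by have [m _ um] := ul _ e0; exists m => n /um.
apply/cvgrPdist_lt => e /ul[m um].
by exists m => // n /um.
Qed.

Lemma analytic_atP (f : K -> K) (z : K) :
  analytic_at f z <-> exists a : nat -> K, exists2 e : K, 0 < e &
    forall w, `|z - w| < e ->
      converges_to (series (fun n => a n * (w - z) ^+ n)) (f w).
Proof.
split=> [[a /nbhs_normP[e /= e0 ae]]|[a [e e0 ae]]].
  by exists a, e => // w zw; apply: ae.
exists a; apply/nbhs_normP; exists e => // w /= zw; exact: ae.
Qed.

Lemma derivative_atE (f : K -> K) (z l : K) :
  (forall e : K, 0 < e -> exists2 d : K, 0 < d & forall h, h != 0 -> `|h| < d ->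
     `|l - h^-1 * (f (h + z) - f z)| < e) -> derivative_at f z = l.
Proof.
move=> fl; rewrite /derivative_at derive1E /derive.
apply: cvg_lim => //; apply/cvgrPdist_lt => e /fl[d d0 fd].
rewrite near_withinE; apply/nbhs_normP; exists d => // h /= hd h0.
by rewrite /GRing.scale /= mulr1; apply: fd => //; rewrite -normrN -sub0r.
Qed.
End NumFieldTopology.

Section Modulus.
Variable R : realType.
Local Notation C := R[i].
Implicit Types z w : C.

Lemma normcN z : normc (- z) = normc z.
Proof. by case: z => a b /=; rewrite !sqrrN. Qed.

Lemma normcE z : normc z = Num.sqrt (Re z ^+ 2 + Im z ^+ 2).
Proof. by case: z. Qed.

Lemma normc_normr z : `|z| = (normc z)%:C.
Proof. by rewrite normc_def normcE. Qed.

Lemma normc_lt z (e : R) : (`|z| < e%:C) = (normc z < e).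
Proof. by rewrite normc_normr ltcR. Qed.

Lemma gt0_ReC (e : C) : 0 < e -> 0 < Re e /\ e = (Re e)%:C.
Proof. by case: e => a b; rewrite ltcE /= => /andP[/eqP -> ->]. Qed.

Lemma normc_ge0 z : 0 <= normc z.
Proof. by rewrite normcE sqrtr_ge0. Qed.

Lemma normc_eq0 z : (normc z == 0) = (z == 0).
Proof. by apply/eqP/eqP => [/eq0_normc|->]; rewrite ?normc0. Qed.

Lemma normc_gt0 z : (0 < normc z) = (z != 0).
Proof. by rewrite lt_def normc_ge0 andbT normc_eq0. Qed.

Lemma normcB z w : normc (z - w) = normc (w - z).
Proof. by rewrite -normcN opprB. Qed.

Lemma normc_real (x : R) : normc x%:C = `|x|.
Proof. by rewrite normcE /= expr0n addr0 sqrtr_sqr. Qed.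

Lemma normc_nat n : normc (n%:R : C) = n%:R.
Proof. by rewrite -(rmorph_nat (real_complex R)) normc_real ger0_norm. Qed.

Lemma normc_i : normc ('i : C) = 1.
Proof. by rewrite normcE /= expr0n add0r expr1n sqrtr1. Qed.

Lemma normcX z n : normc (z ^+ n) = normc z ^+ n.
Proof. by elim: n => [|n IH]; rewrite ?expr0 ?normc1// !exprS normcM IH. Qed.

Lemma normc_sum I (r : seq I) (P : pred I) (F : I -> C) :
  normc (\sum_(i <- r | P i) F i) <= \sum_(i <- r | P i) normc (F i).
Proof.
elim/big_ind2: _ => [|x y u v xy uv|//]; first by rewrite normc0.
by rewrite (le_trans (le_normcD _ _))// lerD.
Qed.

Lemma normc_prod I (r : seq I) (P : pred I) (F : I -> C) :
  normc (\prod_(i <- r | P i) F i) = \prod_(i <- r | P i) normc (F i).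
Proof. by elim/big_ind2: _ => [|x y u v <- <-|//]; rewrite ?normc1 ?normcM. Qed.

Lemma normcDl z w : normc z <= normc (z + w) + normc w.
Proof. by rewrite -{1}(addrK w z) -[normc w]normcN le_normcD. Qed.

Lemma normc_Re z : `|Re z| <= normc z.
Proof. by rewrite normcE -sqrtr_sqr ler_sqrt ?lerDl ?addr_ge0 ?sqr_ge0. Qed.

Lemma normc_Im z : `|Im z| <= normc z.
Proof. by rewrite normcE -sqrtr_sqr ler_sqrt ?lerDr ?addr_ge0 ?sqr_ge0. Qed.

Lemma ReD z w : Re (z + w) = Re z + Re w.
Proof. by case: z; case: w. Qed.
Lemma ImD z w : Im (z + w) = Im z + Im w.
Proof. by case: z; case: w. Qed.
Lemma ReN z : Re (- z) = - Re z.
Proof. by case: z. Qed.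
Lemma ImN z : Im (- z) = - Im z.
Proof. by case: z. Qed.
Lemma ReM z w : Re (z * w) =
  Re z * Re w - Im z * Im w.
Proof. by case: z; case: w. Qed.
Lemma ImM z w : Im (z * w) =
  Re z * Im w + Im z * Re w.
Proof. by case: z => a b; case: w => c d. Qed.
Lemma Re0 : Re (0 : C) = 0. Proof. by []. Qed.
Lemma Im0 : Im (0 : C) = 0. Proof. by []. Qed.
Lemma Re1 : Re (1 : C) = 1. Proof. by []. Qed.
Lemma Im1 : Im (1 : C) = 0. Proof. by []. Qed.
Lemma natC n : (n%:R : C) = (n%:R : R)%:C.
Proof. by rewrite rmorph_nat. Qed.
Lemma ReR (x : R) : Re (x%:C) = x. Proof. by []. Qed.
Lemma ImR (x : R) : Im (x%:C) = 0. Proof. by []. Qed.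
Lemma Re_nat n : Re (n%:R : C) = n%:R. Proof. by rewrite natC. Qed.
Lemma Im_nat n : Im (n%:R : C) = 0. Proof. by rewrite natC. Qed.
Lemma ReRM (x : R) z : Re (x%:C * z) = x * Re z.
Proof. by rewrite ReM /= mul0r subr0. Qed.
Lemma ImRM (x : R) z : Im (x%:C * z) = x * Im z.
Proof. by rewrite ImM /= mul0r addr0. Qed.
Lemma Re_natM n z : Re (n%:R * z) = n%:R * Re z.
Proof. by rewrite natC ReRM. Qed.
Lemma Re_sum I (r : seq I) (P : pred I) (F : I -> C) :
  Re (\sum_(i <- r | P i) F i) = \sum_(i <- r | P i) Re (F i).
Proof. by elim/big_ind2: _ => [|x y u v <- <-|//]; rewrite ?ReD. Qed.
Lemma Im_sum I (r : seq I) (P : pred I) (F : I -> C) :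
  Im (\sum_(i <- r | P i) F i) = \sum_(i <- r | P i) Im (F i).
Proof. by elim/big_ind2: _ => [|x y u v <- <-|//]; rewrite ?ImD. Qed.
Lemma eqC z w : Re z = Re w -> Im z = Im w ->
  z = w.
Proof. by case: z => a b; case: w => c d /= -> ->. Qed.
End Modulus.

Section Limits.
Variable R : realType.
Local Notation C := R[i].
Implicit Types (u v : nat -> C) (l k : C).

(** Convergence of the real sequence of moduli of the differences: every limit
    below is a limit of real numbers. *)
Definition clim u l : Prop := (fun n => normc (u n - l)) @ \oo --> (0 : R).

Lemma climP u l : clim u l <-> forall e : R, 0 < e ->
  exists m, forall n, (m <= n)%N -> normc (u n - l) < e.
Proof.
split=> [/cvgrPdist_lt ul e /ul[m _ um]|ul].
  by exists m => n /um/=; rewrite sub0r normrN ger0_norm ?normc_ge0.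
apply/cvgrPdist_lt => e /ul[m um]; exists m => // n /= /um.
by rewrite sub0r normrN ger0_norm ?normc_ge0.
Qed.

Lemma converges_to_clim u l : converges_to u l <-> clim u l.
Proof.
rewrite converges_toP climP; split=> [ul e e0|ul e].
  have [|m um] := ul e%:C; first by rewrite ltcR.
  by exists m => n /um; rewrite normc_lt normcB.
move=> /gt0_ReC[e0 ->]; have [m um] := ul _ e0.
by exists m => n /um; rewrite normc_lt normcB.
Qed.

Lemma clim_le u l (b : nat -> R) (m : nat) :
  (forall n, (m <= n)%N -> normc (u n - l) <= b n) ->
  b @ \oo --> (0 : R) -> clim u l.
Proof.
move=> ub b0; apply: (squeeze_cvgr _ (cvg_cst 0) b0).
by exists m => // n /= /ub ->; rewrite normc_ge0.
Qed.

Lemma clim_const l : clim (fun=> l) l.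
Proof. by rewrite /clim subrr normc0; exact: cvg_cst. Qed.

Lemma clim_uniq u l k : clim u l -> clim u k -> l = k.
Proof.
move=> /climP ul /climP uk; apply/eqP; rewrite -subr_eq0 -normc_eq0.
apply/eqP/le_anti; rewrite normc_ge0 andbT leNgt; apply/negP => lk.
have [|m um] := ul (normc (l - k) / 2); first lra.
have [|p up] := uk (normc (l - k) / 2); first lra.
have := um _ (leq_maxl m p); have := up _ (leq_maxr m p).
set x := u _ => h1 h2.
have := le_normcD (l - x) (x - k); rewrite subrKA [normc (l - x)]normcB; lra.
Qed.

Lemma clim_ext u v l m : (forall n, (m <= n)%N -> u n = v n) ->
  clim u l -> clim v l.
Proof.
move=> uv ul; apply: (clim_le (m := m) _ ul) => n mn.
by rewrite uv.
Qed.

Lemma climD u v l k : clim u l -> clim v k -> clim (fun n => u n + v n) (l + k).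
Proof.
move=> ul vk; apply: (clim_le (m := 0) (b := fun n => normc (u n - l) + normc (v n - k))).
  by move=> n _; rewrite opprD addrACA le_normcD.
by rewrite -[0]addr0; exact: cvgD.
Qed.

Lemma climN u l : clim u l -> clim (fun n => - u n) (- l).
Proof.
by move=> ul; apply: (clim_le (m := 0) _ ul) => n _; rewrite -opprD normcN.
Qed.

Lemma climB u v l k : clim u l -> clim v k -> clim (fun n => u n - v n) (l - k).
Proof. by move=> ul vk; apply: climD => //; apply: climN. Qed.

Lemma clim_lec u l (B : R) m : (forall n, (m <= n)%N -> normc (u n) <= B) ->
  clim u l -> normc l <= B.
Proof.
move=> uB /climP ul; rewrite leNgt; apply/negP => Bl.
have [|p up] := ul (normc l - B); first lra.
have := up _ (leq_maxr m p); have := uB _ (leq_maxl m p).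
set x := u _ => h1 h2.
have := le_normcD (l - x) x; rewrite subrK normcB; lra.
Qed.

Lemma clim_bounded u l : clim u l -> exists2 M : R, 0 < M & forall n, normc (u n) <= M.
Proof.
move=> /cvgP/cvg_seq_bounded; rewrite /bounded_near /=.
move=> [M0 [_ /(_ (`|M0| + 1))]] H.
have {}H : forall n, normc (u n - l) <= `|M0| + 1.
  have M01 : M0 < `|M0| + 1 by rewrite (le_lt_trans (ler_norm _))// ltrDl.
  by move=> n; have := H M01 n I; rewrite ger0_norm ?normc_ge0.
exists (`|M0| + 1 + normc l) => [|n].
  by rewrite ltr_wpDr ?normc_ge0// ltr_wpDl.
by rewrite -{1}(subrK l (u n)) (le_trans (le_normcD _ _))// lerD.
Qed.

Lemma climM u v l k : clim u l -> clim v k -> clim (fun n => u n * v n) (l * k).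
Proof.
move=> ul vk; have [M M0 uM] := clim_bounded ul.
apply: (clim_le (m := 0)
  (b := fun n => M * normc (v n - k) + normc (u n - l) * normc k)).
  move=> n _; rewrite (_ : _ - _ = u n * (v n - k) + (u n - l) * k); last by ring.
  rewrite (le_trans (le_normcD _ _))// !normcM lerD// ler_wpM2r ?normc_ge0//.
rewrite -[0]addr0 -{1}(mulr0 M) -{2}(mul0r (normc k)).
by apply: cvgD; [apply: cvgMr|apply: cvgMl].
Qed.

Lemma climMc k u l : clim u l -> clim (fun n => k * u n) (k * l).
Proof. by apply: climM; apply: clim_const. Qed.

Lemma clim_shift u l (k : nat) : clim u l <-> clim (fun n => u (n + k)%N) l.
Proof.
rewrite !climP; split=> ul e /ul[m um].
  by exists m => n mn; apply: um; rewrite (leq_trans mn)// leq_addr.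
exists (m + k)%N => n mn; rewrite -(@subnK k n) ?(leq_trans _ mn) ?leq_addl//.
by apply: um; rewrite leq_subRL ?(leq_trans _ mn) ?leq_addl// addnC.
Qed.

Lemma clim_subseq u l (f : nat -> nat) : (forall n, (n <= f n)%N) ->
  clim u l -> clim (fun n => u (f n)) l.
Proof.
rewrite !climP => nf ul e /ul[m um].
by exists m => n mn; apply: um; rewrite (leq_trans mn).
Qed.

Lemma clim_real (x : nat -> R) (y : R) :
  x @ \oo --> y -> clim (fun n => (x n)%:C) y%:C.
Proof.
move=> /cvgrPdist_lt xy; apply/climP => e /xy[m _ xm].
by exists m => n /xm; rewrite -rmorphB normc_real distrC.
Qed.

Lemma clim_ReIm u l : clim (fun n => (Re (u n))%:C) (Re l)%:C ->
  clim (fun n => (Im (u n))%:C) (Im l)%:C -> clim u l.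
Proof.
move=> rl il; rewrite (complexE l).
apply: (clim_ext (m := 0)) (climD rl (climMc 'i il)).
by move=> n _; rewrite -complexE.
Qed.

(** A telescoping majorant does two things at once: it makes the series
    absolutely convergent, and its n-th term bounds the remainder of order n. *)
Lemma series_tele (f : nat -> C) (v : nat -> R) :
  (forall n, 0 <= v n) -> (forall n, normc (f n) <= v n - v n.+1) ->
  exists2 l, clim (series f) l & forall n, normc (l - series f n) <= v n.
Proof.
move=> v0 fv.
have Hc (g : nat -> R) : (forall n, `|g n| <= v n - v n.+1) -> cvgn (series g).
  move=> gv; apply: normed_cvg; apply: nondecreasing_is_cvgn.
    by apply: nondecreasing_series => n _ _ /=.
  exists (v 0) => _ [n _ <-] /=; rewrite /series /=.
  rewrite (le_trans (ler_sum _ (fun i _ => gv i)))//.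
  by rewrite -[leLHS]opprK -sumrN (eq_bigr (fun i => v i.+1 - v i)) ?telescope_sumr//
    => [|i _]; rewrite ?opprB ?gerBl.
have [a ca] : exists a, (series (fun n => Re (f n))) @ \oo --> (a : R).
  by exists (limn (series (fun n => Re (f n)))); apply: Hc => n;
    rewrite (le_trans (normc_Re _)).
have [b cb] : exists b, (series (fun n => Im (f n))) @ \oo --> (b : R).
  by exists (limn (series (fun n => Im (f n)))); apply: Hc => n;
    rewrite (le_trans (normc_Im _)).
have fl : clim (series f) (a +i* b).
  apply: clim_ReIm => /=.
    apply: (clim_ext (m := 0)) (clim_real ca) => n _.
    by rewrite /series /= Re_sum.
  apply: (clim_ext (m := 0)) (clim_real cb) => n _.
  by rewrite /series /= Im_sum.
exists (a +i* b) => // n.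
apply: (clim_lec (m := n)) (climB fl (clim_const (series f n))) => m nm.
rewrite /series /= (big_cat_nat (leq0n n) nm)/= addrAC subrr add0r.
rewrite (le_trans (normc_sum _ _ _))//.
rewrite (le_trans (ler_sum _ (fun i _ => fv i)))//.
rewrite -[leLHS]opprK -sumrN (eq_bigr (fun i => v i.+1 - v i)) => [|i _].
  by rewrite telescope_sumr// opprB gerBl.
by rewrite opprB.
Qed.
End Limits.

(** * The complex exponential and the principal logarithm *)

Section Exponential.
Variable R : realType.
Local Notation C := R[i].
Implicit Types z w : C.

Lemma sqr_i : ('i : C) * 'i = -1.
Proof. by apply: eqC => /=; ring. Qed.

Lemma i_neq0 : ('i : C) != 0.
Proof. by rewrite -normc_eq0 normc_i oner_eq0. Qed.

Lemma ReiM z : Re ('i * z) = - Im z.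
Proof. by rewrite ReM /= mul0r mul1r sub0r. Qed.
Lemma ImiM z : Im ('i * z) = Re z.
Proof. by rewrite ImM /= mul0r mul1r add0r. Qed.

Lemma Re_expC z : Re (expC z) = expR (Re z) * cos (Im z).
Proof. by rewrite /expC ReRM. Qed.
Lemma Im_expC z : Im (expC z) = expR (Re z) * sin (Im z).
Proof. by rewrite /expC ImRM. Qed.

Lemma expC0 : expC (0 : C) = 1.
Proof.
by apply: eqC; rewrite ?Re_expC ?Im_expC Re0 Im0 expR0 ?cos0 ?sin0 ?mulr1 ?mulr0.
Qed.

Lemma expCD z w : expC (z + w) = expC z * expC w.
Proof.
apply: eqC.
  by rewrite [LHS]Re_expC [RHS]ReM !Re_expC !Im_expC ReD ImD expRD cosD; ring.
by rewrite [LHS]Im_expC [RHS]ImM !Re_expC !Im_expC ReD ImD expRD sinD; ring.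
Qed.

Lemma expCNM z : expC (- z) * expC z = 1.
Proof. by rewrite -expCD addNr expC0. Qed.

Lemma expC_neq0 z : expC z != 0.
Proof.
by apply/eqP => z0; have /eqP := expCNM z; rewrite z0 mulr0 eq_sym oner_eq0.
Qed.

Lemma expCN z : expC (- z) = (expC z)^-1.
Proof.
by apply: (mulIf (expC_neq0 z)); rewrite expCNM mulVf ?expC_neq0.
Qed.

Lemma expCB z w : expC (z - w) = expC z / expC w.
Proof. by rewrite expCD expCN. Qed.

Lemma expC_nat n z : expC (n%:R * z) = expC z ^+ n.
Proof.
elim: n => [|n IH]; first by rewrite mul0r expC0 expr0.
by rewrite -addn1 natrD mulrDl mul1r expCD IH exprD expr1.
Qed.

Lemma expC_sum I (s : seq I) (P : pred I) (F : I -> C) :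
  expC (\sum_(i <- s | P i) F i) = \prod_(i <- s | P i) expC (F i).
Proof. by elim/big_ind2: _ => [|x y u v <- <-|//]; rewrite ?expC0 ?expCD. Qed.

Lemma normc_expC z : normc (expC z) = expR (Re z).
Proof.
rewrite normcE Re_expC Im_expC !exprMn -mulrDr cos2Dsin2 mulr1 sqrtr_sqr.
by rewrite ger0_norm// expR_ge0.
Qed.

Lemma expCipi : expC ('i * piC R) = -1.
Proof.
by apply: eqC; rewrite ?Re_expC ?Im_expC ReiM ImiM ReR ImR oppr0 expR0 ?cospi ?sinpi
  ?mul1r ?ReN ?ImN ?Im1 ?oppr0.
Qed.

Lemma expC2ipi : expC (2 * ('i * piC R)) = 1.
Proof. by rewrite expC_nat expCipi sqrrN expr1n. Qed.

(** With t = atan (Im z / Re z) in the open interval from - pi / 2 to pi / 2, the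
    modulus of z is Re z / cos t, and Im z = Re z * tan t. *)
Lemma expC_logC z : 0 < Re z -> expC (logC z) = z.
Proof.
case: z => a b /= a0; rewrite /logC /=.
have ab0 : 0 < a ^+ 2 + b ^+ 2 by rewrite ltr_pwDl ?exprn_gt0 ?sqr_ge0.
have [/andP[t1 t2] tE] := atan_def (b / a).
set t := atan (b / a) in t1 t2 tE *.
have ct : 0 < cos t by apply: cos_gt0_pihalf; rewrite t1 t2.
have bE : b = a * (sin t / cos t) by rewrite -/(tan t) tE; field; rewrite gt_eqF.
have aE : Num.sqrt (a ^+ 2 + b ^+ 2) = a / cos t.
  rewrite (_ : a ^+ 2 + b ^+ 2 = (a / cos t) ^+ 2); last first.
    have -> : a ^+ 2 + b ^+ 2 = a ^+ 2 * (cos t ^+ 2 + sin t ^+ 2) / cos t ^+ 2.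
      by rewrite [in LHS]bE; field; exact: lt0r_neq0.
    by rewrite cos2Dsin2 mulr1 expr_div_n.
  by rewrite sqrtr_sqr ger0_norm// divr_ge0 ?ltW.
apply: eqC; rewrite ?Re_expC ?Im_expC /= lnK ?posrE ?sqrtr_gt0// aE.
  by field; exact: lt0r_neq0.
by rewrite [RHS]bE; field; exact: lt0r_neq0.
Qed.

Lemma Re_logC z : 0 < Re z -> Re (logC z) = ln (normc z).
Proof. by rewrite normcE. Qed.

Lemma Im_logC z : `|Im (logC z)| <= 2.
Proof.
have [/andP[t1 t2] _] := atan_def (Im z / Re z).
rewrite /logC /=; have := pihalf_lt2 R.
by move=> p2; rewrite ler_norml; apply/andP; split; lra.
Qed.

End Exponential.

(** * Complex-valued functions of a real variable *)

Section Derivative.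
Variable R : realType.
Local Notation C := R[i].
Implicit Types (f g : R -> C) (t : R) (a b : C).

(** All the holomorphic functions that have to be estimated are restricted to
    real segments, where the real mean value theorem controls their increments. *)
Definition cder f t a : Prop :=
  is_derive t 1 (fun s => Re (f s)) (Re a) /\
  is_derive t 1 (fun s => Im (f s)) (Im a).

Lemma is_derive_ext (h k : R -> R) t (d d' : R) :
  h =1 k -> d = d' -> is_derive t 1 h d -> is_derive t 1 k d'.
Proof. by move=> /funext -> ->. Qed.

Lemma cder_ext f g t a b : f =1 g -> a = b -> cder f t a -> cder g t b.
Proof. by move=> /funext -> ->. Qed.

Lemma cder_const t a : cder (fun=> a) t 0.
Proof. by split; exact: is_derive_cst. Qed.

Lemma cder_real (h : R -> R) t (d : R) : is_derive t 1 h d ->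
  cder (fun s => (h s)%:C) t d%:C.
Proof. by move=> hd; split=> //=; exact: is_derive_cst. Qed.

Lemma cderD f g t a b : cder f t a -> cder g t b ->
  cder (fun s => f s + g s) t (a + b).
Proof.
move=> [fa fa'] [gb gb']; split.
  apply: is_derive_ext (is_deriveD fa gb) => [s|]; by rewrite ReD.
apply: is_derive_ext (is_deriveD fa' gb') => [s|]; by rewrite ImD.
Qed.

Lemma cderM f g t a b : cder f t a -> cder g t b ->
  cder (fun s => f s * g s) t (a * g t + f t * b).
Proof.
move=> [fa fa'] [gb gb']; split.
  apply: is_derive_ext (is_deriveB (is_deriveM fa gb) (is_deriveM fa' gb')).
    by move=> s; rewrite ReM.
  by rewrite ReD !ReM /GRing.scale /=; ring.
apply: is_derive_ext (is_deriveD (is_deriveM fa gb') (is_deriveM fa' gb)).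
  by move=> s; rewrite ImM.
by rewrite ImD !ImM /GRing.scale /=; ring.
Qed.

Lemma cderMc k f t a : cder f t a -> cder (fun s => k * f s) t (k * a).
Proof.
move=> fa; apply: cder_ext (cderM (cder_const t k) fa) => //.
by rewrite mul0r add0r.
Qed.

Lemma cderN f t a : cder f t a -> cder (fun s => - f s) t (- a).
Proof. by move=> /(cderMc (-1)); apply: cder_ext => [s|]; rewrite mulN1r. Qed.

Lemma cderB f g t a b : cder f t a -> cder g t b ->
  cder (fun s => f s - g s) t (a - b).
Proof. by move=> fa gb; apply: cderD => //; apply: cderN. Qed.

Lemma cder_id t : cder (fun s => s%:C) t 1.
Proof. exact: (@cder_real id). Qed.

Lemma cder_exp f t a : cder f t a ->
  cder (fun s => expC (f s)) t (a * expC (f t)).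
Proof.
move=> [fa fa'].
have E1 : is_derive t 1 (fun s => expR (Re (f s)))
    (Re a * expR (Re (f t))).
  by apply: is_derive_ext (is_derive1_comp (is_derive_expR _) fa) => //; rewrite mulrC.
have E2 : is_derive t 1 (fun s => cos (Im (f s)))
    (- (Im a * sin (Im (f t)))).
  apply: is_derive_ext (is_derive1_comp (is_derive_cos _) fa') => //; ring.
have E3 : is_derive t 1 (fun s => sin (Im (f s)))
    (Im a * cos (Im (f t))).
  apply: is_derive_ext (is_derive1_comp (is_derive_sin _) fa') => //; ring.
split.
  apply: is_derive_ext (is_deriveM E1 E2) => [s|]; first by rewrite Re_expC.
  by rewrite ReM Re_expC Im_expC /GRing.scale /=; ring.
apply: is_derive_ext (is_deriveM E1 E3) => [s|]; first by rewrite Im_expC.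
by rewrite ImM Re_expC Im_expC /GRing.scale /=; ring.
Qed.

Lemma is_deriveVR (h : R -> R) t (d : R) : h t != 0 -> is_derive t 1 h d ->
  is_derive t 1 (fun s => (h s)^-1) (- d / h t ^+ 2).
Proof.
move=> h0 hd; apply: is_derive_ext (is_deriveV h0 hd) => //.
by rewrite /GRing.scale /=; field.
Qed.

(** On the right half-plane the real part of the logarithm is half the logarithm
    of x ^ 2 + y ^ 2 and its imaginary part is atan (y / x), so that the real
    differentiation rules give the real and imaginary parts of a / f. *)
Lemma cder_log f t a : 0 < Re (f t) -> cder f t a ->
  cder (fun s => logC (f s)) t (a / f t).
Proof.
move=> f0 [fa fa'].
set x := fun s => Re (f s) in fa; set y := fun s => Im (f s) in fa'.
pose n s := x s * x s + y s * y s; pose q s := y s / x s.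
have n0 : 0 < n t.
  by rewrite ltr_pwDl ?mulr_gt0 ?f0// -expr2 sqr_ge0.
have N : is_derive t 1 n
    (2 * (x t * Re a + y t * Im a)).
  apply: is_derive_ext (is_deriveD (is_deriveM fa fa) (is_deriveM fa' fa')) => //.
  by rewrite /GRing.scale /=; ring.
have E1 := @is_derive1_comp R _ n _ _ _ (is_derive1_ln n0) N.
have xt0 : x t != 0 by rewrite gt_eqF// f0.
have Q : is_derive t 1 q
    ((Im a * x t - y t * Re a) / x t ^+ 2).
  apply: is_derive_ext (is_deriveM fa' (is_deriveVR xt0 fa)) => //.
  by rewrite /GRing.scale /=; field.
have E2 := @is_derive1_comp R _ q _ _ _ (is_derive1_atan (q t)) Q.
have ft : f t = x t +i* y t by rewrite /x /y; case: (f t).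
have N0 : x t ^+ 2 + y t ^+ 2 != 0 by rewrite !expr2 gt_eqF.
have nm : x t * x t + y t * y t != 0 by rewrite gt_eqF.
have nE s : n s = x s * x s + y s * y s by [].
have af : a / f t = ((Re a * x t + Im a * y t) / (x t * x t + y t * y t))
    +i* ((Im a * x t - Re a * y t) / (x t * x t + y t * y t)).
  apply: (mulIf (x := f t)).
    by apply/eqP => f00; move: f0; rewrite f00 ltxx.
  rewrite divfK; last by apply/eqP => f00; move: f0; rewrite f00 ltxx.
  by rewrite ft; apply: eqC; rewrite ?ReM ?ImM /=; field.
split.
  apply: is_derive_ext (is_deriveM (is_derive_cst (2^-1 : R) t 1) E1) => [s|].
    rewrite /logC /= /cst /= -/(x s) -/(y s) !expr2 -nE.
    rewrite [LHS](_ : _ = 2^-1 * ln (n s))//.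
    have ns : 0 <= n s by rewrite addr_ge0// -expr2 sqr_ge0.
    have [ns0|ns0] := eqVneq (n s) 0; first by rewrite ns0 sqrtr0 ln0// mulr0.
    rewrite -[in LHS](@sqr_sqrtr _ (n s))// lnXn ?sqrtr_gt0 ?lt_def ?ns0//.
    by rewrite -[ln _ *+ 2]mulr_natl mulKf.
  by rewrite af /= /GRing.scale /= nE; field.
apply: is_derive_ext E2 => [s|]; first by rewrite /logC.
by rewrite af /= /q; field; rewrite xt0 nm.
Qed.

(** The increment v = f y - f x is projected on its own direction: the real
    function Re (conj v * f) - |v| * g is nonincreasing, since its derivative is at
    most |v| (|f'| - g'), and its increment is |v| (|v| - (g y - g x)). *)
Lemma cder_mvt f (df : R -> C) (g dg : R -> R) (x y : R) : x <= y ->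
  (forall t, x <= t <= y -> cder f t (df t)) ->
  (forall t, x <= t <= y -> is_derive t 1 g (dg t)) ->
  (forall t, x <= t <= y -> normc (df t) <= dg t) ->
  normc (f y - f x) <= g y - g x.
Proof.
rewrite le_eqVlt => /predU1P[->|xy] fd gd fg; first by rewrite !subrr normc0.
set v := f y - f x.
have [v0|v0] := eqVneq (normc v) 0.
  rewrite v0.
  have [||c cxy ->] := @MVT R g dg x y xy.
  - by move=> t /itvP txy; apply: gd; rewrite !txy.
  - apply: derivable_within_continuous => u /itvP u1.
    by have [] : is_derive u 1 g (dg u) by apply: gd; rewrite !u1.
  have cc : x <= c <= y by move: cxy => /itvP cxy; rewrite !cxy.
  by apply: mulr_ge0; [exact: le_trans (normc_ge0 _) (fg _ cc)|rewrite subr_ge0 ltW].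
pose p s := Re (conjc v * f s) - normc v * g s.
have pd t : x <= t <= y ->
    is_derive t 1 p (Re (conjc v * df t) - normc v * dg t).
  move=> txy; have [h1 _] := cderMc (conjc v) (fd _ txy).
  apply: is_derive_ext (is_deriveB h1 (is_deriveM (is_derive_cst (normc v) t 1) (gd _ txy))) => //.
  by rewrite /GRing.scale /=; ring.
have [||c cxy pE] := @MVT R p (fun t => Re (conjc v * df t) - normc v * dg t) x y xy.
- by move=> t /itvP txy; apply: pd; rewrite !txy.
- apply: derivable_within_continuous => u /itvP u1.
  by have [] := pd u _; rewrite ?u1.
have cc : x <= c <= y by move: cxy => /itvP cxy; rewrite !cxy.
have : p y - p x <= 0.
  rewrite pE pmulr_lle0 ?subr_gt0// subr_le0.
  rewrite (le_trans (ler_norm _))// (le_trans (normc_Re _))// normcM.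
  have -> : normc (conjc v) = normc v by case: (v) => a b /=; rewrite sqrrN.
  by rewrite ler_wpM2l ?normc_ge0 ?fg.
have -> : p y - p x = normc v * (normc v - (g y - g x)).
  rewrite /p; have -> : Re (conjc v * f y) = Re (conjc v * f x) + normc v ^+ 2.
    rewrite (_ : f y = f x + v); last by rewrite /v; ring.
    rewrite mulrDr ReD; congr (_ + _); rewrite normcE sqr_sqrtr ?addr_ge0 ?sqr_ge0//.
    by case: (v) => a b /=; ring.
  ring.
by rewrite pmulr_rle0 ?subr_le0// lt_def v0 normc_ge0.
Qed.

Lemma cder_lip f (df : R -> C) (K : R) (x y : R) : x <= y ->
  (forall t, x <= t <= y -> cder f t (df t)) ->
  (forall t, x <= t <= y -> normc (df t) <= K) ->
  normc (f y - f x) <= K * (y - x).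
Proof.
move=> xy fd fK; rewrite mulrBr.
apply: (cder_mvt (g := fun s => K * s) (dg := fun=> K) xy fd _ fK) => t _.
apply: is_derive_ext (is_deriveM (is_derive_cst K t 1) (is_derive_id t 1)) => //.
by rewrite /GRing.scale /= /cst; ring.
Qed.

End Derivative.

(** * Roots of unity and the exponential series *)

Section RootsOfUnity.
Variable R : realType.
Local Notation C := R[i].

Lemma expC_2pi_frac_neq1 (x : R) : 0 < x < 1 ->
  expC (2 * ('i * piC R) * x%:C) != 1.
Proof.
move=> /andP[x0 x1]; apply/eqP => /(congr1 (@complex.Re R)).
have -> : 2 * ('i * piC R) * x%:C = 'i * ((pi * x) *+ 2)%:C.
  by rewrite /piC -[(pi * x) *+ 2]mulr_natr !rmorphM rmorph_nat; ring.
rewrite Re_expC Re1 ReiM ImiM ReR ImR oppr0 expR0 mul1r cos_mulr2n => h.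
have : cos (pi * x) ^+ 2 = 1 by move: h; rewrite mulr2n; lra.
rewrite cos2sin2 => s0; have /eqP : sin (pi * x) ^+ 2 = 0 by lra.
rewrite sqrf_eq0 gt_eqF// sin_gt0_pi// mulr_gt0 ?pi_gt0//=.
by rewrite -[ltRHS]mulr1 ltr_pM2l ?pi_gt0.
Qed.

Definition omega m : C := expC (2 * ('i * piC R) / m%:R).

Lemma omegaX m k : omega m ^+ k = expC (2 * ('i * piC R) * (k%:R / m%:R)).
Proof. by rewrite /omega -expC_nat; congr expC; ring. Qed.

Lemma omega_expn m : (0 < m)%N -> omega m ^+ m = 1.
Proof.
move=> m0; rewrite omegaX divff ?mulr1 ?expC2ipi//.
by rewrite pnatr_eq0 -lt0n.
Qed.

Lemma omega_neq1 m k : (0 < k < m)%N -> omega m ^+ k != 1.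
Proof.
move=> /andP[k0 km]; rewrite omegaX.
have m0 : (0 < m)%N by exact: leq_trans km.
have -> : k%:R / m%:R = (k%:R / m%:R : R)%:C :> C by rewrite rmorphM fmorphV !rmorph_nat.
apply: expC_2pi_frac_neq1.
by rewrite divr_gt0 ?ltr0n//= ltr_pdivrMr ?ltr0n// mul1r ltr_nat.
Qed.

(** The order of omega divides m, and no smaller positive power of omega is 1. *)
Lemma omega_prim m : (0 < m)%N -> m.-primitive_root (omega m).
Proof.
move=> m0; have [k km pk] := prim_order_exists m0 (omega_expn m0).
have : (k <= m)%N by rewrite dvdn_leq.
rewrite leq_eqVlt => /predU1P[kE|lt]; first by rewrite -{1}kE.
have := @omega_neq1 m k; rewrite (prim_order_gt0 km) lt => /(_ isT).
by rewrite (prim_expr_order km) eqxx.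
Qed.

Lemma omega_neq0 m : omega m != 0.
Proof. exact: expC_neq0. Qed.

Lemma sum_unity_root (z : C) m : z ^+ m = 1 -> z != 1 -> \sum_(j < m) z ^+ j = 0.
Proof.
move=> zm z1; apply: (mulfI (x := z - 1)); first by rewrite subr_eq0.
by rewrite -subrX1 zm subrr mulr0.
Qed.

Lemma normc_omega m k : (0 < m)%N -> normc (omega m ^+ k) = 1.
Proof.
move=> m0; rewrite omegaX normc_expC.
have -> : k%:R / m%:R = (k%:R / m%:R : R)%:C :> C by rewrite rmorphM fmorphV !rmorph_nat.
rewrite (_ : 2 * _ * _ = 'i * (pi * 2 * (k%:R / m%:R))%:C).
  by rewrite ReiM ImR oppr0 expR0.
by rewrite /piC !rmorphM rmorph_nat fmorphV !rmorph_nat; ring.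
Qed.
End RootsOfUnity.

Section ExpSeries.
Variable R : realType.
Local Notation C := R[i].

Lemma exp_coeff_cvg0 (x : R) : (fun n => x ^+ n / n`!%:R) @ \oo --> (0 : R).
Proof. exact: cvg_series_cvg_0 (is_cvg_series_exp_coeff x). Qed.

(** Induction on the order: the remainder of order n + 1 vanishes at t = 0 and its
    derivative in t is h times the remainder of order n, so it is dominated by the
    primitive of the bound at order n. *)
Lemma expC_taylor (h : C) n (t : R) : 0 <= t <= 1 ->
  normc (expC (t%:C * h) - \sum_(k < n) (t%:C * h) ^+ k / k`!%:R)
  <= expR (normc h) * ((normc h * t) ^+ n / n`!%:R).
Proof.
elim: n t => [|n IH] t /andP[t0 t1].
  rewrite big_ord0 subr0 normc_expC expr0 fact0 divr1 mulr1 ler_expR ReRM.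
  rewrite (le_trans (ler_norm _))// normrM (ger0_norm t0).
  by rewrite (le_trans _ (normc_Re h))// ler_piMl.
pose r (s : R) := expC (s%:C * h) - \sum_(k < n.+1) (s%:C * h) ^+ k / k`!%:R.
pose g (s : R) := expR (normc h) * ((normc h * s) ^+ n.+1 / n.+1`!%:R).
have sd (s : R) : cder (fun u => u%:C * h) s h.
  apply: cder_ext (cderM (cder_id s) (cder_const s h)) => //.
  by rewrite mul1r mulr0 addr0.
have sX (s : R) k : cder (fun u => (u%:C * h) ^+ k.+1 / k.+1`!%:R) s
    (h * ((s%:C * h) ^+ k / k`!%:R)).
  have sX' : cder (fun u => (u%:C * h) ^+ k.+1) s (k.+1%:R * (h * (s%:C * h) ^+ k)).
    elim: k => [|k IHk].
      by apply: cder_ext (sd s) => [u|]; rewrite ?expr1// expr0; ring.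
    apply: cder_ext (cderM (sd s) IHk) => [u|]; first by rewrite [RHS]exprS.
    by rewrite !exprS -[k.+2%:R]natr1; ring.
  apply: cder_ext (cderM sX' (cder_const s _)) => //.
  rewrite mulr0 addr0 factS natrM; field.
  by rewrite nat1r !pnatr_eq0 -lt0n fact_gt0.
have rd s : cder r s (h * (expC (s%:C * h) - \sum_(k < n) (s%:C * h) ^+ k / k`!%:R)).
  rewrite mulrBr; apply: cderB; first exact: cder_exp.
  have : cder (fun u : R => 1 + \sum_(k < n) (u%:C * h) ^+ k.+1 / k.+1`!%:R) s
      (0 + \sum_(k < n) h * ((s%:C * h) ^+ k / k`!%:R)).
    apply: cderD; first exact: cder_const.
    elim: n {IH r g} => [|n IHn].
      by apply: cder_ext (cder_const s 0) => [u|]; rewrite big_ord0.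
    apply: cder_ext (cderD IHn (sX s n)) => [u|]; by rewrite big_ord_recr.
  apply: cder_ext => [u|]; last by rewrite add0r mulr_sumr.
  by rewrite big_ord_recl/= expr0 fact0 divr1.
have gd (s : R) : is_derive s (1 : R) g (normc h * (expR (normc h) * ((normc h * s) ^+ n / n`!%:R))).
  have g1 : is_derive s (1 : R) (fun u => normc h * u) (normc h).
    apply: is_derive_ext (is_deriveM (is_derive_cst (normc h) s 1) (is_derive_id s 1)) => //.
    by rewrite /GRing.scale /= /cst; ring.
  apply: is_derive_ext (is_deriveM (is_deriveX n.+1 g1)
     (is_derive_cst (expR (normc h) / n.+1`!%:R) s 1)) => [u|].
    by rewrite mulrfctE exprfctE /g /cst; ring.
  rewrite /GRing.scale /= /cst /= factS natrM mulr0 add0r -mulr_natr; field.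
  by rewrite nat1r !pnatr_eq0 -lt0n fact_gt0.
have r0 : r 0 = 0.
  rewrite /r big_ord_recl /= mul0r expC0 expr0 fact0 divr1 big1 ?addr0 ?subrr// => k _.
  by rewrite exprS !mul0r.
have g0 : g 0 = 0 by rewrite /g mulr0 exprS !mul0r mulr0.
have := @cder_mvt R r _ g _ 0 t t0 (fun s _ => rd s) (fun s _ => gd s).
rewrite r0 g0 !subr0; apply => s /andP[s0 st].
by rewrite normcM ler_wpM2l ?normc_ge0// IH// s0 (le_trans st).
Qed.

Lemma expC_series (h : C) : clim (series (fun n => h ^+ n / n`!%:R)) (expC h).
Proof.
apply: (clim_le (m := 0) (b := fun n => expR (normc h) * (normc h ^+ n / n`!%:R))).
  move=> n _; rewrite normcB /series /= big_mkord.
  have := @expC_taylor h n 1; rewrite lexx ler01 mul1r mulr1; exact.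
by rewrite -(mulr0 (expR (normc h))); apply: cvgMr; exact: exp_coeff_cvg0.
Qed.
End ExpSeries.

(** * Power series *)

Section RealHelpers.
Variable R : realType.

Lemma sum_geom_le (t : R) n m : 0 <= t < 1 -> (n <= m)%N ->
  \sum_(n <= k < m) t ^+ k <= t ^+ n / (1 - t).
Proof.
move=> /andP[t0 t1] nm; have t1' : 0 < 1 - t by rewrite subr_gt0.
suff -> : \sum_(n <= k < m) t ^+ k = (t ^+ n - t ^+ m) / (1 - t).
  by rewrite ler_pM2r ?invr_gt0// gerBl exprn_ge0.
elim: m nm => [|m IH]; first by rewrite leqn0 => /eqP ->; rewrite big_geq// subrr mul0r.
rewrite leq_eqVlt => /predU1P[->|]; first by rewrite big_geq// subrr mul0r.
rewrite ltnS => nm; rewrite big_nat_recr//= IH// exprS; field.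
by rewrite gt_eqF.
Qed.

Lemma cvg_geom0 (c t : R) : 0 <= t < 1 -> (fun n => c * t ^+ n) @ \oo --> (0 : R).
Proof.
by move=> /andP[t0 t1]; apply: cvg_geometric; rewrite ger0_norm.
Qed.

Lemma le_lim0 (x B : R) (v : nat -> R) m : v @ \oo --> (0 : R) ->
  (forall n, (m <= n)%N -> x <= B + v n) -> x <= B.
Proof.
move=> v0 xB; have : (fun n => B + v n) @ \oo --> B + 0 by apply: cvgD => //; exact: cvg_cst.
rewrite addr0 => h; apply: (@ler_cvg_to _ _ _ _ (fun=> x) _ _ _ (cvg_cst x) h).
by exists m => // n /= /xB.
Qed.

Lemma natX2 n : (n.+1%:R : R) <= 2 ^+ n.
Proof. by rewrite -natrX ler_nat ltn_expl. Qed.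
End RealHelpers.

Section PowerSeries.
Variable R : realType.
Local Notation C := R[i].
Implicit Types (f g : C -> C) (z h : C) (a b : nat -> C) (rho M : R).

Definition ps_sum a h n : C := \sum_(k < n) a k * h ^+ k.

(** The bound |a n| rho^n <= M is part of the data: it gives explicit remainders,
    and it is what survives sums, products and limits. *)
Definition ps f z a rho M : Prop :=
  [/\ 0 < rho, forall n, normc (a n) * rho ^+ n <= M &
      forall h, normc h < rho -> clim (ps_sum a h) (f (z + h))].

Definition ana f z : Prop := exists a rho M, ps f z a rho M.

Lemma ps_M f z a rho M : ps f z a rho M -> 0 <= M.
Proof. by case=> r0 /(_ 0) + _; apply: le_trans; rewrite mulr_ge0 ?normc_ge0 ?expr0. Qed.

Lemma ps_theta h rho : normc h < rho -> 0 <= normc h / rho < 1.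
Proof.
move=> hr; have r0 : 0 < rho by exact: le_lt_trans (normc_ge0 h) hr.
by rewrite divr_ge0 ?normc_ge0 ?ltW//= ltr_pdivrMr// mul1r.
Qed.

Lemma ps_term f z a rho M h k : ps f z a rho M ->
  normc (a k * h ^+ k) <= M * (normc h / rho) ^+ k.
Proof.
case=> r0 aM _; rewrite normcM normcX.
have -> : normc h ^+ k = rho ^+ k * (normc h / rho) ^+ k.
  by rewrite -exprMn mulrC divfK ?gt_eqF.
by rewrite mulrA ler_wpM2r ?aM ?exprn_ge0 ?divr_ge0 ?normc_ge0 ?ltW.
Qed.

Lemma ps_rem f z a rho M h n : ps f z a rho M -> normc h < rho ->
  normc (f (z + h) - ps_sum a h n) <=
    M * ((normc h / rho) ^+ n / (1 - normc h / rho)).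
Proof.
move=> fa hr; have [r0 aM fc] := fa.
apply: (clim_lec (m := n)) (climB (fc h hr) (clim_const (ps_sum a h n))) => m nm.
rewrite /ps_sum -!(big_mkord xpredT (fun k => a k * h ^+ k)).
rewrite (big_cat_nat (leq0n n) nm)/= addrAC subrr add0r.
rewrite (le_trans (normc_sum _ _ _))//.
rewrite (le_trans (ler_sum _ (fun k _ => ps_term h k fa)))// -mulr_sumr.
by rewrite ler_wpM2l ?(ps_M fa)// sum_geom_le// ps_theta.
Qed.

Lemma ps_shrink f z a rho M r : 0 < r -> r <= rho -> ps f z a rho M ->
  ps f z a r M.
Proof.
move=> r0 rr [rho0 aM fc]; split=> // [n|h hr]; last by apply: fc; exact: lt_le_trans hr rr.
by rewrite (le_trans _ (aM n))// ler_wpM2l ?normc_ge0// lerXn2r ?nnegrE ?(ltW r0) ?(ltW rho0).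
Qed.

Lemma series_ps_sum a h : series (fun n => a n * h ^+ n) = ps_sum a h.
Proof. by apply/funext => n; rewrite /series /= big_mkord. Qed.

(** The terms of a convergent series are bounded, which bounds the coefficients at
    half the radius. *)
Lemma analytic_ana f z : analytic_at f z -> ana f z.
Proof.
move=> /analytic_atP[a [e0 /gt0_ReC[]]]; move: (Re e0) => e ep -> fa.
have fc h : normc h < e -> clim (ps_sum a h) (f (z + h)).
  move=> he; rewrite -series_ps_sum; apply/converges_to_clim.
  have hE : z + h - z = h by ring.
  have -> : (fun n => a n * h ^+ n) = (fun n => a n * (z + h - z) ^+ n) by rewrite hE.
  by apply: fa; rewrite opprD addrA subrr sub0r normc_lt normcN.
have e2 : 0 < e / 2 by lra.
have h2 : normc ((e / 2)%:C : C) = e / 2 by rewrite normc_real gtr0_norm.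
have [|M M0 aM] := clim_bounded (fc (e / 2)%:C _); first by rewrite h2; lra.
exists a, (e / 2), (M + M); split=> // [n|h he]; last by apply: fc; lra.
have -> : normc (a n) * (e / 2) ^+ n = normc (ps_sum a (e / 2)%:C n.+1 - ps_sum a (e / 2)%:C n).
  by rewrite /ps_sum big_ord_recr /= [_ + _ - _]addrAC subrr add0r normcM normcX h2.
by rewrite (le_trans (le_normcD _ _))// normcN lerD.
Qed.

Lemma ps_ext f g z a rho M d : 0 < d -> (forall h, normc h < d -> f (z + h) = g (z + h)) ->
  ps f z a rho M -> ps g z a (Num.min d rho) M.
Proof.
move=> d0 fg fa; have [r0 _ _] := fa.
have m0 : 0 < Num.min d rho by rewrite lt_min d0.
have mr : Num.min d rho <= rho by rewrite ge_min lexx orbT.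
have [_ aM fc] := ps_shrink m0 mr fa; split=> // h hm.
rewrite -fg; first exact: fc.
by move: hm; rewrite lt_min => /andP[].
Qed.

Lemma ana_ext f g z d : 0 < d -> (forall h, normc h < d -> f (z + h) = g (z + h)) ->
  ana f z -> ana g z.
Proof.
by move=> d0 fg [a [rho [M /(ps_ext d0 fg) ?]]]; exists a, (Num.min d rho), M.
Qed.

(** If a k is the first nonzero coefficient, then the remainder of order k + 1 is
    smaller than a k * h^k as soon as h is small and nonzero. *)
Lemma ps_dichotomy f z a rho M : ps f z a rho M ->
  (forall n, a n = 0) \/
  exists2 d : R, 0 < d & forall h, 0 < normc h < d -> f (z + h) != 0.
Proof.
move=> fa; have [r0 aM fc] := fa.
have [a0|/existsNP[n0 /eqP an0]] := pselect (forall n, a n = 0).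
  by left.
right; have exn : exists n, a n != 0 by exists n0.
have [k ak kmin] := ex_minnP exn.
have aj j : (j < k)%N -> a j = 0.
  by move=> jk; apply/eqP; apply: contraLR jk => /kmin; rewrite -leqNgt.
have nk : 0 < normc (a k) by rewrite normc_gt0.
have M0 := ps_M fa.
pose B := normc (a k) * rho ^+ k.
have B0 : 0 < B by rewrite mulr_gt0 ?exprn_gt0.
have MB : 0 < M + B by rewrite ltr_wpDl.
exists (Num.min (rho / 2) (rho * (B / (M + B)) / 4)).
  by rewrite lt_min !divr_gt0// mulr_gt0// divr_gt0.
move=> h; rewrite lt_min => /and3P[h0 h1 h2].
have hr : normc h < rho by lra.
have := ps_rem k.+1 fa hr; set t := normc h / rho.
have -> : ps_sum a h k.+1 = a k * h ^+ k.
  rewrite /ps_sum big_ord_recr /= big1 ?add0r// => i _.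
  by rewrite aj ?mul0r.
move=> H; apply/eqP => f0; move: H.
rewrite f0 sub0r normcN normcM normcX leNgt => /negP; apply.
have t0 : 0 < t by rewrite divr_gt0.
have t2 : t < 1 / 2 by rewrite ltr_pdivrMr//; lra.
have tB : t * (M + B) < B / 4.
  rewrite /t mulrAC ltr_pdivrMr// -ltr_pdivlMr//; move: h2.
  by rewrite (_ : rho * _ / 4 = B / 4 * rho / (M + B)); last by ring.
have -> : normc (a k) * normc h ^+ k = B * t ^+ k.
  by rewrite /B /t expr_div_n; field; rewrite expf_neq0// gt_eqF.
rewrite exprSr mulrA mulrA ltr_pdivrMr; last lra.
rewrite mulrAC mulrC [ltRHS]mulrAC [ltRHS]mulrC ltr_pM2l ?exprn_gt0//.
by nra.
Qed.

Lemma ps_zero f z a rho M h : (forall n, a n = 0) -> ps f z a rho M ->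
  normc h < rho -> f (z + h) = 0.
Proof.
move=> a0 [_ _ fc] /fc fh; apply: clim_uniq fh _.
apply: (clim_ext (m := 0)) (clim_const 0) => n _.
by rewrite /ps_sum big1// => i _; rewrite a0 mul0r.
Qed.

Lemma ana_dichotomy f z : ana f z -> exists2 d : R, 0 < d &
  (forall h, normc h < d -> f (z + h) = 0) \/
  (forall h, 0 < normc h < d -> f (z + h) != 0).
Proof.
move=> [a [rho [M fa]]]; have [r0 _ _] := fa.
have [a0|[d d0 df]] := ps_dichotomy fa; last by exists d => //; right.
by exists rho => //; left => h; exact: ps_zero fa.
Qed.

Lemma ps_uniq0 f z a rho M d : ps f z a rho M -> 0 < d ->
  (forall h, normc h < d -> f (z + h) = 0) -> forall n, a n = 0.
Proof.
move=> fa d0 f0; have [//|[e e0 fe]] := ps_dichotomy fa.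
pose h : C := (Num.min d e / 2)%:C.
have m0 : 0 < Num.min d e by rewrite lt_min d0.
have hE : normc h = Num.min d e / 2 by rewrite normc_real gtr0_norm// divr_gt0.
have md : Num.min d e <= d by rewrite ge_min lexx.
have me : Num.min d e <= e by rewrite ge_min lexx orbT.
have hh : 0 < normc h < e by rewrite hE; apply/andP; split; lra.
by have := fe h hh; rewrite f0 ?eqxx// hE; lra.
Qed.

Lemma psD f g z a b rho M N : ps f z a rho M -> ps g z b rho N ->
  ps (fun w => f w + g w) z (fun n => a n + b n) rho (M + N).
Proof.
move=> [r0 aM fc] [_ bN gc]; split=> // [n|h hr].
  have rn : 0 <= rho ^+ n by rewrite exprn_ge0// ltW.
  by rewrite (le_trans (ler_wpM2r rn (le_normcD _ _)))// [leLHS]mulrDl lerD.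
apply: (clim_ext (m := 0)) (climD (fc h hr) (gc h hr)) => n _.
by rewrite /ps_sum -big_split/=; apply: eq_bigr => i _; rewrite mulrDl.
Qed.

Lemma psZ f z a rho M k : ps f z a rho M ->
  ps (fun w => k * f w) z (fun n => k * a n) rho (normc k * M).
Proof.
move=> [r0 aM fc]; split=> // [n|h hr].
  by rewrite normcM -mulrA ler_wpM2l ?normc_ge0.
apply: (clim_ext (m := 0)) (climMc k (fc h hr)) => n _.
by rewrite /ps_sum mulr_sumr; apply: eq_bigr => i _; rewrite mulrA.
Qed.

Lemma ps_const k z rho : 0 < rho -> ps (fun=> k) z (fun n => k *+ (n == 0%N)) rho (normc k).
Proof.
move=> r0; split=> // [[|n]|h _].
- by rewrite expr0 mulr1 mulr1n.
- by rewrite mulr0n normc0 mul0r normc_ge0.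
apply: (clim_ext (m := 1)) (clim_const k) => -[//|n] _.
rewrite /ps_sum big_ord_recl/= expr0 mulr1 mulr1n big1 ?addr0// => i _.
by rewrite mulr0n mul0r.
Qed.

(** The Cauchy product of two coefficient sequences. *)
Definition conv a b n : C := \sum_(i < n.+1) a i * b (n - i)%N.

Lemma conv_bound f g z a b rho M N : ps f z a rho M -> ps g z b rho N -> forall n,
  normc (conv a b n) * rho ^+ n <= n.+1%:R * (M * N).
Proof.
move=> [r0 aM _] [_ bN _] n.
have rn : 0 <= rho ^+ n by rewrite exprn_ge0// ltW.
rewrite (le_trans (ler_wpM2r rn (normc_sum _ _ _)))//.
rewrite mulr_suml mulr_natl -[in leRHS](card_ord n.+1) -sumr_const.
apply: ler_sum => i _; rewrite normcM.
have -> : rho ^+ n = rho ^+ i * rho ^+ (n - i) by rewrite -exprD subnKC// -ltnS.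
by rewrite mulrACA ler_pM// mulr_ge0 ?normc_ge0 ?exprn_ge0 ?ltW.
Qed.

(** The coefficients of the product are bounded by (n + 1) M N / rho^n: the factor
    n + 1 is absorbed by halving the radius. *)
Lemma psM f g z a b rho M N : ps f z a rho M -> ps g z b rho N ->
  ps (fun w => f w * g w) z (conv a b) (rho / 2) (M * N).
Proof.
move=> fa gb; have [r0 aM fc] := fa; have [_ bN gc] := gb.
have M0 := ps_M fa; have N0 := ps_M gb.
split=> [|n|h hr]; first lra.
  rewrite expr_div_n mulrA ler_pdivrMr ?exprn_gt0// (le_trans (conv_bound fa gb n))//.
  by rewrite mulrC ler_wpM2l ?mulr_ge0// natX2.
have hr' : normc h < rho by lra.
have := climM (fc h hr') (gc h hr').
set t := normc h / rho.
have t01 : 0 <= t < 1 by exact: ps_theta.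
have t2 : 0 <= t * 2 < 1.
  by rewrite /t mulrAC divr_ge0 ?mulr_ge0 ?normc_ge0 ?ltW//= ltr_pdivrMr//; lra.
have t0 : 0 <= t by case/andP: t01.
move=> H.
(* the two partial sums differ by the terms of total degree at least n *)
have D : clim (fun n => ps_sum (conv a b) h n - ps_sum a h n * ps_sum b h n) 0.
  apply: (clim_le (m := 0) (b := fun n => M * N / (1 - t) * (t * 2) ^+ n)); last exact: cvg_geom0.
  move=> n _; rewrite subr0.
  have -> : ps_sum (conv a b) h n = \sum_(i < n) a i * h ^+ i * ps_sum b h (n - i).
    rewrite /ps_sum; elim: n => [|n IH]; first by rewrite !big_ord0.
    rewrite big_ord_recr IH /= [RHS]big_ord_recr /=.
    have -> : \sum_(i < n) a i * h ^+ i * (\sum_(k < n.+1 - i) b k * h ^+ k) =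
        \sum_(i < n) (a i * h ^+ i * (\sum_(k < n - i) b k * h ^+ k)
           + a i * b (n - i)%N * h ^+ n).
      apply: eq_bigr => i _; rewrite subSn 1?ltnW// big_ord_recr /= mulrDr.
      have -> : h ^+ n = h ^+ i * h ^+ (n - i) by rewrite -exprD subnKC// ltnW.
      by ring.
    rewrite big_split /= -addrA; congr (_ + _).
    rewrite /conv big_ord_recr /= subnn mulrDl mulr_suml subSnn; congr (_ + _).
    by rewrite big_ord_recr big_ord0 /= expr0; ring.
  rewrite /ps_sum mulr_suml -sumrB (le_trans (normc_sum _ _ _))//.
  have E (i : 'I_n) : normc (a i * h ^+ i * (\sum_(k < n - i) b k * h ^+ k)
      - a i * h ^+ i * (\sum_(k < n) b k * h ^+ k)) <= M * N / (1 - t) * t ^+ n.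
    rewrite -mulrBr normcM normcB -!(big_mkord xpredT (fun k => b k * h ^+ k)).
    rewrite (big_cat_nat (leq0n (n - i)) (leq_subr i n))/= addrAC subrr add0r.
    have -> : M * N / (1 - t) * t ^+ n = (M * t ^+ i) * (N * (t ^+ (n - i) / (1 - t))).
      have -> : t ^+ n = t ^+ i * t ^+ (n - i) by rewrite -exprD subnKC// ltnW.
      by ring.
    rewrite ler_pM ?normc_ge0//; first exact: ps_term fa.
    rewrite (le_trans (normc_sum _ _ _))//.
    rewrite (le_trans (ler_sum _ (fun k _ => ps_term h k gb)))// -mulr_sumr.
    by rewrite ler_wpM2l// sum_geom_le// leq_subr.
  rewrite (le_trans (ler_sum _ (fun i _ => E i)))// sumr_const card_ord -[leLHS]mulr_natr.
  rewrite [(t * 2) ^+ n]exprMn [leRHS]mulrA ler_wpM2l//.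
    rewrite mulr_ge0 ?exprn_ge0// divr_ge0 ?mulr_ge0// subr_ge0 ltW//.
    by case/andP: t01.
  by rewrite (le_trans _ (natX2 R n))// ler_nat.
have := climD D H; rewrite add0r; apply: (clim_ext (m := 0)) => n _.
by rewrite subrK.
Qed.

Lemma ps_common f g z : ana f z -> ana g z -> exists a b rho M N,
  ps f z a rho M /\ ps g z b rho N.
Proof.
move=> [a [r [M fa]]] [b [s [N gb]]].
have [r0 _ _] := fa; have [s0 _ _] := gb.
have m0 : 0 < Num.min r s by rewrite lt_min r0.
exists a, b, (Num.min r s), M, N; split.
  by apply: ps_shrink fa; rewrite // ge_min lexx.
by apply: ps_shrink gb; rewrite // ge_min lexx orbT.
Qed.

Lemma anaD f g z : ana f z -> ana g z -> ana (fun w => f w + g w) z.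
Proof.
move=> /ps_common/[apply]-[a [b [r [M [N [/psD/[apply]]]]]]] fg.
by eexists; exists r, (M + N); exact: fg.
Qed.

Lemma anaM f g z : ana f z -> ana g z -> ana (fun w => f w * g w) z.
Proof.
move=> /ps_common/[apply]-[a [b [r [M [N [/psM/[apply]]]]]]] fg.
by eexists; exists (r / 2), (M * N); exact: fg.
Qed.

Lemma ana_const k z : ana (fun=> k) z.
Proof. by eexists; exists 1, (normc k); apply: ps_const. Qed.

Lemma anaN f z : ana f z -> ana (fun w => - f w) z.
Proof.
move=> fa; have := anaM (ana_const (-1) z) fa.
by apply: (ana_ext (d := 1)) => // h _; rewrite mulN1r.
Qed.

Lemma anaB f g z : ana f z -> ana g z -> ana (fun w => f w - g w) z.
Proof. by move=> fa /anaN; exact: anaD. Qed.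

Lemma ps_id z rho : 0 < rho ->
  ps id z (fun n => if n is 0%N then z else (n == 1%N)%:R) rho (normc z + rho).
Proof.
move=> r0; split=> // [[|[|n]]|h _].
- by rewrite expr0 mulr1 lerDl ltW.
- by rewrite [normc _](normc1 R) mul1r expr1 lerDr normc_ge0.
- by rewrite [normc _](normc0 R) mul0r addr_ge0 ?normc_ge0 ?ltW.
apply: (clim_ext (m := 2)) (clim_const _) => -[//|[//|n]] _.
rewrite /ps_sum 2!big_ord_recl/= expr0 mulr1 expr1 mul1r big1 ?addr0// => i _.
by rewrite mul0r.
Qed.

Lemma ana_id z : ana id z.
Proof. by eexists; exists 1, (normc z + 1); exact: ps_id. Qed.

Lemma ana_shift f z w : ana f (z + w) -> ana (fun x => f (x + w)) z.
Proof.
move=> [a [r [M [r0 aM fc]]]]; exists a, r, M; split=> // h hr.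
by rewrite addrAC; exact: fc.
Qed.

Lemma ps_exp (c z : C) (rho : R) : 0 < rho -> exists M : R,
  ps (fun s => expC (c * s)) z (fun n => expC (c * z) * (c ^+ n / n`!%:R)) rho M.
Proof.
move=> r0.
have : clim (fun n => ((normc c * rho) ^+ n / n`!%:R)%:C) 0.
  exact: clim_real (exp_coeff_cvg0 _).
move=> /clim_bounded[M M0 cM]; exists (normc (expC (c * z)) * M); split=> // [n|h _].
  rewrite normcM -mulrA ler_wpM2l ?normc_ge0// (le_trans _ (cM n))// normc_real.
  rewrite ger0_norm.
    by rewrite exprMn normcM normcX normcV normc_nat mulrAC.
  by rewrite divr_ge0// exprn_ge0// mulr_ge0 ?normc_ge0// ltW.
rewrite mulrDr expCD; apply: (clim_ext (m := 0)) (climMc _ (expC_series (c * h))) => n _.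
rewrite /series /= big_mkord mulr_sumr; apply: eq_bigr => i _.
by rewrite exprMn; ring.
Qed.

(** Averaging w^(- j k) f (z + r w^j) over the m-th roots of unity w^j isolates
    the coefficient a k, up to the remainder of order m of the series, which tends
    to 0 with m: no integral is involved. *)
Lemma cauchy_estimate f z a rho M (r B : R) k : ps f z a rho M -> 0 < r < rho ->
  (forall h, normc h = r -> normc (f (z + h)) <= B) -> normc (a k) * r ^+ k <= B.
Proof.
move=> fa /andP[r0 rr] fB; have [rho0 aM fc] := fa.
have t01 : 0 <= r / rho < 1.
  by rewrite divr_ge0 ?ltW//= ltr_pdivrMr// mul1r.
apply: (@le_lim0 _ _ _ (fun m => M / (1 - r / rho) * (r / rho) ^+ m) k.+1).
  exact: cvg_geom0.
move=> m km; have m0 : (0 < m)%N by exact: leq_trans km.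
have mR : 0 < (m%:R : R) by rewrite ltr0n.
pose w := omega R m.
have w0 : w != 0 by exact: omega_neq0.
have wp : m.-primitive_root w by exact: omega_prim.
have nw : normc w = 1 by rewrite -[w]expr1 normc_omega.
clearbody w.
pose h (j : 'I_m) : C := r%:C * w ^+ j.
have hE j : normc (h j) = r.
  by rewrite normcM normcX nw expr1n mulr1 normc_real gtr0_norm.
have S : \sum_(j < m) ps_sum a (h j) m * w ^- (j * k) = m%:R * (a k * r%:C ^+ k).
  under eq_bigr do rewrite mulr_suml.
  rewrite exchange_big /= (bigD1 (Ordinal km)) //= [X in _ + X]big1 ?addr0.
    rewrite -[in RHS](card_ord m) mulr_natl -sumr_const; apply: eq_bigr => j _.
    rewrite /h exprMn -exprM; field.
    by rewrite expf_neq0.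
  move=> l lk.
  have -> : \sum_(j < m) a l * h j ^+ l * w ^- (j * k) =
      a l * r%:C ^+ l * \sum_(j < m) (w ^+ l / w ^+ k) ^+ j.
    rewrite mulr_sumr; apply: eq_bigr => j _.
    rewrite /h !exprMn exprVn -!exprM [(l * j)%N]mulnC [(k * j)%N]mulnC; ring.
  rewrite sum_unity_root ?mulr0//.
    by rewrite exprMn exprVn -!exprM ![(_ * m)%N]mulnC !exprM (prim_expr_order wp) !expr1n divr1.
  apply/negP => /eqP lk1; move/negP: lk; apply.
  have : w ^+ l = w ^+ k.
    by rewrite -[RHS]mul1r -lk1 mulfVK// expf_neq0.
  move=> /eqP; rewrite (eq_prim_root_expr wp) => /eqP.
  rewrite !modn_small// => lk'; exact/eqP/val_inj.
rewrite -(ler_pM2l mR).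
have <- : normc (m%:R * (a k * r%:C ^+ k)) = m%:R * (normc (a k) * r ^+ k).
  by rewrite !normcM normcX normc_nat normc_real gtr0_norm.
rewrite -S (le_trans (normc_sum _ _ _))// mulr_natl -[in leRHS](card_ord m) -sumr_const.
apply: ler_sum => j _.
rewrite normcM normcV normcX nw expr1n invr1 mulr1.
have := normcDl (ps_sum a (h j) m) (f (z + h j) - ps_sum a (h j) m).
rewrite subrKC => /le_trans; apply; rewrite lerD ?fB//.
have := ps_rem (h := h j) m fa; rewrite hE => /(_ rr).
by move=> H; rewrite (le_trans H)// [leLHS]mulrA [leLHS]mulrAC card_ord.
Qed.
End PowerSeries.

(** * The identity theorem and the Weierstrass theorem *)

Section AnalyticContinuation.
Variable R : realType.
Local Notation C := R[i].
Implicit Types (f g : C -> C) (z h : C) (a b : nat -> C) (rho M : R).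

Lemma ps_center f z a rho M : ps f z a rho M -> f z = a 0%N.
Proof.
case=> r0 _ /(_ 0); rewrite normc0 addr0 => /(_ r0) fz.
apply: clim_uniq fz _; apply: (clim_ext (m := 1)) (clim_const _) => -[//|n] _.
by rewrite /ps_sum big_ord_recl/= expr0 mulr1 big1 ?addr0// => i _; rewrite exprS mul0r mulr0.
Qed.

Lemma ps_derivative f z a rho M : ps f z a rho M -> derivative_at f z = a 1%N.
Proof.
move=> fa; have [r0 aM fc] := fa; have M0 := ps_M fa.
apply: derivative_atE => e' /gt0_ReC[]; move: (Re e') => e e0 ->.
pose d := Num.min (rho / 2) (e * rho ^+ 2 / (2 * M + 1)).
have M1 : 0 < 2 * M + 1 by lra.
have d0 : 0 < d by rewrite lt_min !divr_gt0// mulr_gt0// exprn_gt0.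
exists d%:C; first by rewrite ltcR.
move=> h h0; rewrite !normc_lt /d lt_min => /andP[hr he].
have nh : 0 < normc h by rewrite normc_gt0.
have hr' : normc h < rho by lra.
have := ps_rem 2 fa hr'; set t := normc h / rho.
rewrite /ps_sum !big_ord_recr big_ord0 /= add0r expr0 mulr1 expr1 -(ps_center fa).
have t2 : t <= 1 / 2 by rewrite ler_pdivrMr//; lra.
have t0 : 0 < t by rewrite divr_gt0.
rewrite (_ : a 1%N - _ = h^-1 * - (f (z + h) - (f z + a 1%N * h))); last first.
  by rewrite [h + z]addrC; field.
move=> H; rewrite normcM normcN normcV mulrC ltr_pdivrMr// (le_lt_trans H)//.
apply: (@le_lt_trans _ _ (2 * M * t ^+ 2)).
  have X0 : 0 <= M * t ^+ 2 by rewrite mulr_ge0// exprn_ge0// ltW.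
  rewrite mulrA ler_pdivrMr ?subr_gt0; last lra.
  rewrite (_ : 2 * M * t ^+ 2 * (1 - t) = M * t ^+ 2 + M * t ^+ 2 * (1 - 2 * t)); last by ring.
  by rewrite lerDl mulr_ge0//; lra.
rewrite /t expr_div_n mulrA ltr_pdivrMr ?exprn_gt0// expr2 mulrA.
rewrite [ltRHS]mulrAC ltr_pM2r//.
apply: le_lt_trans (_ : (2 * M + 1) * normc h < _).
  by rewrite ler_wpM2r ?normc_ge0//; lra.
by rewrite mulrC -ltr_pdivlMr.
Qed.

(** The supremum of the initial segments on which P holds is attained and equal to
    1: near it, P holds everywhere or nowhere, and it holds arbitrarily close. *)
Lemma interval_induction (P : R -> Prop) : P 0 ->
  (forall t, 0 <= t <= 1 -> exists2 d : R, 0 < d &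
     (forall u, 0 <= u <= 1 -> `|u - t| < d -> P u) \/
     (forall u, 0 <= u <= 1 -> `|u - t| < d -> ~ P u)) -> P 1.
Proof.
move=> P0 Pt.
pose S := [set t : R | 0 <= t <= 1 /\ forall u, 0 <= u <= t -> P u].
have S0 : S 0.
  by split; rewrite ?lexx ?ler01// => u; rewrite -eq_le => /eqP <-.
have supS : has_sup S by split; [exists 0|exists 1 => t [/andP[]]].
have s0 : 0 <= sup S by apply: ub_le_sup => //; exact: supS.2.
have s1 : sup S <= 1 by apply: sup_le_ub; [exists 0|move=> t [/andP[]]].
have [|d d0 H] := Pt (sup S); first by rewrite s0.
have [t St td] := sup_adherent d0 supS.
have ts : t <= sup S by apply: ub_le_sup => //; exact: supS.2.
have [/andP[t0 t1] tP] := St.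
have Pt' : P t by apply: tP; rewrite t0 lexx.
have ts' : `|t - sup S| < d by rewrite distrC ger0_norm ?subr_ge0//; lra.
case: H => [H|/(_ t)]; last by rewrite t0 t1 => /(_ isT ts').
pose m := Num.min (sup S + d / 2) 1.
have m1 : m <= 1 by rewrite ge_min lexx orbT.
have m2 : m <= sup S + d / 2 by rewrite ge_min lexx.
have m0 : 0 <= m by rewrite le_min ler01 andbT; lra.
have Sm : S m.
  split=> [|u /andP[u0 um]]; first by rewrite m0.
  have [ut|ut] := leP u t; first by apply: tP; rewrite u0.
  apply: H; first by rewrite u0; lra.
  by rewrite ltr_norml; apply/andP; split; lra.
have ms : m <= sup S by apply: ub_le_sup => //; exact: supS.2.
have m1' : m = 1.
  by move: ms; rewrite /m; case: (leP (sup S + d / 2) 1) => // _; lra.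
by apply: Sm.2; rewrite m1' lexx ler01.
Qed.

Definition vanishes_near f z : Prop :=
  exists2 d : R, 0 < d & forall h, normc h < d -> f (z + h) = 0.

(** Near each point of the segment, f vanishes identically or has no zero but
    possibly that point: whether f vanishes near c t is thus locally constant in t,
    and interval_induction applies. *)
Lemma segment_identity f p q :
  (forall t : R, 0 <= t <= 1 -> ana f (p + t%:C * (q - p))) ->
  vanishes_near f p -> vanishes_near f q.
Proof.
move=> fa fp.
pose c (t : R) := p + t%:C * (q - p).
suff : vanishes_near f (c 1) by rewrite /c mul1r subrKC.
apply: (@interval_induction (fun t => vanishes_near f (c t))).
  by rewrite /c mul0r addr0.
move=> t t01; have [d d0 fd] := ana_dichotomy (fa t t01 : ana f (c t)).
have K0 : 0 < normc (q - p) + 1 by rewrite ltr_wpDl ?normc_ge0.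
exists (d / (normc (q - p) + 1)); first by rewrite divr_gt0.
have cd u : `|u - t| < d / (normc (q - p) + 1) -> normc (c u - c t) < d.
  rewrite ltr_pdivlMr// => ud.
  have -> : c u - c t = (u - t)%:C * (q - p) by rewrite /c rmorphB; ring.
  by rewrite normcM normc_real (le_lt_trans _ ud)// ler_wpM2l// lerDl.
case: fd => fd; [left|right] => u _ /cd ud.
  exists (d - normc (c u - c t)) => [|h hd]; first lra.
  have -> : c u + h = c t + (c u - c t + h) by ring.
  by apply: fd; have := le_normcD (c u - c t) h; lra.
move=> [e e0 fe]; have [cut|cut] := eqVneq (c u - c t) 0.
  pose m := Num.min d e.
  have m0 : 0 < m by rewrite lt_min d0.
  have md : m <= d by rewrite ge_min lexx.
  have me : m <= e by rewrite ge_min lexx orbT.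
  have nm : normc ((m / 2)%:C : C) = m / 2 by rewrite normc_real gtr0_norm// divr_gt0.
  have cE : c u = c t by apply/eqP; rewrite -subr_eq0 cut.
  have hm : 0 < normc ((m / 2)%:C : C) < d by rewrite nm; apply/andP; split; lra.
  have /eqP := fd _ hm; apply; rewrite -cE; apply: fe; rewrite nm; lra.
have := fd (c u - c t); rewrite ud normc_gt0 cut subrKC => /(_ isT)/eqP; apply.
by rewrite -[c u]addr0; apply: fe; rewrite normc0.
Qed.

(** The value is 0 where the sequence diverges. *)
Definition lim_fun (J : nat -> C -> C) z : C := xget 0 (clim (J ^~ z)).

Lemma lim_funP (J : nat -> C -> C) z l : clim (J ^~ z) l -> clim (J ^~ z) (lim_fun J z).
Proof. by move=> Jl; rewrite /lim_fun; case: xgetP => // /(_ l). Qed.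

Lemma tele_clim (u : nat -> C) (v : nat -> R) : (forall n, 0 <= v n) ->
  (forall n, normc (u n.+1 - u n) <= v n - v n.+1) ->
  exists2 l, clim u l & forall n, normc (l - u n) <= v n.
Proof.
move=> v0 uv; have [l sl lv] := series_tele v0 uv.
have E n : series (fun n => u n.+1 - u n) n = u n - u 0%N by rewrite /series/= telescope_sumr.
exists (l + u 0%N) => [|n].
  by apply: (clim_ext (m := 0)) (climD sl (clim_const (u 0%N))) => n _; rewrite E subrK.
by have := lv n; rewrite E opprB addrA.
Qed.

(** Cauchy estimates transfer the telescoping bound on J n.+1 - J n to each
    coefficient of the power series: the coefficients converge geometrically
    uniformly, and the limit series sums to the limit function. *)
Lemma weierstrass (J : nat -> C -> C) z (a : nat -> nat -> C) rho (M : nat -> R) (v : nat -> R) :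
  (forall n, ps (J n) z (a n) rho (M n)) ->
  (forall n h, normc h < rho -> normc (J n.+1 (z + h) - J n (z + h)) <= v n - v n.+1) ->
  (forall n, 0 <= v n) -> v @ \oo --> (0 : R) ->
  (forall h, normc h < rho -> clim (J ^~ (z + h)) (lim_fun J (z + h))) /\
  exists b N, ps (lim_fun J) z b (rho / 2) N /\ forall k, clim (a ^~ k) (b k).
Proof.
move=> Ja Jv v0 v_0; have [r0 _ _] := Ja 0%N.
pose r := rho / 2; have r1 : 0 < r by rewrite divr_gt0.
have Jc h : normc h < rho -> clim (J ^~ (z + h)) (lim_fun J (z + h)) /\
    forall n, normc (lim_fun J (z + h) - J n (z + h)) <= v n.
  move=> hr; have [l Jl lv] := tele_clim v0 (fun n => Jv n h hr).
  have Jl' := lim_funP Jl.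
  by rewrite (clim_uniq Jl' Jl); split.
split=> [h /Jc[]//|].
have /choice[b bP] k : exists b0 : C, clim (a ^~ k) b0 /\
    forall n, normc (b0 - a n k) * r ^+ k <= v n.
  have rk : 0 < r ^+ k by rewrite exprn_gt0.
  have dv n : normc (a n.+1 k - a n k) <= v n / r ^+ k - v n.+1 / r ^+ k.
    rewrite -mulrBl ler_pdivlMr//.
    have := psD (Ja n.+1) (psZ (-1) (Ja n)).
    move=> /(@cauchy_estimate _ _ _ _ _ _ r (v n - v n.+1) k).
    rewrite mulN1r; apply=> [|h hr]; first by rewrite r1 /r; lra.
    by rewrite mulN1r Jv// hr /r; lra.
  have [b0 ab bv] := tele_clim (fun n => divr_ge0 (v0 n) (ltW rk)) dv.
  by exists b0; split=> // n; rewrite -ler_pdivlMr.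
have ba k := (bP k).1; have bv k := (bP k).2.
exists b, (M 0%N + v 0%N); split=> //; split=> // [k|h hr].
  have rr : r <= rho by rewrite /r; lra.
  have [_ aM _] := ps_shrink r1 rr (Ja 0%N).
  have rk : 0 <= r ^+ k by rewrite exprn_ge0 ?ltW.
  rewrite -{1}(subrKC (a 0%N k) (b k)) (le_trans (ler_wpM2r rk (le_normcD _ _)))//.
  by rewrite mulrDl lerD.
have hr' : normc h < rho by rewrite /r in hr; lra.
have t01 := ps_theta hr; set t := normc h / r in t01.
have [Jh Jhv] := Jc h hr'.
apply/climP => e e0.
have [|n0 n0P] := (iffLR (climP (fun n => (v n)%:C) 0) (clim_real v_0)) (e * (1 - t) / 4).
  by rewrite divr_gt0// mulr_gt0// subr_gt0; case/andP: t01.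
have := n0P n0 (leqnn _); rewrite subr0 normc_real ger0_norm// => vn.
have [_ _ /(_ h hr')] := Ja n0; rewrite climP => /(_ (e / 4)); case=> [|m mP]; first lra.
exists m => K /mP H1.
have t1 : 0 < 1 - t by rewrite subr_gt0; case/andP: t01.
have H2 : normc (ps_sum b h K - ps_sum (a n0) h K) <= v n0 / (1 - t).
  rewrite /ps_sum -sumrB (le_trans (normc_sum _ _ _))//.
  have E (i : 'I_K) : normc (b i * h ^+ i - a n0 i * h ^+ i) <= v n0 * t ^+ i.
    rewrite -mulrBl normcM normcX.
    have -> : normc h ^+ i = r ^+ i * t ^+ i by rewrite -exprMn mulrC divfK ?gt_eqF.
    by rewrite mulrA ler_wpM2r ?exprn_ge0 ?bv//; case/andP: t01.
  rewrite (le_trans (ler_sum _ (fun i _ => E i)))// -mulr_sumr ler_wpM2l//.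
  rewrite -(big_mkord xpredT (fun k => t ^+ k)).
  by have := @sum_geom_le R t 0 K t01 (leq0n _); rewrite expr0 div1r.
have H3 := Jhv n0.
have H4 : v n0 / (1 - t) < e / 4 by rewrite ltr_pdivrMr// mulrAC.
have H5 : v n0 <= v n0 / (1 - t).
  by rewrite ler_pdivlMr// ler_piMr// gerBl; case/andP: t01.
rewrite (_ : _ - _ = (ps_sum b h K - ps_sum (a n0) h K) +
  ((ps_sum (a n0) h K - J n0 (z + h)) + (J n0 (z + h) - lim_fun J (z + h)))); last by ring.
have N1 := le_normcD (ps_sum b h K - ps_sum (a n0) h K)
  ((ps_sum (a n0) h K - J n0 (z + h)) + (J n0 (z + h) - lim_fun J (z + h))).
have N2 := le_normcD (ps_sum (a n0) h K - J n0 (z + h)) (J n0 (z + h) - lim_fun J (z + h)).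
rewrite [normc (J n0 _ - lim_fun _ _)]normcB in N2; lra.
Qed.
End AnalyticContinuation.

(** * Continuation of the Hurwitz series by the trapezoidal rule *)

Section PowerBounds.
Variable R : realType.
Local Notation C := R[i].

Lemma ln_normc_ge (Y : C) (c q : R) : 0 < c -> 0 < q -> c * q <= Re Y ->
  ln c + ln q <= ln (normc Y).
Proof.
move=> c0 q0 cY; rewrite -lnM ?posrE// ler_ln ?posrE ?mulr_gt0//.
  by rewrite (le_trans cY)// (le_trans (ler_norm _))// normc_Re.
by rewrite (lt_le_trans _ (le_trans (ler_norm _) (normc_Re Y)))//
  (lt_le_trans _ cY)// mulr_gt0.
Qed.

(** |Y^(-s)| = exp (- Re s * ln |Y| + Im s * arg Y), where ln |Y| >= ln c + ln q,
    and |arg Y| <= 2 absorbs the imaginary part of s. *)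
Lemma pow_bound (Y s : C) (c q p A : R) : 0 < c <= 1 -> 1 <= q ->
  c * q <= Re Y -> 0 <= p <= Re s -> normc s <= A ->
  normc (expC (- logC Y * s)) <= expR ((2 - ln c) * A) * expR (- (p * ln q)).
Proof.
move=> /andP[c0 c1] q1 cY /andP[p0 ps] sA; have q0 : 0 < q by lra.
have Y0 : 0 < Re Y by rewrite (lt_le_trans _ cY)// mulr_gt0.
have lnY := ln_normc_ge c0 q0 cY.
have lq : 0 <= ln q by rewrite ln_ge0.
have lc : ln c <= 0 by rewrite ln_le0.
have reA : Re s <= A.
  by rewrite (le_trans (ler_norm _))// (le_trans (normc_Re _)).
have imA : `|Im s| <= A by rewrite (le_trans (normc_Im _)).
have A0 : 0 <= A by apply: le_trans (normc_ge0 _) sA.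
rewrite normc_expC -expRD ler_expR ReM ReN ImN Re_logC//.
have h1 : Im (logC Y) * Im s <= 2 * A.
  by rewrite (le_trans (ler_norm _))// normrM ler_pM// Im_logC.
have h2 : (ln c + ln q) * Re s <= ln (normc Y) * Re s.
  by rewrite ler_wpM2r// (le_trans p0).
have h3 : ln q * p <= ln q * Re s by rewrite ler_wpM2l.
have h4 : ln c * A <= ln c * Re s by rewrite ler_wnM2l.
lra.
Qed.

Lemma expRN_ln (q : R) : 0 < q -> expR (- ln q) = q^-1.
Proof. by move=> q0; rewrite expRN lnK ?posrE. Qed.

Lemma harmonic0 (K : R) : (fun n => K * (n.+1%:R)^-1) @ \oo --> (0 : R).
Proof. by rewrite -(mulr0 K); apply: cvgMr; exact: cvg_harmonic. Qed.

Lemma sqrt_tail0 (K : R) : (fun n => K / Num.sqrt n.+1%:R) @ \oo --> (0 : R).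
Proof.
rewrite -(mulr0 K); apply: cvgMr.
have := @cvg_harmonic R; rewrite /harmonic => /cvgrPdist_lt h.
apply/cvgrPdist_lt => e e0; have [m _ hm] := h _ (exprn_gt0 2 e0).
exists m => // n /hm /=; rewrite !sub0r !normrN !ger0_norm ?invr_ge0 ?sqrtr_ge0// => hn.
rewrite -(@ltr_pXn2r _ 2) ?nnegrE ?invr_ge0 ?sqrtr_ge0 ?(ltW e0)//.
by rewrite exprVn sqr_sqrtr.
Qed.

(** This is the integral comparison for the exponent 3/2, with the discrete
    primitive 6 / sqrt n; the constant 6 leaves room for sqrt (n + 2) <= 2 sqrt (n + 1). *)
Lemma three_halves_tele n :
  expR (- (3 / 2 * ln n.+1%:R)) <= 6 / Num.sqrt n.+1%:R - 6 / Num.sqrt n.+2%:R :> R.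
Proof.
set a := Num.sqrt n.+1%:R; set b := Num.sqrt n.+2%:R.
have a0 : 0 < a by rewrite sqrtr_gt0.
have b0 : 0 < b by rewrite sqrtr_gt0.
have a2 : a ^+ 2 = n.+1%:R by rewrite sqr_sqrtr.
have b2 : b ^+ 2 = a ^+ 2 + 1 by rewrite a2 sqr_sqrtr// natr1.
have a1 : 1 <= a ^+ 2 by rewrite a2 ler1n.
have -> : expR (- (3 / 2 * ln n.+1%:R)) = (a ^+ 3)^-1.
  have -> : 3 / 2 * ln n.+1%:R = ln (a ^+ 3).
    by rewrite -a2 !lnXn// [ln a *+ 2]mulr2n [ln a *+ 3]mulrS [ln a *+ 2]mulr2n; lra.
  by rewrite expRN lnK// posrE exprn_gt0.
have -> : 6 / a - 6 / b = 6 * (b ^+ 2 - a ^+ 2) / (a * b * (a + b)).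
  by field; rewrite !gt_eqF//= addr_gt0.
rewrite b2 addrAC subrr add0r mulr1 ler_pdivlMr ?mulr_gt0 ?addr_gt0//.
rewrite ler_pdivrMl ?exprn_gt0//.
have ba : b <= 2 * a.
  rewrite -(@ler_pXn2r _ 2) ?nnegrE ?mulr_ge0 ?ltW// b2 exprMn; lra.
have : b * (a + b) <= 2 * a * (3 * a).
  by rewrite ler_pM ?addr_ge0 ?(ltW a0) ?(ltW b0)//; lra.
move=> h; have -> : a ^+ 3 * 6 = a * (2 * a * (3 * a)) by ring.
by rewrite -[leLHS]mulrA ler_wpM2l ?(ltW a0).
Qed.
End PowerBounds.

Section Hurwitz.
Variables (R : realType) (x w : R[i]).
Hypotheses (x0 : 0 < Re x) (w0 : 0 < Re w).
Local Notation C := R[i].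

Let y n : C := x + n%:R * w.
Let L n : C := logC (y n).
Let u n (s : C) : C := expC (- L n * s).

(** The m-th approximation of (1 - s) * \sum_n y_n^(-s): the tail of the series is
    replaced with the integral of (x + t w)^(-s) from t = m on, that is,
    y_m^(1 - s) / ((s - 1) w), plus the trapezoidal correction y_m^(-s) / 2.  The
    factor 1 - s removes the pole at 1, so that each approximation is entire. *)
Definition hurwitz_J m (s : C) : C :=
  (1 - s) * (\sum_(n < m) u n s + 2^-1 * u m s) - y m / w * u m s.
Local Notation J := hurwitz_J.

(** The derivative of hurwitz_J m at s = 0. *)
Definition hurwitz_J1 m : C :=
  - (m%:R + 2^-1) + (\sum_(n < m) - L n - 2^-1 * L m) + y m / w * L m.

Let w_neq0 : w != 0.
Proof. by apply/eqP => ww; move: (w0); rewrite ww ltxx. Qed.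

Lemma Re_y n : Re (y n) = Re x + n%:R * Re w.
Proof. by rewrite ReD Re_natM. Qed.

Let c : R := Num.min 1 (Num.min (Re x) (Re w)).
Let c01 : 0 < c <= 1.
Proof. by rewrite !lt_min ltr01 x0 w0 ge_min lexx. Qed.
Let cx : c <= Re x. Proof. by rewrite !ge_min lexx orbT. Qed.
Let cw : c <= Re w. Proof. by rewrite !ge_min lexx !orbT. Qed.

Lemma Re_y_ge n (t : R) : 0 <= t -> c * n.+1%:R <= Re (y n + t%:C * w).
Proof.
move=> t0; rewrite ReD Re_y ReRM -natr1 mulrDr mulr1.
have : c * n%:R <= n%:R * Re w by rewrite mulrC ler_wpM2l.
have : 0 <= t * Re w by rewrite mulr_ge0// ltW.
move: cx; lra.
Qed.

Lemma psSum (f : nat -> C -> C) (z : C) (a : nat -> nat -> C) (rho : R) (M : nat -> R) m : 0 < rho ->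
  (forall n, ps (f n) z (a n) rho (M n)) ->
  ps (fun s => \sum_(n < m) f n s) z (fun k => \sum_(n < m) a n k) rho (\sum_(n < m) M n).
Proof.
move=> r0 fa; elim: m => [|m IH].
  have -> : (fun s => \sum_(n < 0) f n s) = (fun=> 0) by apply/funext => s; rewrite big_ord0.
  have -> : (fun k => \sum_(n < 0) a n k) = (fun k => (0 : C) *+ (k == 0%N)).
    by apply/funext => s; rewrite big_ord0 mul0rn.
  by rewrite big_ord0 -[X in ps _ _ _ _ X](normc0 R); exact: ps_const.
have := psD IH (fa m).
rewrite (_ : (fun s => _ + _) = fun s => \sum_(n < m.+1) f n s); last first.
  by apply/funext => s; rewrite big_ord_recr.
rewrite (_ : (fun s => _ + _) = fun k => \sum_(n < m.+1) a n k); last first.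
  by apply/funext => s; rewrite big_ord_recr.
by rewrite big_ord_recr.
Qed.

Lemma ps_1B (z : C) (rho : R) : 0 < rho -> exists M,
  ps (fun s => 1 - s) z (fun n => if n is 0%N then 1 - z else - (n == 1%N)%:R) rho M.
Proof.
move=> r0; have := psD (ps_const 1 z r0) (psZ (-1) (ps_id z r0)) => h.
eexists; move: h.
rewrite (_ : (fun s => _ + _) = fun s => 1 - s); last first.
  by apply/funext => s; rewrite mulN1r.
rewrite (_ : (fun n => _ + _) = fun n => if n is 0%N then 1 - z else - (n == 1%N)%:R); last first.
  by apply/funext => -[|n] /=; rewrite mulN1r// mulr0n add0r.
exact.
Qed.

Lemma hurwitz_J_ps z m : exists a N, ps (J m) z a 1 N /\
  (z = 0 -> a 1%N = hurwitz_J1 m).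
Proof.
have r2 : 0 < (2 : R) by [].
have [B Bz] := ps_1B z r2.
have /choice[U Uz] n : exists M, ps (u n) z
    (fun k => expC (- L n * z) * ((- L n) ^+ k / k`!%:R)) 2 M by exact: ps_exp.
have h1 := psD (psSum m r2 Uz) (psZ 2^-1 (Uz m)).
have r1 : (2 : R) / 2 = 1 by rewrite divff.
have h2 := psM Bz h1; rewrite r1 in h2.
have h3 := psZ (- (y m / w)) (ps_shrink ltr01 (ler1n R 2 : 1 <= 2%:R) (Uz m)).
have := psD h2 h3.
rewrite (_ : (fun s => _ + _) = J m); last first.
  by apply/funext => s; rewrite /J mulNr.
move=> h4; eexists; eexists; split; first exact: h4.
move=> ->; rewrite /conv !big_ord_recl big_ord0 /= /bump /= addn0 subn0 subnn fact0.
rewrite (eq_bigr (fun n : 'I_m => - L n)) => [|n _]; last first.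
  by rewrite mulr0 expC0 mul1r expr1 divr1.
rewrite (eq_bigr (fun=> 1 : C)) => [|n _]; last by rewrite mulr0 expC0 mul1r expr0 divr1.
by rewrite !mulr0 expC0 sumr_const card_ord /hurwitz_J1 !expr1 expr0 (_ : 1`! = 1%N)//; field.
Qed.

(** The increment is 1 - s times the error of the trapezoidal rule for the
    function t |-> (y_m + t w)^(-s) on the interval from 0 to 1.  Two successive
    primitives bound it by the second derivative of that function, which is
    O(m^(- Re s - 2)), hence summable down to Re s = - 1/2. *)
Lemma hurwitz_J_step m (s : C) (A : R) : - (1 / 2) <= Re s -> normc s <= A ->
  normc (J m.+1 s - J m s) <=
    (1 + A) * (A * (A + 1)) * normc w ^+ 2 * expR ((2 - ln c) * (A + 2))
      * expR (- (3 / 2 * ln m.+1%:R)).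
Proof.
move=> s0 sA; have A0 : 0 <= A by apply: le_trans (normc_ge0 _) sA.
set B1 := expR _; set B2 := expR _.
pose Y (t : R) : C := y m + t%:C * w.
(* E j t = Y^(- s - j), so that differentiation raises j *)
pose E (j : nat) (t : R) : C := expC (- logC (Y t) * (s + j%:R)).
have Y0 t : 0 <= t <= 1 -> 0 < Re (Y t).
  move=> /andP[t0 _]; rewrite (lt_le_trans _ (Re_y_ge m t0))// mulr_gt0//.
  by case/andP: c01.
have Yd t : cder Y t w.
  apply: cder_ext (cderD (cder_const t (y m)) (cderM (cder_id t) (cder_const t w))) => //.
  by ring.
have EY j t : 0 <= t <= 1 -> E j t / Y t = E j.+1 t.
  move=> t01; rewrite /E -[X in _ / X](expC_logC (Y0 t t01)) -expCB -[j.+1%:R]natr1.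
  by congr expC; ring.
have Ed j t : 0 <= t <= 1 -> cder (E j) t (- (w * (s + j%:R)) * E j.+1 t).
  move=> t01; have := cder_exp (cderM (cderN (cder_log (Y0 t t01) (Yd t))) (cder_const t (s + j%:R))).
  by apply: cder_ext => //; rewrite -EY// /E; ring.
(* (1 - s) * k is the derivative of the trapezoidal error e on [0, t] *)
pose k (t : R) : C := 2^-1 * (E 0%N 0 - E 0%N t) - 2^-1 * (w * s) * (t%:C * E 1%N t).
have kd t : 0 <= t <= 1 -> cder k t (2^-1 * t%:C * (w ^+ 2 * (s * (s + 1))) * E 2%N t).
  move=> t01; have := cderB (cderMc 2^-1 (cderB (cder_const t (E 0%N 0)) (Ed 0%N t t01)))
    (cderMc (2^-1 * (w * s)) (cderM (cder_id t) (Ed 1%N t t01))).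
  by apply: cder_ext => //; ring.
have k0 : k 0 = 0 by rewrite /k subrr; ring.
have E2 t : 0 <= t <= 1 -> normc (E 2%N t) <= B1 * B2.
  move=> /andP[t0 _]; apply: pow_bound c01 _ (Re_y_ge m t0) _ _; first by rewrite ler1n.
    by rewrite ReD Re_nat; apply/andP; split; lra.
  by rewrite (le_trans (le_normcD _ _))// normc_nat lerD2r.
pose K := A * (A + 1) * (normc w * normc w) * (B1 * B2).
have K0 : 0 <= K by rewrite /K !mulr_ge0 ?normc_ge0 ?expR_ge0// addr_ge0.
have kK t : 0 <= t <= 1 -> normc (k t) <= K.
  move=> /andP[t0 t1].
  have v01 v : 0 <= v <= t -> 0 <= v <= 1 by move=> /andP[-> vt]; rewrite (le_trans vt).
  have := @cder_lip _ k _ K 0 t t0 (fun v hv => kd v (v01 v hv)).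
  rewrite k0 !subr0 => H; rewrite (le_trans (H _))// ?ler_piMr// => v /v01 hv.
  have /andP[v0 v1] := hv.
  have s1A : normc (s + 1) <= A + 1 by rewrite (le_trans (le_normcD _ _))// normc1 lerD2r.
  have := E2 v hv; move: (E 2%N v) => e2 He2.
  rewrite !normcM normcV normc_nat [normc v%:C]normc_real ger0_norm//.
  have P1 : 0 <= normc w * normc w * (normc s * normc (s + 1)).
    by rewrite !mulr_ge0 ?normc_ge0.
  have P2 : normc w * normc w * (normc s * normc (s + 1)) <= A * (A + 1) * (normc w * normc w).
    by rewrite [leRHS]mulrC ler_wpM2l ?mulr_ge0 ?normc_ge0// ler_pM ?normc_ge0.
  rewrite ler_pM ?normc_ge0//; first by rewrite !mulr_ge0 ?normc_ge0.
  by rewrite -[leRHS]mul1r ler_pM// ?mulr_ge0//; lra.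
pose e (t : R) : C := (1 - s) * (2^-1 * (t%:C * (E 0%N 0 + E 0%N t)))
   - w^-1 * (Y t * E 0%N t - Y 0 * E 0%N 0).
have ed t : 0 <= t <= 1 -> cder e t ((1 - s) * k t).
  move=> t01; have := cderB (cderMc (1 - s) (cderMc 2^-1 (cderM (cder_id t)
     (cderD (cder_const t (E 0%N 0)) (Ed 0%N t t01)))))
     (cderMc w^-1 (cderB (cderM (Yd t) (Ed 0%N t t01)) (cder_const t (Y 0 * E 0%N 0)))).
  apply: cder_ext => //; rewrite /k.
  have Yt : Y t != 0 by apply/eqP => Yt; have := Y0 t t01; rewrite Yt ltxx.
  by rewrite -(EY 0%N t t01); field; rewrite Yt w_neq0.
have e0 : e 0 = 0 by rewrite /e subrr; ring.
have -> : J m.+1 s - J m s = e 1 - e 0.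
  have Y1 : Y 1 = y m.+1 by rewrite /Y /y -natr1; ring.
  have Y00 : Y 0 = y m by rewrite /Y mul0r addr0.
  rewrite e0 /e /E Y1 Y00 !addr0 /J big_ord_recr /= -/(u m s) -/(u m.+1 s) subr0.
  by field; rewrite w_neq0.
have N : normc (1 - s) <= 1 + A by rewrite (le_trans (le_normcD _ _))// normc1 normcN lerD2l.
rewrite (_ : _ * B2 = (1 + A) * K * (1 - 0)); last by rewrite /K; ring.
apply: (cder_lip ler01 ed) => t t01.
by rewrite normcM ler_pM ?normc_ge0 ?kK.
Qed.
End Hurwitz.

(** * The ratio of two shifted double gamma functions *)

Section HurwitzLimit.
Variable R : realType.
Local Notation C := R[i].
Implicit Types (x w s z : C).

Lemma Re_neq0 z : 0 < Re z -> z != 0.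
Proof. by move=> z0; apply/eqP => zz; move: z0; rewrite zz ltxx. Qed.

(** Since hurwitz_J m 0 = 1/2 - x / w for all m, the limit function has this value
    at 0, and its derivative there is the limit of the derivatives. *)
Lemma hurwitz_limit x w z : 0 < Re x -> 0 < Re w -> 0 <= Re z ->
  exists b rho N, [/\ ps (lim_fun (hurwitz_J x w)) z b rho N,
    z = 0 -> b 0%N = 2^-1 - x / w & z = 0 -> clim (hurwitz_J1 x w) (b 1%N)].
Proof.
move=> x0 w0 z0.
have /choice[a /choice[N aN]] m := hurwitz_J_ps x w0 z m.
have h2 : 0 < (1 / 2 : R) by rewrite divr_gt0.
have h21 : (1 / 2 : R) <= 1 by lra.
have Ja m := ps_shrink h2 h21 (aN m).1.
set c := Num.min 1 (Num.min (Re x) (Re w)) => //.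
pose A := normc z + 1 / 2.
pose K := (1 + A) * (A * (A + 1)) * normc w ^+ 2 * expR ((2 - ln c) * (A + 2)).
have A0 : 0 <= A by rewrite addr_ge0 ?normc_ge0// ltW.
have K0 : 0 <= K.
  have A1 : 0 <= A + 1 by rewrite addr_ge0.
  have A2 : 0 <= 1 + A by rewrite addr_ge0.
  by rewrite /K !mulr_ge0 ?exprn_ge0 ?normc_ge0 ?expR_ge0.
pose v n := (K * 6) / Num.sqrt n.+1%:R.
have v0 n : 0 <= v n by apply: divr_ge0; [exact: mulr_ge0|exact: sqrtr_ge0].
have Jv n h : normc h < 1 / 2 ->
    normc (hurwitz_J x w n.+1 (z + h) - hurwitz_J x w n (z + h)) <= v n - v n.+1.
  move=> h12; have := @hurwitz_J_step R x w x0 w0 n (z + h) A; rewrite -/c -/K => H.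
  rewrite (le_trans (H _ _))//.
  - have := le_trans (ler_norm _) (normc_Re (- h)); rewrite normcN ReN ReD; lra.
  - by rewrite (le_trans (le_normcD _ _))// lerD2l ltW.
  - rewrite (_ : v n - v n.+1 = K * (6 / Num.sqrt n.+1%:R - 6 / Num.sqrt n.+2%:R)).
      by rewrite ler_wpM2l//; exact: three_halves_tele.
    by rewrite /v; ring.
have [_ [b [M [Jb ab]]]] := weierstrass Ja Jv v0 (sqrt_tail0 _).
exists b, (1 / 2 / 2), M; split=> // zE.
  apply: clim_uniq (ab 0%N) _; apply: (clim_ext (m := 0)) (clim_const _) => n _.
  rewrite -(ps_center (Ja n)) zE /hurwitz_J mulr0 expC0.
  rewrite (eq_bigr (fun=> 1 : C)) => [|i _]; last by rewrite mulr0 expC0.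
  rewrite sumr_const card_ord; field; exact: Re_neq0.
by apply: (clim_ext (m := 0)) (ab 1%N) => n _; rewrite (aN n).2.
Qed.

Lemma hurwitz_ana x w z : 0 < Re x -> 0 < Re w -> 0 <= Re z ->
  ana (lim_fun (hurwitz_J x w)) z.
Proof.
by move=> x0 w0 /(hurwitz_limit x0 w0)[b [rho [N [h _ _]]]]; exists b, rho, N.
Qed.

Lemma Re_y_bound x w n : 0 < Re x -> 0 < Re w ->
  Num.min 1 (Num.min (Re x) (Re w)) * n.+1%:R <= Re (x + n%:R * w).
Proof. by move=> x0 w0; have := Re_y_ge x w0 n (lexx 0); rewrite mul0r addr0. Qed.

Lemma min_bound x w : 0 < Re x -> 0 < Re w ->
  0 < Num.min 1 (Num.min (Re x) (Re w)) <= 1.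
Proof. by move=> x0 w0; rewrite !lt_min ltr01 x0 w0 ge_min lexx. Qed.

Lemma hurwitz_pow_bound x w s : 0 < Re x -> 0 < Re w ->
  1 <= Re s -> exists K, forall n,
  normc (expC (- logC (x + n%:R * w) * s)) <= K * (n.+1%:R)^-1.
Proof.
move=> x0 w0 s1; eexists => n.
have s01 : (0 : R) <= 1 <= Re s by apply/andP; split.
have := pow_bound (min_bound x0 w0) _ (Re_y_bound n x0 w0) s01 (lexx _).
by rewrite mul1r expRN_ln ?ltr0n//; apply; rewrite ler1n.
Qed.

(** For Re s > 2 the correction terms of hurwitz_J vanish in the limit. *)
Lemma hurwitz_J_cvg x w s D : 0 < Re x -> 0 < Re w ->
  2 < Re s ->
  clim (fun n => \sum_(i < n) expC (- logC (x + i%:R * w) * s)) D ->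
  clim (hurwitz_J x w ^~ s) ((1 - s) * D).
Proof.
move=> x0 w0 s2 SD.
have [|K KP] := @hurwitz_pow_bound x w s x0 w0; first lra.
have [|K' KP'] := @hurwitz_pow_bound x w (s - 1) x0 w0.
  by rewrite ReD ReN Re1; lra.
have u0 : clim (fun n => expC (- logC (x + n%:R * w) * s)) 0.
  by apply: (clim_le (m := 0)) (harmonic0 K) => n _; rewrite subr0.
have yu0 : clim (fun n => (x + n%:R * w) * expC (- logC (x + n%:R * w) * s)) 0.
  apply: (clim_le (m := 0)) (harmonic0 K') => n _; rewrite subr0.
  rewrite -{1}(@expC_logC _ (x + n%:R * w)) -?expCD.
    by rewrite (_ : _ + _ = - logC (x + n%:R * w) * (s - 1)) ?KP'//; ring.
  rewrite (lt_le_trans _ (Re_y_bound n x0 w0))// mulr_gt0//.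
  by have /andP[] := min_bound x0 w0.
have := climB (climMc (1 - s) (climD SD (climMc 2^-1 u0))) (climMc w^-1 yu0).
rewrite !mulr0 addr0 subr0; apply: (clim_ext (m := 0)) => n _.
by rewrite /hurwitz_J; ring.
Qed.

End HurwitzLimit.

Section DoubleGamma.
Variable R : realType.
Local Notation C := R[i].
Implicit Types (x w s z : C).

Lemma powCE z s : powC z (- s) = expC (- logC z * s).
Proof. by rewrite /powC; congr expC; ring. Qed.

(** Summing over squares, the terms telescope in the direction of w1, up to the
    boundary terms \sum_(n2 < n) (x + n w1 + n2 w2)^(-s), which are O(n^(- 1)). *)
Lemma double_zeta_diff w1 w2 x s Z1 Z2 : 0 < Re x ->
  0 < Re w1 -> 0 < Re w2 -> 2 < Re s ->
  is_double_zeta w1 w2 x Z1 -> is_double_zeta w1 w2 (x + w1) Z2 ->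
  clim (fun n => \sum_(i < n) expC (- logC (x + i%:R * w2) * s)) (Z1 s - Z2 s).
Proof.
move=> x0 w10 w20 s2 [/(_ s s2)/converges_to_clim Z1s _] [/(_ s s2)/converges_to_clim Z2s _].
pose g n1 n2 : C := powC (x + n1%:R * w1 + n2%:R * w2) (- s).
have T : clim (fun n => \sum_(n2 < n) g n n2) 0.
  pose c := Num.min 1 (Num.min (Re x) (Re w1)).
  apply: (clim_le (m := 0) (b := fun n => expR ((2 - ln c) * normc s) * (n.+1%:R)^-1)); last exact: harmonic0.
  move=> n _; rewrite subr0 (le_trans (normc_sum _ _ _))//.
  have E (i : 'I_n) : normc (g n i) <= expR ((2 - ln c) * normc s) * (n.+1%:R)^-1 * (n.+1%:R)^-1.
    have -> : expR ((2 - ln c) * normc s) * (n.+1%:R)^-1 * (n.+1%:R)^-1 =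
        expR ((2 - ln c) * normc s) * expR (- (2 * ln n.+1%:R)).
      by rewrite -!expRN_ln ?ltr0n// -mulrA -expRD; congr (_ * expR _); ring.
    rewrite /g powCE; apply: pow_bound (min_bound x0 w10) _ _ _ (lexx _).
    - by rewrite ler1n.
    - rewrite (le_trans (Re_y_bound n x0 w10))// [leRHS]ReD lerDl Re_natM.
      by rewrite mulr_ge0// ltW.
    - by rewrite ler0n ltW.
  rewrite (le_trans (ler_sum _ (fun i _ => E i)))// sumr_const card_ord -[leLHS]mulr_natr.
  rewrite -[leLHS]mulrA ler_piMr ?mulr_ge0 ?expR_ge0 ?invr_ge0//.
  by rewrite mulrC ler_pdivrMr ?ltr0n// mul1r ler_nat.
have := climD (climB Z1s Z2s) T; rewrite addr0.
apply: (clim_ext (m := 0)) => n _.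
rewrite -sumrB (eq_bigr (fun n1 : 'I_n => \sum_(n2 < n) (g n1 n2 - g n1.+1 n2))).
  rewrite exchange_big /= -big_split /=; apply: eq_bigr => n2 _.
  rewrite -(big_mkord xpredT (fun n1 => g n1 n2 - g n1.+1 n2)).
  rewrite -[X in X + _]opprK -sumrN (eq_bigr (fun n1 => g n1.+1 n2 - g n1 n2)) => [|n1 _].
    by rewrite telescope_sumr// opprB subrK /g mul0r addr0 powCE.
  by rewrite opprB.
move=> n1 _; rewrite -sumrB; apply: eq_bigr => n2 _; rewrite /g.
have -> // : x + w1 + n1%:R * w1 + n2%:R * w2 = x + n1.+1%:R * w1 + n2%:R * w2.
by rewrite -[n1.+1%:R]natr1; ring.
Qed.

(** Z1 - Z2 is the Hurwitz series for Re s > 2, so (1 - s) (Z1 - Z2) coincides with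
    the continuation lim hurwitz_J along a segment down to s = 0, and comparing
    Taylor coefficients at 0 yields (Z1 - Z2)'(0) = l + (Z1 - Z2)(0), where
    (Z1 - Z2)(0) = 1/2 - x / w2. *)
Lemma gamma_ratio w1 w2 (G : C -> C) x : 0 < Re x ->
  0 < Re w1 -> 0 < Re w2 -> is_double_gamma w1 w2 G ->
  exists2 l, clim (hurwitz_J1 x w2) l & G x / G (x + w1) = expC (l + (2^-1 - x / w2)).
Proof.
move=> x0 w10 w20 [GZ _].
have xw0 : 0 < Re (x + w1) by rewrite ReD addr_gt0.
have [Z1 Z1P ->] := GZ _ x0; have [Z2 Z2P ->] := GZ _ xw0.
have [_ Z1a] := Z1P; have [_ Z2a] := Z2P.
pose H := lim_fun (hurwitz_J x w2).
(* the segment from 3 + i to 0 avoids the poles 1 and 2 *)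
pose p : C := 3 +i* 1.
pose f s := (1 - s) * (Z1 s - Z2 s) - H s.
have a1B z : ana (fun s : C => 1 - s) z by apply: anaB; [exact: ana_const|exact: ana_id].
have fp : vanishes_near f p.
  exists 1 => // h h1; rewrite /f.
  have s2 : 2 < Re (p + h).
    have := le_lt_trans (le_trans (ler_norm _) (normc_Re (- h))).
    rewrite normcN => /(_ _ h1); rewrite ReN ReD /=; lra.
  have := hurwitz_J_cvg x0 w20 s2 (double_zeta_diff x0 w10 w20 s2 Z1P Z2P).
  by move=> HJ; rewrite /H (clim_uniq (lim_funP HJ) HJ) subrr.
have f0 : vanishes_near f 0.
  apply: segment_identity fp => t /andP[t0 t1].
  have qE : p + t%:C * (0 - p) = (3 * (1 - t)) +i* (1 - t).
    by rewrite /p; apply: eqC; rewrite ?(ReD, ImD, ReRM, ImRM) /=; ring.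
  have q1 : p + t%:C * (0 - p) != 1.
    by rewrite qE eq_complex /=; apply/negP => /andP[/eqP h1 /eqP h2]; lra.
  have q2 : p + t%:C * (0 - p) != 2.
    apply/negP => /eqP q2; move: (congr1 (@complex.Im R) q2) (congr1 (@complex.Re R) q2).
    by rewrite qE Im_nat Re_nat /= => h1 h2; lra.
  apply: anaB; last by apply: hurwitz_ana => //; rewrite qE /=; lra.
  by apply: anaM => //; apply: anaB; apply: analytic_ana; [exact: Z1a|exact: Z2a].
have n01 : (0 : C) != 1 by rewrite eq_sym oner_eq0.
have n02 : (0 : C) != 2 by rewrite eq_sym pnatr_eq0.
have [b [rho [N [Hb b0 b1]]]] := hurwitz_limit x0 w20 (lexx 0 : 0 <= Re (0 : C)).
have [a [a' [r1 [M [M' [h1 h2]]]]]] :=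
  ps_common (analytic_ana (Z1a 0 n01 n02)) (analytic_ana (Z2a 0 n01 n02)).
have [r10 _ _] := h1; have [rho0 _ _] := Hb.
rewrite (ps_derivative h1) (ps_derivative h2) -expCB.
have [B hB] := ps_1B (0 : C) r10.
have h3 := psM hB (psD h1 (psZ (-1) h2)).
pose m := Num.min (r1 / 2) rho.
have m0 : 0 < m by rewrite lt_min rho0 divr_gt0.
have m1 : m <= r1 / 2 by rewrite ge_min lexx.
have m2 : m <= rho by rewrite ge_min lexx orbT.
have h4 := psD (ps_shrink m0 m1 h3) (psZ (-1) (ps_shrink m0 m2 Hb)).
have [d d0 fd] := f0.
have E : forall n, conv (fun n => if n is 0%N then 1 - 0 else - (n == 1%N)%:R)
    (fun n => a n + -1 * a' n) n = b n.
  move=> n; apply/eqP; rewrite -subr_eq0 -[- b n]mulN1r; apply/eqP.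
  by apply: (ps_uniq0 h4 d0 _ n) => h hd; have := fd h hd; rewrite /f !mulN1r.
exists (b 1%N); first exact: b1.
congr expC; rewrite -(b0 erefl) -!E /conv !big_ord_recl !big_ord0 /= subn0 subnn.
by rewrite /bump /= subnn; ring.
Qed.
End DoubleGamma.

(** * The sine function and its infinite product *)

Section ComplexSine.
Variable R : realType.
Local Notation C := R[i].
Implicit Types z w : C.

Definition cosC z : C := (expC ('i * z) + expC (- ('i * z))) / 2.

Lemma expC_i z : expC ('i * z) = cosC z + 'i * sinC z.
Proof. by rewrite /cosC /sinC; field; rewrite i_neq0. Qed.

Lemma expC_Ni z : expC (- ('i * z)) = cosC z - 'i * sinC z.
Proof. by rewrite /cosC /sinC; field; rewrite i_neq0. Qed.

Lemma sinCN z : sinC (- z) = - sinC z.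
Proof. by rewrite /sinC mulrN opprK; field; rewrite i_neq0. Qed.

Lemma cosCN z : cosC (- z) = cosC z.
Proof. by rewrite /cosC mulrN opprK addrC. Qed.

Lemma sinC0 : sinC (0 : C) = 0.
Proof. by rewrite /sinC mulr0 oppr0 subrr mul0r. Qed.

Lemma cos2Dsin2C z : cosC z ^+ 2 + sinC z ^+ 2 = 1.
Proof.
have := expCNM ('i * z); rewrite expC_i expC_Ni => <-.
have i2 := @sqr_i R.
transitivity (cosC z ^+ 2 - 'i * 'i * sinC z ^+ 2); first by rewrite i2; ring.
by ring.
Qed.

Lemma sinCD z w : sinC (z + w) = sinC z * cosC w + cosC z * sinC w.
Proof.
rewrite {1}/sinC mulrDr opprD !expCD !expC_i !expC_Ni; field.
by rewrite i_neq0.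
Qed.

Lemma cosCD z w : cosC (z + w) = cosC z * cosC w - sinC z * sinC w.
Proof.
rewrite {1}/cosC mulrDr opprD !expCD !expC_i !expC_Ni.
transitivity (cosC z * cosC w + 'i * 'i * sinC z * sinC w); first by field.
by rewrite sqr_i; ring.
Qed.

Lemma expCNipi : expC (- ('i * piC R)) = -1.
Proof. by rewrite expCN expCipi invrN invr1. Qed.

Lemma sinCpi : sinC (piC R) = 0.
Proof. by rewrite /sinC expCipi expCNipi subrr mul0r. Qed.

Lemma cosCpi : cosC (piC R) = -1.
Proof. by rewrite /cosC expCipi expCNipi; field. Qed.

Lemma sinCDpi z : sinC (z + piC R) = - sinC z.
Proof. by rewrite sinCD sinCpi cosCpi; ring. Qed.

Lemma cosCDpi z : cosC (z + piC R) = - cosC z.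
Proof. by rewrite cosCD sinCpi cosCpi; ring. Qed.

Lemma sinC_real (x : R) : sinC (x%:C : C) = (sin x)%:C.
Proof.
have E (y : R) : expC ('i * y%:C) = (cos y)%:C + 'i * (sin y)%:C.
  apply: eqC; rewrite ?(Re_expC, Im_expC) ReiM ImiM ReR ImR oppr0 expR0 mul1r.
    by rewrite ReD ReiM ReR ImR oppr0 addr0.
  by rewrite ImD ImiM ReR ImR add0r.
rewrite /sinC -[- ('i * _)]mulrN -(rmorphN (real_complex R)) !E cosN sinN rmorphN; field.
by rewrite i_neq0.
Qed.

Lemma piC_neq0 : piC R != 0.
Proof. by rewrite -normc_eq0 normc_real gtr0_norm ?pi_gt0// gt_eqF ?pi_gt0. Qed.

Lemma expC_1_le (h : C) : normc (expC h - 1) <= expR (normc h) * normc h.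
Proof.
have := @expC_taylor R h 1 1; rewrite lexx ler01 => /(_ isT).
have -> : 1%:C * h = h by rewrite mul1r.
rewrite big_ord_recl big_ord0 addr0 [_ ^+ _](expr0 h) [(_ : 'I_1)`!]fact0 !divr1.
by rewrite mulr1 expr1.
Qed.

Lemma expC_2_le (h : C) : normc (expC h - 1 - h) <= expR (normc h) * normc h ^+ 2.
Proof.
have := @expC_taylor R h 2 1; rewrite lexx ler01 => /(_ isT).
have -> : 1%:C * h = h by rewrite mul1r.
rewrite !big_ord_recl big_ord0 addr0 [_ ^+ ord0](expr0 h) [(_ : 'I_2)`!]fact0.
rewrite [_ ^+ (lift _ _)](expr1 h) [(lift _ _)`!](_ : _ = 1%N)// !divr1.
rewrite opprD addrA mulr1 => /le_trans; apply.
by rewrite ler_wpM2l ?expR_ge0// ler_piMr ?exprn_ge0 ?normc_ge0// invf_le1// ler1n.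
Qed.

Lemma normc_iM z : normc ('i * z) = normc z.
Proof. by rewrite normcM normc_i mul1r. Qed.

Lemma sinC_le z : normc (sinC z) <= expR (normc z) * normc z.
Proof.
rewrite /sinC -[expC _ - _](subrKA 1) normcM normcV normcM normc_i normc_nat mulr1.
rewrite ler_pdivrMr// (le_trans (le_normcD _ _))// [normc (1 - _)]normcB.
have := expC_1_le ('i * z); have := expC_1_le (- ('i * z)).
by rewrite normcN normc_iM; lra.
Qed.

Lemma sinC_sub_le z : normc (sinC z - z) <= expR (normc z) * normc z ^+ 2.
Proof.
rewrite (_ : _ - z = ((expC ('i * z) - 1 - 'i * z) + - (expC (- ('i * z)) - 1 - - ('i * z)))
   / (2 * 'i)); last by rewrite /sinC; field; rewrite i_neq0.
rewrite normcM normcV normcM normc_i normc_nat mulr1 ler_pdivrMr//.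
rewrite (le_trans (le_normcD _ _))// normcN.
have := expC_2_le ('i * z); have := expC_2_le (- ('i * z)).
by rewrite normcN normc_iM; lra.
Qed.

Lemma clim_expC (u : nat -> C) l : clim u l -> clim (fun n => expC (u n)) (expC l).
Proof.
move=> ul; have [M M0 uM] := clim_bounded (climB ul (clim_const l)).
apply: (clim_le (m := 0) (b := fun n => normc (expC l) * expR M * normc (u n - l))).
  move=> n _; rewrite -{1}(subrKC l (u n)) expCD -{2}[expC l]mulr1 -mulrBr normcM -mulrA.
  rewrite ler_wpM2l ?normc_ge0// (le_trans (expC_1_le _))//.
  by rewrite ler_wpM2r ?normc_ge0// ler_expR.
by rewrite -(mulr0 (normc (expC l) * expR M)); apply: cvgMr.
Qed.
End ComplexSine.

Section RealSine.
Variable R : realType.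
Implicit Types u : R.

Lemma sin_le_id u : 0 <= u -> `|sin u| <= u.
Proof.
move=> u0; have := @cder_lip R (fun s => (sin s)%:C) (fun s => (cos s)%:C) 1 0 u u0.
rewrite sin0 subr0 mul1r subr0 normc_real; apply=> s _.
  exact: cder_real (is_derive_sin s).
by rewrite normc_real cos_max.
Qed.

Lemma cos_sub1_le u : 0 <= u -> `|cos u - 1| <= u ^+ 2 / 2.
Proof.
move=> u0; have := @cder_mvt R (fun s => (cos s)%:C) (fun s => (- sin s)%:C)
  (fun s => s ^+ 2 / 2) (fun s => s) 0 u u0.
rewrite cos0 [0 ^+ 2]exprS !mul0r subr0 -rmorphB normc_real; apply=> s s0.
- exact: cder_real (is_derive_cos s).
- apply: is_derive_ext (is_deriveM (is_deriveX 2 (is_derive_id s 1))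
    (is_derive_cst (2^-1 : R) s 1)) => [v|]; first by rewrite mulrfctE exprfctE.
  by rewrite /GRing.scale /= /cst; field.
- by rewrite normc_real normrN sin_le_id//; case/andP: s0.
Qed.

Lemma sin_sub_le u : 0 <= u -> `|sin u - u| <= u ^+ 3 / 6.
Proof.
move=> u0; have := @cder_mvt R (fun s => (sin s - s)%:C) (fun s => (cos s - 1)%:C)
  (fun s => s ^+ 3 / 6) (fun s => s ^+ 2 / 2) 0 u u0.
rewrite sin0 [0 ^+ 3]exprS !mul0r !subr0 normc_real; apply=> s s0.
- apply: cder_real; exact: is_deriveB (is_derive_sin s) (is_derive_id s 1).
- apply: is_derive_ext (is_deriveM (is_deriveX 3 (is_derive_id s 1))
    (is_derive_cst (6^-1 : R) s 1)) => [v|]; first by rewrite mulrfctE exprfctE.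
  by rewrite /GRing.scale /= /cst; field.
- by rewrite normc_real cos_sub1_le//; case/andP: s0.
Qed.

Lemma sin_ge_third u : 0 < u < 2 -> u / 3 <= sin u.
Proof.
move=> /andP[u0 u2]; have := sin_sub_le (ltW u0).
rewrite ler_norml => /andP[h _].
have : u ^+ 3 / 6 <= u * (2 / 3).
  have -> : u ^+ 3 / 6 = u * (u ^+ 2 / 6) by field.
  rewrite ler_wpM2l ?(ltW u0)//.
  have : u ^+ 2 <= 2 ^+ 2 by rewrite lerXn2r ?nnegrE ?(ltW u0) ?(ltW u2).
  lra.
lra.
Qed.

(** The difference is (u - sin u) (u + sin u) / (u sin u) ^ 2, where
    |u - sin u| <= u^3 / 6 and sin u >= u / 3. *)
Lemma csc_sub_le u : 0 < u < 2 -> `|(sin u ^+ 2)^-1 - (u ^+ 2)^-1| <= 3.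
Proof.
move=> u02; have /andP[u0 u2] := u02.
have s3 := sin_ge_third u02.
have s0 : 0 < sin u by apply: lt_le_trans s3; rewrite divr_gt0.
have h1 : `|u - sin u| <= u ^+ 3 / 6 by rewrite distrC sin_sub_le ?ltW.
have h2 := le_trans (ler_norm _) (sin_le_id (ltW u0)).
have -> : (sin u ^+ 2)^-1 - (u ^+ 2)^-1 = (u - sin u) * (u + sin u) / (u ^+ 2 * sin u ^+ 2).
  by field; rewrite !gt_eqF.
have p0 : 0 < u ^+ 2 * sin u ^+ 2 by rewrite mulr_gt0 ?exprn_gt0.
rewrite normrM [X in _ * X]gtr0_norm ?invr_gt0// ler_pdivrMr// normrM.
rewrite [`|u + sin u|]gtr0_norm ?addr_gt0//.
have h3 : `|u - sin u| * (u + sin u) <= u ^+ 3 / 6 * (2 * u).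
  by rewrite ler_pM// ?addr_ge0 ?(ltW u0) ?(ltW s0)//; lra.
rewrite (le_trans h3)//.
have -> : u ^+ 3 / 6 * (2 * u) = 3 * (u ^+ 2 * (u / 3) ^+ 2) by field.
rewrite ler_wpM2l// ler_wpM2l ?exprn_ge0 ?(ltW u0)// lerXn2r// nnegrE ?(ltW s0)//.
by rewrite divr_ge0// ltW.
Qed.

Lemma sum_inv_sqr M : \sum_(k < M) (k.+1%:R ^+ 2)^-1 <= 2 :> R.
Proof.
suff H : \sum_(k < M) (k.+1%:R ^+ 2)^-1 <= 2 - (if M is M'.+1 then (M%:R)^-1 else 0) :> R.
  by rewrite (le_trans H)// gerBl; case: M {H} => // M; rewrite invr_ge0.
elim: M => [|[|M] IH]; first by rewrite big_ord0 subr0.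
  by rewrite big_ord_recl big_ord0 expr1n; lra.
rewrite big_ord_recr /= (le_trans (lerD IH (lexx _)))//.
have a0 : 0 < M.+1%:R :> R by rewrite ltr0n.
rewrite -[M.+2%:R]natr1; move: (M.+1%:R) a0 => a a0.
have : ((a + 1) ^+ 2)^-1 <= a^-1 - (a + 1)^-1.
  have -> : a^-1 - (a + 1)^-1 = (a * (a + 1))^-1.
    by field; rewrite !gt_eqF// addr_gt0.
  rewrite lef_pV2 ?posrE ?exprn_gt0 ?mulr_gt0 ?addr_gt0//.
  by rewrite expr2 ler_wpM2r ?lerDl// addr_ge0// ltW.
lra.
Qed.

Lemma prod_dist (I : Type) (s : seq I) (u v : I -> R[i]) (e : I -> R) :
  (forall i, 1 <= e i) -> (forall i, normc (u i) <= e i) -> (forall i, normc (v i) <= e i) ->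
  normc (\prod_(i <- s) u i - \prod_(i <- s) v i) <=
    (\prod_(i <- s) e i) * \sum_(i <- s) normc (u i - v i).
Proof.
move=> e1 ue ve.
have P1 (r : seq I) : 1 <= \prod_(i <- r) e i.
  by elim/big_ind: _ => // p q p1 q1; rewrite -[1]mul1r ler_pM.
elim: s => [|i s IH]; first by rewrite !big_nil subrr normc0 mulr0.
rewrite !big_cons.
set U := \prod_(j <- s) u j in IH *; set V := \prod_(j <- s) v j in IH *.
set P := \prod_(j <- s) e j in IH *; set S := \sum_(j <- s) _ in IH *.
have VP : normc V <= P.
  by rewrite /V normc_prod; apply: ler_prod => j _; rewrite normc_ge0 ve.
have S0 : 0 <= S by apply: sumr_ge0 => j _; exact: normc_ge0.
have -> : u i * U - v i * V = u i * (U - V) + (u i - v i) * V by ring.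
rewrite (le_trans (le_normcD _ _))// !normcM mulrDr addrC.
have e0 : 0 <= e i by apply: le_trans (e1 i).
have P0 : 0 <= P by apply: le_trans (P1 s).
apply: lerD.
  rewrite mulrC ler_pM ?normc_ge0//.
  by rewrite (le_trans VP)// ler_peMl.
by rewrite -mulrA ler_pM ?normc_ge0.
Qed.
End RealSine.

Section SineProduct.
Variable R : realType.
Local Notation C := R[i].

(** The product of y - omega^i over the nontrivial roots, with omega^k and
    omega^(-k) paired. *)
Lemma unity_root_prod M (y : C) : \sum_(i < M.*2.+1) y ^+ i = \prod_(k < M)
    ((y - omega R M.*2.+1 ^+ k.+1) * (y - omega R M.*2.+1 ^+ (M.*2.+1 - k.+1))).
Proof.
set m := M.*2.+1; set z := omega R m.
have zp : m.-primitive_root z by exact: omega_prim.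
have : \sum_(i < m) 'X^i = \prod_(0 <= i < M.*2) ('X - (z ^+ i.+1)%:P) :> {poly C}.
  apply: (mulfI (x := 'X - 1%:P)); first by rewrite polyXsubC_eq0.
  by rewrite -subrX1 -(factor_Xn_sub_1 zp) big_nat_recl//= expr0.
move=> /(congr1 (fun p : {poly C} => p.[y])); rewrite horner_sum horner_prod /=.
under eq_bigr do rewrite hornerXn.
move=> ->; under eq_bigr do rewrite hornerXsubC.
rewrite big_split /= -addnn (big_cat_nat (leq0n M) (leq_addr M M))/=; congr (_ * _).
  by rewrite big_mkord.
rewrite -{1}[M]add0n big_addn addnK big_nat_rev /= big_mkord.
apply: eq_bigr => k _; congr (_ - _ ^+ _).
rewrite add0n /m -addnn -addSn; have := ltn_ord k; lia.
Qed.

Let al M k : R := pi * k.+1%:R / M.*2.+1%:R.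

Lemma al_bound M k : (k < M)%N -> 0 < al M k < 2.
Proof.
move=> kM; have m0 : 0 < (M.*2.+1%:R : R) by rewrite ltr0n.
rewrite /al divr_gt0 ?mulr_gt0 ?pi_gt0 ?ltr0n//=.
have p4 : pi < 4 :> R by have := pihalf_lt2 R; lra.
rewrite ltr_pdivrMr//; apply: lt_le_trans (_ : 4 * k.+1%:R <= _).
  by rewrite ltr_pM2r ?ltr0n.
rewrite -!natrM ler_nat; lia.
Qed.

Lemma sin_al_neq0 M k : (k < M)%N -> sin (al M k) != 0.
Proof.
move=> /al_bound a2; have := sin_ge_third a2; case/andP: a2 => a0 _.
by move=> h; rewrite gt_eqF// (lt_le_trans _ h)// divr_gt0.
Qed.

Lemma unity_root_pair M k (th : C) : (k < M)%N ->
  (expC ('i * th) ^+ 2 - omega R M.*2.+1 ^+ k.+1) *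
    (expC ('i * th) ^+ 2 - omega R M.*2.+1 ^+ (M.*2.+1 - k.+1)) =
  expC ('i * th) ^+ 2 * (4 * ((sin (al M k))%:C ^+ 2 - sinC th ^+ 2)).
Proof.
move=> kM; set m := M.*2.+1; set e := expC _; set f := expC ('i * (al M k)%:C).
have e0 : e != 0 by exact: expC_neq0.
have f0 : f != 0 by exact: expC_neq0.
have zk : omega R m ^+ k.+1 = f ^+ 2.
  rewrite omegaX /f -expC_nat; congr expC.
  by rewrite /al /piC !rmorphM fmorphV !rmorph_nat; ring.
have zmk : omega R m ^+ (m - k.+1) = f ^- 2.
  apply: (mulIf (x := f ^+ 2)); first by rewrite expf_neq0.
  rewrite mulVf ?expf_neq0// -zk -exprD subnK ?omega_expn//.
  by rewrite /m -addnn; lia.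
rewrite zk zmk -sinC_real /sinC !expCN -/e -/f; clearbody e f.
have i2 : ('i : C) ^+ 2 = -1 by rewrite expr2 sqr_i.
rewrite !expr_div_n !exprMn i2; field.
by rewrite e0 f0.
Qed.

(** With e = exp (i th) and m = 2 M + 1, the quotient sin (m th) / sin th is, up to
    a power of e, the sum of the first m powers of e^2, which factors over the roots
    of unity; th = 0 gives the normalizing constant m. *)
Lemma sinC_finite_prod M (th : C) : sinC (M.*2.+1%:R * th) =
  M.*2.+1%:R * sinC th * \prod_(k < M) (1 - sinC th ^+ 2 / (sin (al M k))%:C ^+ 2).
Proof.
set m := M.*2.+1; set e := expC ('i * th).
have e0 : e != 0 by exact: expC_neq0.
have E t : \sum_(i < m) (expC ('i * t) ^+ 2) ^+ i = (expC ('i * t) ^+ 2) ^+ M *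
    \prod_(k < M) (4 * ((sin (al M k))%:C ^+ 2 - sinC t ^+ 2)).
  rewrite unity_root_prod (eq_bigr _ (fun k _ => unity_root_pair t (ltn_ord k))) big_split /=.
  by rewrite prodr_const card_ord.
have m1 : m%:R = \prod_(k < M) (4 * (sin (al M k))%:C ^+ 2) :> C.
  have := E 0; rewrite sinC0 mulr0 expC0 !expr1n mul1r.
  rewrite (eq_bigr (fun=> 1 : C)) => [|i _]; last by rewrite !expr1n.
  rewrite sumr_const card_ord => ->.
  by apply: eq_bigr => k _; rewrite expr0n subr0.
have -> : m%:R * sinC th * \prod_(k < M) (1 - sinC th ^+ 2 / (sin (al M k))%:C ^+ 2) =
    sinC th * \prod_(k < M) (4 * ((sin (al M k))%:C ^+ 2 - sinC th ^+ 2)).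
  rewrite m1 mulrAC -big_split /= mulrC; congr (_ * _); apply: eq_bigr => k _.
  field; apply/eqP => /(congr1 (@complex.Re R))/eqP; exact/negP/sin_al_neq0.
set Q := \prod_(k < M) _; have EQ := E th; rewrite -/e -/Q in EQ.
rewrite /sinC ['i * (_ * th)]mulrCA !expCN !expC_nat -/e.
have := subrX1 (e ^+ 2) m; rewrite EQ => H; clearbody e Q.
have i0 := i_neq0 R.
have -> : e ^+ m - (e ^+ m)^-1 = (e ^+ m)^-1 * ((e ^+ 2) ^+ m - 1).
  by rewrite -exprM mulnC exprM; field; rewrite expf_neq0.
have em : e ^+ m = e * (e ^+ 2) ^+ M by rewrite -exprM mul2n -exprS.
have X0 : (e ^+ 2) ^+ M != 0 by rewrite !expf_neq0.
rewrite H em; move: ((e ^+ 2) ^+ M) X0 => X X0; field.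
by rewrite e0 i0 X0.
Qed.
End SineProduct.

Ltac nonneg := repeat first
  [ assumption | done | exact: normc_ge0 | exact: expR_ge0 | apply: addr_ge0
  | apply: mulr_ge0 | apply: exprn_ge0 | rewrite invr_ge0 | by apply: ltW ].

Section EulerSine.
Variable R : realType.
Local Notation C := R[i].

Lemma prod_1D_le (D : R) M : 0 <= D ->
  \prod_(k < M) (1 + D / k.+1%:R ^+ 2) <= expR (2 * D).
Proof.
move=> D0; apply: (@le_trans _ _ (expR (\sum_(k < M) D / k.+1%:R ^+ 2))).
  rewrite expR_sum; apply: ler_prod => k _.
  by rewrite addr_ge0 ?divr_ge0 ?exprn_ge0//= expR_ge1Dx.
by rewrite ler_expR -mulr_sumr mulrC ler_wpM2r// sum_inv_sqr.
Qed.

(** With m = 2 M + 1 and th = pi t / m, the factors of sinC_finite_prod for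
    sin (m th) differ from the factors 1 - t^2 / k^2 by
    O(1 / m^2 + 1 / (m k^2)), because sin th = th + O(th^2) and
    1 / sin^2 (pi k / m) = m^2 / (pi k)^2 + O(1).  The M errors add up to O(1 / m),
    and the products stay bounded by exp (2 D). *)
Lemma euler_sine (t : C) :
  clim (fun M => piC R * t * \prod_(k < M) (1 - t ^+ 2 / k.+1%:R ^+ 2)) (sinC (piC R * t)).
Proof.
pose n := normc t; pose T := pi * n; pose B := expR T.
have n0 : 0 <= n by exact: normc_ge0.
have p0 : 0 < pi :> R := pi_gt0 R.
have T0 : 0 <= T by rewrite mulr_ge0// ltW.
have B1 : 1 <= B by rewrite -expR0 ler_expR.
have B0 : 0 <= B by apply: le_trans B1.
pose D := 9 * B ^+ 2 * n ^+ 2; pose P := expR (2 * D).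
have D0 : 0 <= D by rewrite /D; nonneg.
pose K := 3 * (B ^+ 2 * T ^+ 2) + 2 * (B * (B + 1) * T * n ^+ 2).
have K0 : 0 <= K by rewrite /K; nonneg.
have P0 : 0 <= P by exact: expR_ge0.
apply: (clim_le (m := 0) (b := fun M => (B * T * (P * K) + B * T ^+ 2 * P) * (M.+1%:R)^-1));
  last exact: harmonic0.
move=> M _; set m := M.*2.+1; pose q : R := m%:R.
have q0 : 0 < q by rewrite ltr0n.
have qM : M%:R / q <= 1 by rewrite ler_pdivrMr// mul1r ler_nat /m; lia.
pose th : C := piC R * t / m%:R.
have m0 : (m%:R : C) != 0 by rewrite pnatr_eq0.
have nth : normc th = T / q.
  by rewrite !normcM normcV normc_nat normc_real gtr0_norm.
have Tq : T / q <= T by rewrite ler_pdivrMr// ler_peMr// ler1n.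
have Tq0 : 0 <= T / q by rewrite divr_ge0// ltW.
have eB : expR (T / q) <= B by rewrite ler_expR.
have h1 : normc (sinC th) <= B * (T / q).
  by rewrite (le_trans (sinC_le _))// nth ler_wpM2r.
have h2 : normc (sinC th - th) <= B * (T / q) ^+ 2.
  by rewrite (le_trans (sinC_sub_le _))// nth ler_wpM2r ?exprn_ge0.
pose al k : R := pi * k.+1%:R / q.
pose a k : C := sinC th ^+ 2 / (sin (al k))%:C ^+ 2.
pose b k : C := t ^+ 2 / k.+1%:R ^+ 2.
have al0 k : 0 < al k by rewrite divr_gt0// mulr_gt0// ltr0n.
have bE k : b k = th ^+ 2 / (al k)%:C ^+ 2.
  have -> : (al k)%:C = piC R * k.+1%:R / m%:R.
    by rewrite /al !rmorphM fmorphV !rmorph_nat.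
  rewrite /b /th; move: (piC R) (piC_neq0 R) => p pn0; field.
  by rewrite m0 pn0 nat1r pnatr_eq0.
have tq k : (T / q) ^+ 2 / al k ^+ 2 = n ^+ 2 / k.+1%:R ^+ 2.
  rewrite /T /al; move: (p0); move: (pi : R) => p pn0; field.
  by rewrite (gt_eqF q0) (gt_eqF pn0) nat1r pnatr_eq0.
have sa k : (k < M)%N -> al k / 3 <= sin (al k).
  by move=> kM; rewrite sin_ge_third// al_bound.
have aD (k : 'I_M) : normc (a k) <= D / k.+1%:R ^+ 2.
  have sk := sa k (ltn_ord k).
  have s0 : 0 < sin (al k) by apply: lt_le_trans sk; rewrite divr_gt0.
  rewrite /a normcM normcV !normcX normc_real gtr0_norm//.
  rewrite ler_pdivrMr ?exprn_gt0//.
  have h1s : normc (sinC th) ^+ 2 <= (B * (T / q)) ^+ 2.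
    by rewrite lerXn2r ?nnegrE //; nonneg.
  apply: le_trans h1s _.
  have -> : (B * (T / q)) ^+ 2 = D / k.+1%:R ^+ 2 * (al k / 3) ^+ 2.
    rewrite exprMn -[(T / q) ^+ 2](divfK (x := al k ^+ 2)) ?expf_neq0 ?(gt_eqF (al0 k))//.
    by rewrite tq /D; field; rewrite nat1r pnatr_eq0.
  have ak0 := ltW (al0 k); have s00 := ltW s0.
  by apply: ler_wpM2l; [nonneg|rewrite lerXn2r ?nnegrE //; nonneg].
have bD (k : 'I_M) : normc (b k) <= D / k.+1%:R ^+ 2.
  rewrite /b normcM normcV !normcX normc_nat ler_wpM2r ?invr_ge0 ?exprn_ge0//.
  by rewrite /D ler_peMl ?exprn_ge0//; have := exprn_ege1 2 B1; lra.
have ab (k : 'I_M) : normc (a k - b k) <=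
    3 * (B ^+ 2 * T ^+ 2) / q ^+ 2 + B * (B + 1) * T * n ^+ 2 / q * (k.+1%:R ^+ 2)^-1.
  have a2 : 0 < al k < 2 by rewrite al_bound.
  have s0 : sin (al k) != 0 by rewrite sin_al_neq0.
  have -> : a k - b k = sinC th ^+ 2 * ((sin (al k) ^+ 2)^-1 - (al k ^+ 2)^-1)%:C +
      (sinC th - th) * ((sinC th - th) + 2 * th) / (al k)%:C ^+ 2.
    rewrite bE /a rmorphB !fmorphV !rmorphXn; field.
    by apply/andP; split; rewrite -normc_eq0 normc_real normr_eq0// gt_eqF.
  rewrite (le_trans (le_normcD _ _))// lerD//.
    have -> : 3 * (B ^+ 2 * T ^+ 2) / q ^+ 2 = (B * (T / q)) ^+ 2 * 3.
      by field; rewrite gt_eqF.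
    rewrite normcM normcX normc_real ler_pM ?csc_sub_le//; first by nonneg.
    by rewrite lerXn2r ?nnegrE //; nonneg.
  have -> : B * (B + 1) * T * n ^+ 2 / q * (k.+1%:R ^+ 2)^-1 =
      B * (T / q) ^+ 2 * ((B + 1) * (T / q)) / al k ^+ 2.
    transitivity (B * (B + 1) * (T / q) * (n ^+ 2 / k.+1%:R ^+ 2)); first by ring.
    by rewrite -tq; ring.
  rewrite normcM normcV normcX normc_real gtr0_norm// ler_wpM2r ?invr_ge0 ?exprn_ge0 ?(ltW (al0 _))//.
  rewrite normcM ler_pM ?normc_ge0//.
  rewrite (_ : _ + 2 * th = sinC th + th); last by ring.
  by rewrite (le_trans (le_normcD _ _))// nth mulrDl mul1r lerD2r.
pose e (k : 'I_M) := 1 + D / k.+1%:R ^+ 2.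
have N1 (x : C) (d : R) : normc x <= d -> normc (1 - x) <= 1 + d.
  by move=> xd; rewrite (le_trans (le_normcD _ _))// normc1 normcN lerD2l.
have PP : \prod_(k < M) e k <= P by exact: prod_1D_le.
have e1 k : 1 <= e k by rewrite lerDl divr_ge0 ?exprn_ge0.
have := @prod_dist R _ (index_enum 'I_M) (fun k => 1 - a k) (fun k => 1 - b k) e e1
  (fun k => N1 _ _ (aD k)) (fun k => N1 _ _ (bD k)).
set Pa := \prod_(k < M) (1 - a k); set Pb := \prod_(k < M) (1 - b k) => H.
have S : \sum_(k < M) normc (1 - a k - (1 - b k)) <= K / q.
  have E (k : 'I_M) : normc (1 - a k - (1 - b k)) <=
    3 * (B ^+ 2 * T ^+ 2) / q ^+ 2 + B * (B + 1) * T * n ^+ 2 / q * (k.+1%:R ^+ 2)^-1.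
    by rewrite (_ : _ - _ = - (a k - b k)) ?normcN//; ring.
  rewrite (le_trans (ler_sum _ (fun k _ => E k)))// big_split /=.
  rewrite sumr_const card_ord -mulr_sumr /K [leRHS]mulrDl lerD//.
    have -> : (3 * (B ^+ 2 * T ^+ 2) / q ^+ 2) *+ M = 3 * (B ^+ 2 * T ^+ 2) / q * (M%:R / q).
      by rewrite -[LHS]mulr_natr; field; rewrite gt_eqF.
    by rewrite ler_piMr//; nonneg.
  have -> : 2 * (B * (B + 1) * T * n ^+ 2) / q = B * (B + 1) * T * n ^+ 2 / q * 2 by ring.
  by rewrite ler_wpM2l ?sum_inv_sqr//; nonneg.
have {}H : normc (Pa - Pb) <= P * (K / q).
  rewrite (le_trans H)// ler_pM ?sumr_ge0 ?prodr_ge0// => k _; rewrite ?normc_ge0//.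
  by rewrite (le_trans _ (e1 k)).
have Pbn : normc Pb <= P.
  rewrite (le_trans _ PP)// /Pb normc_prod; apply: ler_prod => k _.
  by rewrite normc_ge0 N1.
have mth : piC R * t = m%:R * th by rewrite /th [RHS]mulrC divfK.
have sE : sinC (piC R * t) = m%:R * sinC th * Pa by rewrite mth sinC_finite_prod.
rewrite sE mth (_ : _ - _ = - (m%:R * sinC th * (Pa - Pb)) - m%:R * (sinC th - th) * Pb);
  last by ring.
rewrite (le_trans (le_normcD _ _))// !normcN.
have qM1 : q^-1 <= (M.+1%:R)^-1.
  by rewrite lef_pV2 ?posrE ?ltr0n// ler_nat ltnS -addnn leq_addr.
rewrite (@le_trans _ _ ((B * T * (P * K) + B * T ^+ 2 * P) * q^-1))//; last first.
  by apply: ler_wpM2l; nonneg.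
have nE (x y : C) : normc (m%:R * x * y) = q * normc x * normc y.
  by rewrite !normcM normc_nat.
rewrite mulrDl !nE lerD//.
  have -> : B * T * (P * K) / q = q * (B * (T / q)) * (P * (K / q)).
    by field; rewrite gt_eqF.
  by apply: ler_pM; rewrite ?normc_ge0 ?ler_pM2l//; nonneg.
have -> : B * T ^+ 2 * P / q = q * (B * (T / q) ^+ 2) * P.
  by field; rewrite gt_eqF.
by apply: ler_pM; rewrite ?normc_ge0 ?ler_pM2l//; nonneg.
Qed.
End EulerSine.

(** * The reflection formula *)

Section Reflection.
Variable R : realType.
Local Notation C := R[i].
Implicit Types (x w t : C).

(** The ratio n (n^n exp (- n) / n!)^2, of limit 1 / (2 pi) by Stirling's
    formula. *)
Definition stirling n : C := n%:R ^+ n.*2.+1 * expC (- n.*2%:R) / n`!%:R ^+ 2.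

Definition sine_prod t m : C := \prod_(k < m) (1 - t ^+ 2 / k.+1%:R ^+ 2).

(** What remains of the logarithms of the last terms of hurwitz_J1 (w + x) and
    hurwitz_J1 (w - x) once they are compared with log ((m + 1) w). *)
Definition log_err x w m : C :=
  let c := m.+1%:R * w in
  (m%:R + 2^-1 + x / w) * (logC (c + x) - logC c)
  + (m%:R + 2^-1 - x / w) * (logC (c - x) - logC c).

Lemma Re_shift_gt0 x w m (s : R) : `|Re x| < Re w -> `|s| <= 1 ->
  (Re w - `|Re x|) * m.+1%:R <= Re (m.+1%:R * w + s%:C * x).
Proof.
move=> xw s1; rewrite ReD Re_natM ReRM.
have h : - `|Re x| <= s * Re x.
  by rewrite lerNl -mulNr (le_trans (ler_norm _))// normrM normrN ler_piMl.
have h2 : `|Re x| <= `|Re x| * m.+1%:R by rewrite ler_peMr// ler1n.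
rewrite mulrBl [m.+1%:R * _]mulrC; lra.
Qed.

(** The sum of the two logarithms is even in x, hence O(1 / m^2), and their
    difference is O(1 / m). *)
Lemma log_err_cvg x w : `|Re x| < Re w -> clim (log_err x w) 0.
Proof.
move=> xw; set d := Re w - `|Re x|.
have d0 : 0 < d by rewrite subr_gt0.
have w0 : 0 < Re w by apply: le_lt_trans xw.
set X := normc x.
have X0 : 0 <= X by exact: normc_ge0.
pose K := 2 * (X / d) ^+ 2 + normc (x / w) * (2 * (X / d)).
have K0 : 0 <= X / d by rewrite divr_ge0// ltW.
apply: (clim_le (m := 0) (b := fun m => K * (m.+1%:R)^-1)); last exact: harmonic0.
move=> m _; rewrite subr0; set q : R := m.+1%:R.
have q0 : 0 < q by rewrite ltr0n.
set c : C := m.+1%:R * w.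
have cE (s : R) : `|s| <= 1 -> 0 < Re (c + s%:C * x) /\
    normc (x / (c + s%:C * x)) <= X / d / q.
  move=> s1; have h := Re_shift_gt0 m xw s1.
  have h0 : 0 < d * q by rewrite mulr_gt0.
  have h1 : 0 < Re (c + s%:C * x) by rewrite (lt_le_trans _ h).
  split=> //; rewrite normcM normcV -mulrA -invfM ler_wpM2l// lef_pV2 ?posrE//.
    by rewrite (le_trans h)// (le_trans (ler_norm _))// normc_Re.
  by rewrite (lt_le_trans h1)// (le_trans (ler_norm _))// normc_Re.
have lin (e : C) (s : R) : cder (fun u => c + u%:C * e) s e.
  apply: cder_ext (cderD (cder_const s c) (cderM (cder_id s) (cder_const s e))) => //.
  by ring.
have ld (s : R) : `|s| <= 1 -> cder (fun u => logC (c + u%:C * x)) s (x / (c + s%:C * x)).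
  by move=> s1; apply: cder_log (lin x s); have [] := cE s s1.
have ld' (s : R) : `|s| <= 1 -> cder (fun u => logC (c - u%:C * x)) s (- (x / (c - s%:C * x))).
  move=> s1; have [h0 _] := cE (- s) (etrans (congr1 (fun y => y <= 1) (normrN s)) s1).
  rewrite rmorphN mulNr in h0.
  have := cder_log (f := fun u => c + u%:C * - x) _ (lin (- x) s).
  rewrite mulrN => /(_ h0); apply: cder_ext => [u|]; first by rewrite mulrN.
  by rewrite mulNr.
have s01 (s : R) : 0 <= s <= 1 -> `|s| <= 1.
  by move=> /andP[s0 s1]; rewrite ger0_norm.
have cN (s : R) : `|s| <= 1 -> normc (x / (c - s%:C * x)) <= X / d / q.
  move=> s1; have [] := cE (- s); first by rewrite normrN.
  by rewrite rmorphN mulNr.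
have lp : normc (logC (c + x) - logC c) <= X / d / q.
  have := @cder_lip R (fun u => logC (c + u%:C * x)) _ (X / d / q) 0 1 ler01
    (fun s hs => ld s (s01 s hs)) (fun s hs => (cE s (s01 s hs)).2).
  by rewrite mul1r mul0r addr0 subr0 mulr1.
have lm : normc (logC (c - x) - logC c) <= X / d / q.
  have H (s : R) : 0 <= s <= 1 -> normc (- (x / (c - s%:C * x))) <= X / d / q.
    by move=> hs; rewrite normcN cN// s01.
  have := @cder_lip R (fun u => logC (c - u%:C * x)) _ (X / d / q) 0 1 ler01
    (fun s hs => ld' s (s01 s hs)) H.
  by rewrite mul1r mul0r !subr0 mulr1.
have lpm : normc ((logC (c + x) - logC c) + (logC (c - x) - logC c)) <= 2 * (X / d / q) ^+ 2.
  have D (s : R) : 0 <= s <= 1 -> cder (fun u => logC (c + u%:C * x) + logC (c - u%:C * x)) s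
      (- (2 * s%:C) * ((x / (c + s%:C * x)) * (x / (c - s%:C * x)))).
    move=> hs; have hs' := s01 s hs.
    apply: cder_ext (cderD (ld s hs') (ld' s hs')) => //.
    have [h0 _] := cE s hs'.
    have [h1 _] := cE (- s) (etrans (congr1 (fun y => y <= 1) (normrN s)) hs').
    rewrite rmorphN mulNr in h1.
    by field; rewrite !Re_neq0.
  have H (s : R) : 0 <= s <= 1 -> normc (- (2 * s%:C) * ((x / (c + s%:C * x)) * (x / (c - s%:C * x))))
      <= 2 * (X / d / q) ^+ 2.
    move=> hs; have hs' := s01 s hs.
    rewrite normcM normcN [normc (_ * _%:C)]normcM normc_nat normc_real [normc (_ * (_ / _))]normcM.
    rewrite expr2 ler_pM ?mulr_ge0 ?normc_ge0//; first by rewrite ler_piMr.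
    by rewrite ler_pM ?normc_ge0 ?cN ?(cE s hs').2.
  have := @cder_lip R _ _ _ 0 1 ler01 D H.
  rewrite mul1r mul0r addr0 !subr0 mulr1.
  by rewrite (_ : _ - _ = logC (c + x) - logC c + (logC (c - x) - logC c))//; ring.
rewrite /log_err -/c.
rewrite (_ : _ + _ = (m%:R + 2^-1) * ((logC (c + x) - logC c) + (logC (c - x) - logC c))
  + x / w * ((logC (c + x) - logC c) - (logC (c - x) - logC c))); last by ring.
rewrite (le_trans (le_normcD _ _))// /K [leRHS]mulrDl lerD// normcM.
  have -> : 2 * (X / d) ^+ 2 * q^-1 = q * (2 * (X / d / q) ^+ 2).
    by field; rewrite !gt_eqF.
  rewrite ler_pM ?normc_ge0//.
  have -> : (m%:R + 2^-1 : C) = (m%:R + 2^-1 : R)%:C by rewrite rmorphD fmorphV !rmorph_nat.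
  rewrite normc_real ger0_norm ?addr_ge0// /q -[m.+1%:R]natr1 lerD2l; lra.
rewrite -[leRHS]mulrA ler_wpM2l ?normc_ge0// (le_trans (le_normcD _ _))// normcN.
by rewrite -mulrA mulr_natl mulr2n lerD.
Qed.

(** The limit gamma_ratio exponentiates to a Gauss product: the finite products for
    w + x and w - x combine into the partial product of the sine, and the powers
    and exponentials left over into Stirling's ratio. *)
Lemma reflection_seq x w m : `|Re x| < Re w ->
  expC (hurwitz_J1 (w + x) w m + (2^-1 - (w + x) / w)
      + (hurwitz_J1 (w - x) w m + (2^-1 - (w - x) / w))) * sine_prod (x / w) m
  = w * stirling m.+1 * expC (log_err x w m).
Proof.
move=> xw; have w0 : w != 0 by apply: Re_neq0; apply: le_lt_trans xw.
have wR : 0 < Re w by apply: le_lt_trans xw.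
have yE n : w + x + n%:R * w = n.+1%:R * w + x by rewrite -[n.+1%:R]natr1; ring.
have zE n : w - x + n%:R * w = n.+1%:R * w - x by rewrite -[n.+1%:R]natr1; ring.
set c := m.+1%:R * w.
have cR : 0 < Re c by rewrite Re_natM mulr_gt0// ltr0n.
have -> : hurwitz_J1 (w + x) w m + (2^-1 - (w + x) / w)
      + (hurwitz_J1 (w - x) w m + (2^-1 - (w - x) / w)) =
  - m.+1.*2%:R + ((m.*2.+1)%:R * logC c + (\sum_(n < m) (- logC (n.+1%:R * w + x) - logC (n.+1%:R * w - x))
    + log_err x w m)).
  rewrite /hurwitz_J1 /log_err !yE !zE -/c big_split /=.
  have E s : \sum_(n < m) - logC (w + s + n%:R * w) = \sum_(n < m) - logC (n.+1%:R * w + s).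
    by apply: eq_bigr => n _; rewrite -[n.+1%:R]natr1; congr (- logC _); ring.
  rewrite (E x) (E (- x)).
  have -> : (m.+1.*2%:R : C) = 2 * (m%:R + 1) by rewrite natr1 -natrM mul2n.
  have -> : (m.*2.+1%:R : C) = 2 * m%:R + 1 by rewrite -natr1 -mul2n natrM.
  have -> : c = (m%:R + 1) * w by rewrite /c natr1.
  by field.
rewrite [expC (- _ + _)]expCD [expC (_ * logC c + _)]expCD [expC (\sum_(n < m) _ + _)]expCD.
rewrite expC_sum expC_nat (expC_logC cR) /stirling /sine_prod.
set eo := expC (log_err x w m); set e1 := expC (- _); set p1 := \prod_(n < m) expC _.
set p2 := \prod_(n < m) _.
have -> : e1 * (c ^+ m.*2.+1 * (p1 * eo)) * p2 = e1 * c ^+ m.*2.+1 * (p1 * p2) * eo.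
  by clearbody e1 p1 eo p2; ring.
congr (_ * _).
have fE : m.+1`!%:R = m.+1%:R * \prod_(k < m) k.+1%:R :> C.
  rewrite factS natrM; congr (_ * _); elim: (m) => [|k IH]; first by rewrite big_ord0.
  by rewrite big_ord_recr /= factS natrM IH mulrC.
have pE : (\prod_(n < m) expC (- logC (n.+1%:R * w + x) - logC (n.+1%:R * w - x)))
    * \prod_(k < m) (1 - (x / w) ^+ 2 / k.+1%:R ^+ 2) =
    (w ^+ 2) ^- m * (\prod_(k < m) k.+1%:R) ^- 2.
  have RE j : (w ^+ 2) ^- j * (\prod_(k < j) k.+1%:R) ^- 2 =
      \prod_(k < j) ((w ^+ 2)^-1 * (k.+1%:R ^+ 2)^-1) :> C.
    elim: j => [|j IH]; first by rewrite !big_ord0 expr0 expr1n invr1 mulr1.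
    by rewrite !big_ord_recr /= -IH exprSr exprMn !invfM; ring.
  rewrite RE -big_split /=.
  apply: eq_bigr => k _ /=.
  have kx (s : R) : `|s| <= 1 -> k.+1%:R * w + s%:C * x != 0 /\ 0 < Re (k.+1%:R * w + s%:C * x).
    move=> s1; suff h : 0 < Re (k.+1%:R * w + s%:C * x) by split => //; apply: Re_neq0.
    by rewrite (lt_le_trans _ (Re_shift_gt0 k xw s1))// mulr_gt0 ?subr_gt0 ?ltr0n.
  have [p0 pR] := kx 1 (ltac:(by rewrite normr1)).
  have [q0 qR] := kx (-1) (ltac:(by rewrite normrN normr1)).
  rewrite mul1r in p0 pR; rewrite rmorphN mulN1r in q0 qR.
  rewrite expCD !expCN !expC_logC//.
  have kn : k.+1%:R != 0 :> C by rewrite pnatr_eq0.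
  move: p0 q0 kn; move: (k.+1%:R : C) => v p0 q0 kn; field.
  by rewrite p0 q0 w0 kn.
rewrite /p1 /p2 pE fE.
have mn : m.+1%:R != 0 :> C by rewrite pnatr_eq0.
have Pn : \prod_(k < m) k.+1%:R != 0 :> C.
  by apply/prodf_neq0 => k _; rewrite pnatr_eq0.
have -> : c ^+ m.*2.+1 = m.+1%:R ^+ m.*2.+1 * ((w ^+ 2) ^+ m * w).
  by rewrite -exprM mul2n -exprSr -exprMn.
have -> : m.+1%:R ^+ m.+1.*2.+1 = m.+1%:R ^+ m.*2.+1 * m.+1%:R ^+ 2 :> C.
  by rewrite -exprD addn2.
move: (\prod_(k < m) _) Pn => P Pn; move: (m.+1%:R ^+ _) => A.
have wm : (w ^+ 2) ^+ m != 0 by rewrite !expf_neq0.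
move: ((w ^+ 2) ^+ m) wm => W wm; clearbody e1.
move: (m.+1%:R : C) mn => v mn.
by field; rewrite wm mn Pn.
Qed.

(** At t = 1/2 the sine product is the Wallis product, which in terms of factorials
    is (2 n + 1) (2 n)!^2 / (16^n n!^4). *)
Lemma wallis_stirling n : (0 < n)%N ->
  sine_prod 2^-1 n * stirling n.*2 = 2 * (2 + n%:R^-1) * stirling n ^+ 2.
Proof.
have SP k : sine_prod 2^-1 k * (16%:R ^+ k * k`!%:R ^+ 4) = k.*2.+1%:R * k.*2`!%:R ^+ 2.
  elim: k => [|k IH]; first by rewrite /sine_prod big_ord0 fact0 !expr1n expr0 !mulr1.
  rewrite /sine_prod big_ord_recr /= -/(sine_prod 2^-1 k).
  have kn : k.+1%:R != 0 :> C by rewrite pnatr_eq0.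
  rewrite [16%:R ^+ k.+1]exprS doubleS !factS !natrM !exprMn.
  transitivity (sine_prod 2^-1 k * (16%:R ^+ k * k`!%:R ^+ 4) *
     (4 * k.+1%:R ^+ 2 * (4 * k.+1%:R ^+ 2 - 1))); first by field.
  rewrite IH.
  have -> : (k.*2.+3%:R : C) = 2 * k.+1%:R + 1 by rewrite -natrM natr1 mul2n doubleS.
  have -> : (k.*2.+2%:R : C) = 2 * k.+1%:R by rewrite -natrM mul2n doubleS.
  have -> : (k.*2.+1%:R : C) = 2 * k.+1%:R - 1.
    by rewrite -natrM mul2n doubleS -[k.*2.+2%:R]natr1 addrK.
  by ring.
move=> n0; have nn : n%:R != 0 :> C by rewrite pnatr_eq0 -lt0n.
have fn k : k`!%:R != 0 :> C by rewrite pnatr_eq0 -lt0n fact_gt0.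
have n16 : 16%:R ^+ n != 0 :> C by rewrite expf_neq0// pnatr_eq0.
have S : sine_prod 2^-1 n = n.*2.+1%:R * n.*2`!%:R ^+ 2 / (16%:R ^+ n * n`!%:R ^+ 4).
  by rewrite -SP mulfK// mulf_neq0// expf_neq0.
have -> : stirling n.*2 = 2 * n%:R * 16%:R ^+ n * (n%:R ^+ n) ^+ 4 *
    expC (- n.*2%:R) ^+ 2 / n.*2`!%:R ^+ 2.
  rewrite /stirling; congr (_ / _).
  have -> : expC (- n.*2.*2%:R) = expC (- n.*2%:R) ^+ 2 :> C.
    by rewrite -expC_nat; congr expC; rewrite -[n.*2.*2]mul2n natrM mulrN.
  congr (_ * _).
  have -> : n.*2%:R = 2 * n%:R :> C by rewrite -natrM mul2n.
  have e4 (z : C) : z ^+ n.*2.*2 = (z ^+ 4) ^+ n by rewrite -exprM; congr (_ ^+ _); lia.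
  have e1 : (2 : C) ^+ n.*2.*2 = 16%:R ^+ n by rewrite e4 -natrX.
  by rewrite exprS exprMn e1 e4 -!exprM [(4 * n)%N]mulnC; ring.
rewrite S /stirling.
have -> : n.*2.+1%:R = 2 * n%:R + 1 :> C by rewrite -natrM natr1 mul2n.
have -> : n%:R ^+ n.*2.+1 = n%:R * (n%:R ^+ n) ^+ 2 :> C by rewrite exprS -exprM -muln2.
move: (n%:R ^+ n) (expC _) (fn n) (fn n.*2) => A E.
move: (n`!%:R : C) (n.*2`!%:R : C) => f g f0 g0.
by field; rewrite nn f0 g0 n16.
Qed.

(** reflection_seq at x = 0 and w = 1 shows that the limit k exists and is not 0;
    then wallis_stirling gives (2 / pi) k = 4 k^2 in the limit. *)
Lemma stirling_cvg : clim stirling (2 * piC R)^-1.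
Proof.
have R1 : `|Re (0 : C)| < Re (1 : C) by rewrite normr0 ltr01.
have p1 : 0 < Re (1 : C) by exact: ltr01.
have [b [rho [N [_ _ /(_ erefl) bl]]]] := hurwitz_limit p1 p1 (lexx 0 : 0 <= Re (0 : C)).
have : exists2 k : C, k != 0 & clim stirling k.
  exists (expC (b 1%N + (2^-1 - 1) + (b 1%N + (2^-1 - 1)))); first exact: expC_neq0.
  have h := climD bl (clim_const (2^-1 - 1)).
  rewrite (clim_shift _ _ 1); apply: (clim_ext (m := 0)) (clim_expC (climD h h)) => m _.
  have := reflection_seq m R1; rewrite addr0 subr0 !divr1 mul1r.
  have -> : sine_prod 0 m = 1.
    by rewrite /sine_prod big1// => k _; rewrite expr0n mul0r subr0.
  have -> : log_err 0 1 m = 0 by rewrite /log_err mul0r !addr0 !subr0 subrr !mulr0 addr0.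
  by rewrite expC0 !mulr1 addn1.
move=> [k k0 sk].
have dk : clim (fun n => stirling n.*2) k.
  by apply: clim_subseq sk => n; rewrite -addnn leq_addr.
have sp : clim (fun n => piC R * 2^-1 * sine_prod 2^-1 n) 1.
  have := @euler_sine R 2^-1.
  have -> // : sinC (piC R * 2^-1) = 1.
  rewrite (_ : piC R * 2^-1 = (pi / 2)%:C); last by rewrite rmorphM fmorphV rmorph_nat.
  by rewrite sinC_real sin_pihalf.
have inv0 : clim (fun n => (n%:R : C)^-1) 0.
  rewrite (clim_shift _ _ 1); apply: (clim_le (m := 0)) (harmonic0 1) => n _.
  by rewrite subr0 normcV normc_nat mul1r addn1.
have h1 := climM sp dk.
have h2 := climMc (piC R) (climM (climD (clim_const 2) inv0) (climM sk sk)).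
have E : 1 * k = piC R * ((2 + 0) * (k * k)).
  apply: clim_uniq h1 _; apply: (clim_ext (m := 1)) h2 => n n0.
  by have := wallis_stirling n0; rewrite expr2 => h; rewrite -[RHS]mulrA h;
    move: (n%:R^-1) (piC R) => v p; field.
have -> : (2 * piC R)^-1 = k; last exact: sk.
have k2 : 2 * piC R * k = 1.
  by apply: (mulIf k0); rewrite E; ring.
have p2 : 2 * piC R != 0 by rewrite mulf_neq0 ?piC_neq0.
by apply: (mulfI p2); rewrite k2 divff.
Qed.

Lemma hurwitz_reflection x w l l' : `|Re x| < Re w ->
  clim (hurwitz_J1 (w + x) w) l -> clim (hurwitz_J1 (w - x) w) l' ->
  expC (l + (2^-1 - (w + x) / w)) * expC (l' + (2^-1 - (w - x) / w))
    * (2 * sinC (piC R * x / w)) = x.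
Proof.
move=> xw hl hl'; have w0 : w != 0 by apply: Re_neq0; apply: le_lt_trans xw.
rewrite -expCD; set P := expC _.
have hP := clim_expC (climD (climD hl (clim_const (2^-1 - (w + x) / w)))
   (climD hl' (clim_const (2^-1 - (w - x) / w)))).
have hs := euler_sine (x / w).
have ho := clim_expC (log_err_cvg xw); rewrite expC0 in ho.
have hk : clim (fun m => stirling m.+1) (2 * piC R)^-1.
  by have := stirling_cvg; rewrite (clim_shift _ _ 1); apply: (clim_ext (m := 0)) => n; rewrite addn1.
have h1 := climM hP hs.
have h2 := climMc (piC R * (x / w) * w) (climM hk ho).
have E : P * sinC (piC R * (x / w)) = piC R * (x / w) * w * ((2 * piC R)^-1 * 1).
  apply: clim_uniq h1 _; apply: (clim_ext (m := 0)) h2 => m _.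
  have h := reflection_seq m xw.
  by rewrite -/(sine_prod (x / w) m) [RHS]mulrCA h; move: (expC _) => e; ring.
rewrite -[piC R * x / w]mulrA mulrCA E.
by move: (piC R) (piC_neq0 R) => p p0; field; rewrite p0 w0.
Qed.

(** The sums for x and x + w differ by their end terms, of which only the first,
    log x, and the constant 1 remain in the limit. *)
Lemma hurwitz_shift x w l l' : 0 < Re x -> 0 < Re w ->
  clim (hurwitz_J1 x w) l -> clim (hurwitz_J1 (x + w) w) l' ->
  expC (l' + (2^-1 - (x + w) / w)) = x * expC (l + (2^-1 - x / w)).
Proof.
move=> x0 w0 hl hl'; have wn := Re_neq0 w0.
suff -> : l' = l + 1 + logC x.
  rewrite -[X in _ = X * _](expC_logC x0) -expCD; congr expC; field; exact: wn.
apply: clim_uniq hl' _.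
have := climD (climD hl (clim_const 1)) (clim_const (logC x)).
rewrite (clim_shift _ _ 1); apply: (clim_ext (m := 0)) => m _.
have yE n : x + w + n%:R * w = x + n.+1%:R * w by rewrite -[n.+1%:R]natr1; ring.
rewrite /hurwitz_J1 addn1 big_ord_recl /= mul0r addr0.
under [X in _ = _ + (X - _) + _]eq_bigr do rewrite yE.
by rewrite yE /bump /= -[m.+1%:R]natr1; under eq_bigr do rewrite add1n; ring.
Qed.
End Reflection.

(** * Functional equations of the double gamma and double sine functions *)

Section DoubleGammaSwap.
Variable R : realType.
Local Notation C := R[i].
Implicit Types (x w : C).

Lemma quarter_latticeC w1 w2 : quarter_lattice w1 w2 = quarter_lattice w2 w1 :> set C.
Proof.
by apply/seteqP; split=> z [n1 [n2 ->]]; exists n2, n1; rewrite addrC.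
Qed.

Lemma is_double_zetaC w1 w2 x Z : is_double_zeta w1 w2 x Z -> is_double_zeta w2 w1 x Z.
Proof.
move=> [h1 h2]; split=> // s s2; have := h1 s s2; congr converges_to.
apply/funext => n; rewrite exchange_big /=; apply: eq_bigr => n1 _; apply: eq_bigr => n2 _.
by rewrite addrAC.
Qed.

Lemma is_double_gammaC w1 w2 (G : C -> C) : is_double_gamma w1 w2 G -> is_double_gamma w2 w1 G.
Proof.
move=> [h1 h2]; split=> [x x0|x]; last by rewrite quarter_latticeC; exact: h2.
by have [Z /is_double_zetaC ZP GE] := h1 x x0; exists Z.
Qed.

Lemma quarter_lattice0 w1 w2 : quarter_lattice w1 w2 (0 : C).
Proof. by exists 0%N, 0%N; rewrite !mul0r addr0. Qed.

Lemma quarter_latticeD1 w1 w2 x : quarter_lattice w1 w2 x -> quarter_lattice w1 w2 (x + w1).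
Proof. by move=> [n1 [n2 ->]]; exists n1.+1, n2; rewrite -[n1.+1%:R]natr1; ring. Qed.

Lemma quarter_latticeD2 w1 w2 x : quarter_lattice w1 w2 x -> quarter_lattice w1 w2 (x + w2).
Proof. by rewrite quarter_latticeC; exact: quarter_latticeD1. Qed.
End DoubleGammaSwap.

Section DoubleSine.
Variables (R : realType) (w1 w2 : R[i]) (G : R[i] -> R[i]).
Hypotheses (w10 : 0 < Re w1) (w20 : 0 < Re w2).
Hypothesis HG : is_double_gamma w1 w2 G.
Local Notation C := R[i].
Implicit Types (x z : C).
Local Notation lat := (quarter_lattice w1 w2).

Lemma Re_lattice x : lat x -> 0 <= Re x /\ (Re x <= 0 -> x = 0).
Proof.
move=> [n1 [n2 ->]]; rewrite ReD !Re_natM.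
have h1 : 0 <= n1%:R * Re w1 by rewrite mulr_ge0// ltW.
have h2 : 0 <= n2%:R * Re w2 by rewrite mulr_ge0// ltW.
split=> [|h]; first by rewrite addr_ge0.
have : n1%:R * Re w1 = 0 by lra.
have : n2%:R * Re w2 = 0 by lra.
move=> /eqP; rewrite mulf_eq0 pnatr_eq0 (gt_eqF w20) orbF => /eqP ->.
move=> /eqP; rewrite mulf_eq0 pnatr_eq0 (gt_eqF w10) orbF => /eqP ->.
by rewrite !mul0r addr0.
Qed.

Lemma latN_D1 x : ~ lat (- x) -> ~ lat (- (x + w1)).
Proof. by move=> h /quarter_latticeD1; rewrite opprD subrK. Qed.

Lemma latN_D2 x : ~ lat (- x) -> ~ lat (- (x + w2)).
Proof. by move=> h /quarter_latticeD2; rewrite opprD subrK. Qed.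

(** The segments from 1 + j i to z, for j = 0, 1, ..., meet only at z, and only
    finitely many points of the lattice have a real part in the relevant range:
    one of the segments avoids them all. *)
Lemma segment_avoid z : ~ lat (- z) -> exists2 p : C, 0 < Re p &
  forall t : R, 0 <= t <= 1 -> ~ lat (- (p + t%:C * (z - p))).
Proof.
move=> hz; have [z0|z0] := ltP 0 (Re z).
  by exists z => // t _; rewrite subrr mulr0 addr0.
apply: contrapT => H.
pose p (j : nat) : C := 1 +i* j%:R.
have /choice[f fP] (j : nat) : exists f : R * nat * nat, 0 <= f.1.1 <= 1 /\
    - (p j + f.1.1%:C * (z - p j)) = f.1.2%:R * w1 + f.2%:R * w2.
  apply: contrapT => Hj; apply: H; exists (p j) => /=; first exact: ltr01.
  by move=> t t01 [n1 [n2 E]]; apply: Hj; exists (t, n1, n2).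
pose K := maxn (Num.bound (- Re z / Re w1)) (Num.bound (- Re z / Re w2)).
have bnd (n : nat) (w : C) : 0 < Re w -> n%:R * Re w <= - Re z ->
    (n < Num.bound (- Re z / Re w))%N.
  move=> w0 h; have := @archi_boundP R (- Re z / Re w).
  rewrite divr_ge0 ?oppr_ge0 ?(ltW w0)// => /(_ isT).
  rewrite ltr_pdivrMr// => /(le_lt_trans h); by rewrite ltr_pM2r// ltr_nat.
have fK j : ((f j).1.2 < K)%N && ((f j).2 < K)%N.
  have [/andP[t0 t1] /(congr1 (@complex.Re R))] := fP j.
  rewrite ReN !ReD !Re_natM ReRM ReD ReN /= => E.
  have h1 : 0 <= (f j).1.2%:R * Re w1 by rewrite mulr_ge0// ltW.
  have h2 : 0 <= (f j).2%:R * Re w2 by rewrite mulr_ge0// ltW.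
  have h3 : (1 - (f j).1.1) * (Re z - 1) <= 0 by rewrite mulr_ge0_le0//; lra.
  have h4 : (f j).1.2%:R * Re w1 <= - Re z by lra.
  have h5 : (f j).2%:R * Re w2 <= - Re z by lra.
  by rewrite !leq_max (bnd _ _ w10 h4) (bnd _ _ w20 h5) orbT.
pose g (j : 'I_(K * K).+1) : 'I_K * 'I_K :=
  (Ordinal (proj1 (andP (fK j))), Ordinal (proj2 (andP (fK j)))).
suff gi : injective g by have := leq_card g gi; rewrite card_prod !card_ord ltnn.
move=> j k [E1 E2]; apply/val_inj => /=.
have [/andP[t0 t1] Ej] := fP j; have [/andP[s0 s1] Ek] := fP k.
have E : p j + (f j).1.1%:C * (z - p j) = p k + (f k).1.1%:C * (z - p k).
  by apply: oppr_inj; rewrite Ej Ek E1 E2.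
have tn : (f j).1.1 != 1.
  apply/eqP => t1'; apply: hz; exists (f j).1.2, (f j).2.
  by rewrite -Ej t1'; congr (- _); ring.
move: (congr1 (@complex.Re R) E) (congr1 (@complex.Im R) E).
rewrite !ReD !ImD !ReRM !ImRM !ReD !ImD !ReN !ImN /=.
move: (f j).1.1 (f k).1.1 tn => t s tn e1 e2.
have ts : t = s.
  have : (t - s) * (Re z - 1) = 0 by lra.
  by move=> /eqP; rewrite mulf_eq0 subr_eq0 => /orP[/eqP //|/eqP]; lra.
have : (1 - t) * (j%:R - k%:R) = 0 by rewrite -ts in e2; lra.
move=> /eqP; rewrite mulf_eq0 subr_eq0 eq_sym (negbTE tn) subr_eq0 eqr_nat.
by move=> /eqP.
Qed.

Lemma gamma_neq0_pos x : 0 < Re x -> G x != 0.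
Proof. by move=> x0; have [Z _ ->] := HG.1 x x0; exact: expC_neq0. Qed.

Lemma ana_gamma x : ~ lat (- x) -> ana G x.
Proof. by move=> hx; apply: analytic_ana; exact: HG.2. Qed.

Lemma gamma_eq_pos x : 0 < Re x ->
  G (x + w2) * G (x + w1) = x * G x * G (x + w1 + w2).
Proof.
move=> x0; have xw : 0 < Re (x + w2) by rewrite ReD addr_gt0.
have xw1 : 0 < Re (x + w1) by rewrite ReD addr_gt0.
have xw12 : 0 < Re (x + w1 + w2) by rewrite ReD addr_gt0.
have [l hl El] := gamma_ratio x0 w10 w20 HG.
have [l' hl' El'] := gamma_ratio xw w10 w20 HG.
have := hurwitz_shift x0 w20 hl hl'; rewrite -El -El' [x + w2 + w1]addrAC => h.
have g1 := gamma_neq0_pos xw1; have g12 := gamma_neq0_pos xw12.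
rewrite -[G (x + w2)](divfK g12) h; field; exact: g1.
Qed.

(** The identity holds on the right half-plane and extends along a segment that
    avoids the poles; being free of denominators it is between analytic
    functions. *)
Lemma gamma_eq x : ~ lat (- x) -> G (x + w2) * G (x + w1) = x * G x * G (x + w1 + w2).
Proof.
move=> hx; have [p p0 hp] := segment_avoid hx.
pose f z := G (z + w2) * G (z + w1) - z * G z * G (z + w1 + w2).
have : vanishes_near f x.
  apply: (@segment_identity R f p).
    move=> t t01; have h := hp t t01.
    move: (p + _) h => z h; have h1 := latN_D1 h; have h2 := latN_D2 h.
    have h12 := latN_D2 h1.
    apply: anaB; apply: anaM.
    - by apply: ana_shift; exact: ana_gamma.
    - by apply: ana_shift; exact: ana_gamma.
    - by apply: anaM; [exact: ana_id|exact: ana_gamma].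
    - have : ana (fun u => G (u + (w1 + w2))) z by apply: ana_shift; rewrite addrA; exact: ana_gamma.
      by apply: (ana_ext (d := 1)) => // h' _; rewrite addrA.
  exists (Re p) => // h hp'; rewrite /f gamma_eq_pos ?subrr//.
  have := le_lt_trans (le_trans (ler_norm _) (normc_Re (- h))).
  by rewrite normcN => /(_ _ hp'); rewrite ReN ReD; lra.
move=> [d d0 /(_ 0)]; rewrite normc0 addr0 => /(_ d0)/eqP.
by rewrite subr_eq0 => /eqP.
Qed.

(** Zeta-regularized values are exponentials, and gamma_eq propagates nonvanishing
    to the left, in steps of w1 and w2. *)
Lemma gamma_neq0 x : ~ lat (- x) -> G x != 0.
Proof.
pose d := Num.min (Re w1) (Re w2).
have d0 : 0 < d by rewrite lt_min w10.
have dw1 : d <= Re w1 by rewrite ge_min lexx.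
have dw2 : d <= Re w2 by rewrite ge_min lexx orbT.
have [x0 _|x0] := ltP 0 (Re x); first exact: gamma_neq0_pos.
have : 0 < Re x + (Num.bound (- Re x / d))%:R * d.
  have := @archi_boundP R (- Re x / d).
  rewrite divr_ge0 ?oppr_ge0 ?(ltW d0)// => /(_ isT); rewrite ltr_pdivrMr//; lra.
move: (Num.bound (- Re x / d)) => n; elim: n x {x0} => [|n IH] x; first by rewrite mul0r addr0 => /gamma_neq0_pos.
rewrite -natr1 => xn hx.
have h1 : G (x + w1) != 0 by apply: IH (latN_D1 hx); rewrite ReD; lra.
have h2 : G (x + w2) != 0 by apply: IH (latN_D2 hx); rewrite ReD; lra.
have : G (x + w2) * G (x + w1) != 0 by rewrite mulf_neq0.
by rewrite gamma_eq// !mulf_eq0 !negb_or => /andP[/andP[]].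
Qed.

(** Up to elementary factors this is the gamma function of x / w2, whence the
    functional equation and the reflection formula below. *)
Definition gquot x : C := G x / G (x + w1).
Local Notation F := gquot.

Lemma gquotD x : ~ lat (- x) -> F (x + w2) = x * F x.
Proof.
move=> hx; have h1 := gamma_neq0 (latN_D1 hx).
have h12 := gamma_neq0 (latN_D2 (latN_D1 hx)).
rewrite /F [x + w2 + w1]addrAC; apply: (mulIf h12); rewrite divfK//.
by apply: (mulIf h1); rewrite gamma_eq//; field.
Qed.

Lemma sin_shift x : sinC (piC R * (x - w2) / w2) = - sinC (piC R * x / w2).
Proof.
have wn := Re_neq0 w20.
have -> : piC R * x / w2 = piC R * (x - w2) / w2 + piC R.
  by move: (piC R) => p; field.
by rewrite sinCDpi opprK.
Qed.

Lemma gquot_refl_base x : `|Re x| < Re w2 -> ~ lat (- x) ->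
  F x * F (w2 - x) * (2 * sinC (piC R * x / w2)) = 1.
Proof.
move=> xw hx.
have xn : x != 0 by apply/eqP => x0; apply: hx; rewrite x0 oppr0; exact: quarter_lattice0.
have [h1 h2] := ltr_normlP _ _ xw.
have p1 : 0 < Re (w2 + x) by rewrite ReD; lra.
have p2 : 0 < Re (w2 - x) by rewrite ReD ReN; lra.
have [l hl El] := gamma_ratio p1 w10 w20 HG.
have [l' hl' El'] := gamma_ratio p2 w10 w20 HG.
have := hurwitz_reflection xw hl hl'; rewrite -El -El' -/(F (w2 + x)) -/(F (w2 - x)).
rewrite [w2 + x]addrC gquotD// => E.
by apply: (mulfI xn); rewrite mulr1 -[RHS]E; ring.
Qed.

(** By gquotD the left-hand side does not change when x is shifted by w2, and such
    shifts bring x to the strip of gquot_refl_base. *)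
Lemma gquot_refl_pos x : 0 <= Re x -> ~ lat (- x) -> ~ lat (- (w2 - x)) ->
  F x * F (w2 - x) * (2 * sinC (piC R * x / w2)) = 1.
Proof.
move=> x0; have := @archi_boundP R (Re x / Re w2).
rewrite divr_ge0 ?(ltW w20)// => /(_ isT); rewrite ltr_pdivrMr//.
move: (Num.bound (Re x / Re w2)) => n; elim: n x x0 => [|n IH] x x0; first by rewrite mul0r => h; exfalso; lra.
rewrite -natr1 mulrDl mul1r => xn hx hwx.
have [xw|xw] := ltP (Re x) (Re w2).
  by apply: gquot_refl_base => //; rewrite ger0_norm.
have hy : ~ lat (- (x - w2)).
  move=> /Re_lattice[_]; rewrite ReN ReD ReN => /(_ _) h.
  apply: hwx; have -> : w2 - x = 0; first by rewrite -opprB h//; lra.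
  by rewrite oppr0; exact: quarter_lattice0.
have hwy : ~ lat (- (w2 - (x - w2))).
  have -> : w2 - (x - w2) = w2 - x + w2 by ring.
  exact: latN_D2.
have := IH (x - w2) _ _ hy hwy; rewrite ReD ReN.
have -> : w2 - (x - w2) = w2 - x + w2 by ring.
rewrite gquotD// sin_shift => P; rewrite -[RHS]P; [|lra|lra].
have -> : F x = (x - w2) * F (x - w2) by rewrite -gquotD// subrK.
by ring.
Qed.

Lemma gquot_refl x : ~ lat (- x) -> ~ lat (- (w2 - x)) ->
  F x * F (w2 - x) * (2 * sinC (piC R * x / w2)) = 1.
Proof.
move=> hx hwx; have [x0|x0] := leP 0 (Re x); first exact: gquot_refl_pos.
have E : w2 - (w2 - x) = x by ring.
have := gquot_refl_pos (x := w2 - x); rewrite E => /(_ _ hwx hx).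
have -> : piC R * (w2 - x) / w2 = - (piC R * (x - w2) / w2) by ring.
rewrite sinCN sin_shift opprK [F (w2 - x) * _]mulrC; apply.
by rewrite ReD ReN; move: (w20) (x0) => *; lra.
Qed.

Lemma double_sine_neq0 x : double_sine_regular w1 w2 x -> double_sine G w1 w2 x != 0.
Proof.
by move=> [/gamma_neq0 h1 /gamma_neq0 h2]; rewrite /double_sine mulf_neq0// invr_neq0.
Qed.

(** The quotient of the two values is the inverse of gquot x * gquot (w2 - x). *)
Lemma double_sine_shift x :
  double_sine_regular w1 w2 x -> double_sine_regular w1 w2 (x + w1) ->
  double_sine G w1 w2 x = double_sine G w1 w2 (x + w1) * (2 * sinC (piC R * x / w2)).
Proof.
have E : w1 + w2 - (x + w1) = w2 - x by ring.
have E' : w2 - x + w1 = w1 + w2 - x by ring.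
rewrite /double_sine_regular /double_sine E => -[hx hwx] [hx1 hw2x].
have := gquot_refl hx hw2x; rewrite /F E' => P.
have g1 := gamma_neq0 hx; have g2 := gamma_neq0 hwx.
have g3 := gamma_neq0 hx1; have g4 := gamma_neq0 hw2x.
rewrite -[LHS]mulr1 -[X in _ * X = _]P; field.
by rewrite g1 g2 g3.
Qed.
End DoubleSine.

(** * The scalar factor of the R-matrix *)

Section ScalarFactor.
Variables (R : realType) (N : nat) (r : R[i]) (G : R[i] -> R[i]).
Hypotheses (N0 : (0 < N)%N) (r0 : 0 < Re r).
Hypothesis HG : is_double_gamma r N%:R G.
Local Notation C := R[i].
Local Notation NC := (N%:R : C).
Local Notation pi := (piC R).
Local Notation S2 := (double_sine G r NC).
Local Notation reg := (double_sine_regular r NC).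
Implicit Types (x b : C).

Let NR : 0 < Re NC. Proof. by rewrite Re_nat ltr0n. Qed.
Let Nn : NC != 0. Proof. exact: Re_neq0 NR. Qed.
Let rn : r != 0. Proof. exact: Re_neq0 r0. Qed.

Lemma S2_shift_r x : reg x -> reg (x + r) -> S2 x = S2 (x + r) * (2 * sinC (pi * x / NC)).
Proof. exact: (double_sine_shift r0 NR HG). Qed.

Lemma S2_shift_N x : reg x -> reg (x + NC) -> S2 x = S2 (x + NC) * (2 * sinC (pi * x / r)).
Proof.
have E y : double_sine G NC r y = S2 y by rewrite /double_sine [NC + r]addrC.
have E' y : reg y -> double_sine_regular NC r y.
  by rewrite /double_sine_regular quarter_latticeC [NC + r]addrC.
move=> /E' h1 /E' h2; rewrite -!E.
exact: (double_sine_shift NR r0 (is_double_gammaC HG)).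
Qed.

Lemma S2_neq0 x : reg x -> S2 x != 0.
Proof. exact: (double_sine_neq0 r0 NR HG). Qed.

Lemma S0_mulN b : Rmx_regular N r b -> S0 N r G b * S0 N r G (- b) = 1.
Proof.
move=> [[/S2_neq0 h1 /S2_neq0 h2 /S2_neq0 h3 /S2_neq0 h4] _ _ _].
rewrite /S0 mulrN mulNr !opprK; set x := 'i * b / pi in h1 h2 h3 h4 *.
field; by rewrite h1 h2 h3 h4.
Qed.

(** With x = i beta / pi, the crossing beta |-> - beta + N i pi is x |-> - x - N:
    each of the four double sine values of the second factor is a shift by N of
    one of the first factor. *)
Lemma S0_crossing b (b' := - b + N%:R * 'i * pi) :
  Rmx_regular N r b -> Rmx_regular N r b' ->
  S0 N r G b * S0 N r G b' * (sinC ('i * b / r) * sinC ('i * b' / r)) =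
  sinC (('i * b + pi) / r) * sinC (('i * b' + pi) / r).
Proof.
move=> [[h1 h2 h3 h4] _ _ _] [[h1' h2' h3' h4'] _ _ _]; move: h1' h2' h3' h4'.
rewrite /S0; set x := 'i * b / pi in h1 h2 h3 h4 *.
have pn := piC_neq0 R; have i2 := @sqr_i R.
have -> : 'i * b' / pi = - x - NC.
  apply: (mulIf pn); rewrite divfK// mulrBl mulNr /x divfK// /b' mulrDr.
  rewrite (_ : 'i * (NC * 'i * pi) = 'i * 'i * NC * pi); last by ring.
  by rewrite i2; ring.
have -> : - (- x - NC) = x + NC by ring.
have -> : 1 + (- x - NC) = 1 - x - NC by ring.
have -> : 1 + (x + NC) = 1 + x + NC by ring.
move=> h1' h2' h3' h4'.
have E1 := S2_shift_N h3 h1'.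
have E2 := S2_shift_N (x := - x - NC); rewrite subrK in E2; have {}E2 := E2 h3' h1.
have E3 := S2_shift_N h2 h4'.
have E4 := S2_shift_N (x := 1 - x - NC); rewrite subrK in E4; have {}E4 := E4 h2' h4.
have ib : 'i * b = pi * x by rewrite /x [pi * _]mulrC divfK.
have bx : 'i * b' = pi * (- x - NC).
  rewrite /b' mulrDr mulrN ib (_ : 'i * (NC * 'i * pi) = 'i * 'i * NC * pi); last by ring.
  by rewrite i2; ring.
rewrite bx ib; have -> : (pi * x + pi) / r = pi * (1 + x) / r by ring.
 have -> : (pi * (- x - NC) + pi) / r = pi * (1 - x - NC) / r by ring.
move: (S2_neq0 h1) (S2_neq0 h3) (S2_neq0 h4) (S2_neq0 h1') (S2_neq0 h3') (S2_neq0 h4') E1 E2 E3 E4.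
move: (S2 x) (S2 (- x)) (S2 (1 + x)) (S2 (1 - x)) (S2 (x + NC)) (S2 (- x - NC))
  (S2 (1 + x + NC)) (S2 (1 - x - NC)) => S T U V S' T' U' V'.
move: (sinC (pi * x / r)) (sinC (pi * (- x - NC) / r)) (sinC (pi * (1 + x) / r))
  (sinC (pi * (1 - x - NC) / r)) => s1 s2 s3 s4.
move=> T0 S0 V0 S'0 T'0 U'0 E1 E2 -> ->; rewrite E1 E2.
have s10 : s1 != 0 by apply: contraNneq S0 => s0; rewrite E1 s0 !mulr0.
have s20 : s2 != 0 by apply: contraNneq T'0 => s0; rewrite E2 s0 !mulr0.
by field; rewrite T0 V0 S'0 U'0 s10 s20.
Qed.

(** With x = i beta / pi, the shift of beta by - i pi r is the shift of x by r. *)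
Lemma S0_shift b (b' := b - 'i * pi * r) :
  Rmx_regular N r b -> Rmx_regular N r b' ->
  S0 N r G b' * (sinC ((pi + 'i * b) / NC) * sinC ((pi - 'i * b') / NC)) =
    S0 N r G b * (sinC (- ('i * b') / NC) * sinC ('i * b / NC)) /\
  sinC ((pi - 'i * b') / NC) != 0.
Proof.
move=> [[h1 h2 h3 h4] _ _ _] [[h1' h2' h3' h4'] _ _ _]; move: h1' h2' h3' h4'.
rewrite /S0; set x := 'i * b / pi in h1 h2 h3 h4 *.
have pn := piC_neq0 R; have i2 := @sqr_i R.
have ib : 'i * b = pi * x by rewrite /x [pi * _]mulrC divfK.
have bx : 'i * b' = pi * (x + r).
  rewrite /b' mulrBr ib (_ : 'i * ('i * pi * r) = 'i * 'i * pi * r); last by ring.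
  by rewrite i2; ring.
rewrite bx ib; have -> : pi * (x + r) / pi = x + r by rewrite mulrC mulKf.
have -> : - (x + r) = - x - r by ring.
have -> : 1 + (- x - r) = 1 - x - r by ring.
have -> : 1 + (x + r) = 1 + x + r by ring.
move=> h1' h2' h3' h4'.
have E1 := S2_shift_r h3 h3'.
have E2 := S2_shift_r (x := - x - r); rewrite subrK in E2; have {}E2 := E2 h1' h1.
have E3 := S2_shift_r h2 h2'.
have E4 := S2_shift_r (x := 1 - x - r); rewrite subrK in E4; have {}E4 := E4 h4' h4.
have -> : (pi + pi * x) / NC = pi * (1 + x) / NC by ring.
have -> : (pi - pi * (x + r)) / NC = pi * (1 - x - r) / NC by ring.
have -> : - (pi * (x + r)) / NC = pi * (- x - r) / NC by ring.
move: (S2_neq0 h1) (S2_neq0 h3) (S2_neq0 h4) (S2_neq0 h2) (S2_neq0 h3') (S2_neq0 h4') (S2_neq0 h2') E1 E2 E3 E4.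
move: (S2 x) (S2 (- x)) (S2 (1 + x)) (S2 (1 - x)) (S2 (x + r)) (S2 (- x - r))
  (S2 (1 + x + r)) (S2 (1 - x - r)) => S T U V S' T' U' V'.
move: (sinC (pi * x / NC)) (sinC (pi * (- x - r) / NC)) (sinC (pi * (1 + x) / NC))
  (sinC (pi * (1 - x - r) / NC)) => s1 s2 s3 s4.
move=> T0 S0 V0 U0 S'0 V'0 U'0 E1 E2 E3 E4.
have s40 : s4 != 0 by apply: contraNneq V'0 => s0; rewrite E4 s0 !mulr0.
have s10 : s1 != 0 by apply: contraNneq S0 => s0; rewrite E1 s0 !mulr0.
by split=> //; rewrite E1 E2 E3 E4; field; rewrite V0 S'0 s10 s40.
Qed.
End ScalarFactor.

(** * Sums of cotangents over a finite cyclic group *)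

Section CyclicSums.
Variables (K : fieldType) (Z : finComNzRingType).
Implicit Types (f : Z -> K) (s j x y : Z).

Lemma sum_translate f s : \sum_b f (b + s) = \sum_b f b.
Proof. by rewrite [RHS](reindex_inj (addIr s)). Qed.

Lemma sum_reflect f s : \sum_b f (s - b) = \sum_b f b.
Proof.
by rewrite [RHS](reindex_inj (inv_inj (fun b => subKr s b))).
Qed.

(** Three forms of the addition formula of the cotangent without denominators: for
    cot of the sum, for two pairs of arguments with the same sum, and for two pairs
    with the same difference. *)
Definition cot_add (f g h : Z -> K) : Prop :=
  forall x y, f x * g y - 1 = h (x + y) * (f x + g y).

Definition cot_level (f g : Z -> K) : Prop := forall x y x' y', x + y = x' + y' ->
  (f x * g y - 1) * (f x' + g y') = (f x' * g y' - 1) * (f x + g y).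

Definition cot_level_sub (f g : Z -> K) : Prop := forall x y m,
  (f y * f (y + m) + 1) * (g (x - m) - g x) = (g x * g (x - m) + 1) * (f y - f (y + m)).

(** The addition formulas eliminate the products of two among B, C and E.  What
    remains is affine in them, so that reindexing can treat each of them
    separately. *)
Lemma ybe_termwise (p q p' q' k k' B C E : K) :
  p * q - 1 = k' * (p + q) -> p' * q' - 1 = k * (p' + q') ->
  (p * C - 1) * (p' + E) = (p' * E - 1) * (p + C) ->
  (q * E - 1) * (q' + B) = (q' * B - 1) * (q + E) ->
  (B * C + 1) * (k' - k) = (k * k' + 1) * (B - C) ->
  (p + B) * (k + E) * (q + C) - (q' + C) * (k' + E) * (p' + B) =
  E * ((p - q') * (p' + q)) + B * ((q - k') * (q' + k)) + C * ((p + k') * (k - p'))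
  + (p' - p + q' - q) * (1 - k * k').
Proof.
move=> /eqP; rewrite -subr_eq0 => /eqP D1 /eqP; rewrite -subr_eq0 => /eqP D2.
move=> /eqP; rewrite -subr_eq0 => /eqP D3 /eqP; rewrite -subr_eq0 => /eqP D4.
move=> /eqP; rewrite -subr_eq0 => /eqP D5.
apply/eqP; rewrite -subr_eq0; apply/eqP.
transitivity ((p * C - 1) * (p' + E) - (p' * E - 1) * (p + C) +
  ((q * E - 1) * (q' + B) - (q' * B - 1) * (q + E)) -
  ((B * C + 1) * (k' - k) - (k * k' + 1) * (B - C)) +
  k * (p * q - 1 - k' * (p + q)) - k' * (p' * q' - 1 - k * (p' + q'))); first by ring.
by rewrite D1 D2 D3 D4 D5; ring.
Qed.

(** In the decomposition of ybe_termwise, T4 sums to 0 by translation invariance.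
    Reindexing makes the cotangents of E and C equal to that of B, and the total
    coefficient of the latter vanishes by the addition formula. *)
Lemma ybe_sum (f12 f13 f23 e : Z -> K) (a1 a2 a3 d1 d2 : Z) :
  cot_add f12 f23 f13 -> cot_level f12 e -> cot_level f23 e -> cot_level_sub e f13 ->
  \sum_b (f12 (a2 - b) + e (b - a1)) * (f13 (a3 - d1) + e (d1 - b))
      * (f23 (b + a3 - d1 - d2) + e (b + d2 - a1 - a2)) =
  \sum_c (f23 (a3 - c) + e (c - a2)) * (f13 (a2 + a3 - d1 - d2) + e (d1 + d2 - c - a1))
      * (f12 (c - d1) + e (c - d2)).
Proof.
move=> A12 L12 L23 L13; rewrite -[RHS](sum_translate _ (d2 - a1)).
apply/eqP; rewrite -subr_eq0 -sumrB; apply/eqP.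
pose k := f13 (a3 - d1); pose k' := f13 (a2 + a3 - d1 - d2).
pose B b := e (b - a1); pose C b := e (b + d2 - a1 - a2); pose E b := e (d1 - b).
pose p b := f12 (a2 - b); pose q b := f23 (b + a3 - d1 - d2).
pose p' b := f12 (b + d2 - a1 - d1); pose q' b := f23 (a3 - d2 + a1 - b).
pose T1 b := E b * ((p b - q' b) * (p' b + q b)).
pose T2 b := B b * ((q b - k') * (q' b + k)).
pose T3 b := C b * ((p b + k') * (k - p' b)).
pose T4 b := (p' b - p b + q' b - q b) * (1 - k * k').
transitivity (\sum_b (T1 b + T2 b + T3 b + T4 b)).
  apply: eq_bigr => b _.
  have -> : a3 - (b + (d2 - a1)) = a3 - d2 + a1 - b by ring.
  have -> : b + (d2 - a1) - a2 = b + d2 - a1 - a2 by ring.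
  have -> : d1 + d2 - (b + (d2 - a1)) - a1 = d1 - b by ring.
  have -> : b + (d2 - a1) - d1 = b + d2 - a1 - d1 by ring.
  have -> : b + (d2 - a1) - d2 = b - a1 by ring.
  apply: ybe_termwise.
  - by rewrite A12; congr (f13 _ * _); ring.
  - by rewrite A12; congr (f13 _ * _); ring.
  - by apply: L12; ring.
  - by apply: L23; ring.
  - have := L13 (a3 - d1) (b - a1) (d2 - a2).
    have -> : b - a1 + (d2 - a2) = b + d2 - a1 - a2 by ring.
    by have -> : a3 - d1 - (d2 - a2) = a2 + a3 - d1 - d2 by ring.
rewrite !big_split /= -(sum_reflect T1 (a1 + d1)) -(sum_translate T3 (a2 - d2)).
have -> : \sum_b T4 b = 0.
  rewrite -mulr_suml !sumrB big_split /= sumrB.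
  have -> : \sum_b p' b = \sum_b f12 b.
    by rewrite -(sum_translate f12 (d2 - a1 - d1)); apply: eq_bigr => b _; congr f12; ring.
  have -> : \sum_b p b = \sum_b f12 b by rewrite -(sum_reflect f12 a2).
  have -> : \sum_b q' b = \sum_b f23 b.
    by rewrite -(sum_reflect f23 (a3 - d2 + a1)).
  have -> : \sum_b q b = \sum_b f23 b.
    by rewrite -(sum_translate f23 (a3 - d1 - d2)); apply: eq_bigr => b _; congr f23; ring.
  by ring.
rewrite addr0 -!big_split /= big1// => b _; rewrite /T1 /T2 /T3 /E /C /B /p /q /p' /q'.
have -> : d1 - (a1 + d1 - b) = b - a1 by ring.
have -> : b + (a2 - d2) + d2 - a1 - a2 = b - a1 by ring.
have -> : a2 - (a1 + d1 - b) = b + a2 - a1 - d1 by ring.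
have -> : a3 - d2 + a1 - (a1 + d1 - b) = b + a3 - d1 - d2 by ring.
have -> : a1 + d1 - b + d2 - a1 - d1 = d2 - b by ring.
have -> : a1 + d1 - b + a3 - d1 - d2 = a3 - d2 + a1 - b by ring.
have -> : a2 - (b + (a2 - d2)) = d2 - b by ring.
have -> : b + (a2 - d2) + d2 - a1 - d1 = b + a2 - a1 - d1 by ring.
have := A12 (d2 - b) (b + a3 - d1 - d2); have := A12 (b + a2 - a1 - d1) (a3 - d2 + a1 - b).
have -> : d2 - b + (b + a3 - d1 - d2) = a3 - d1 by ring.
have -> : b + a2 - a1 - d1 + (a3 - d2 + a1 - b) = a2 + a3 - d1 - d2 by ring.
rewrite -/k -/k'; set p1 := f12 _; set q1 := f23 _; set p2 := f12 _; set q2 := f23 _.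
move: (e (b - a1)) => eb.
move=> /eqP; rewrite -subr_eq0 => /eqP D1 /eqP; rewrite -subr_eq0 => /eqP D2.
transitivity (eb * ((p1 * q1 - 1 - k' * (p1 + q1)) - (p2 * q2 - 1 - k * (p2 + q2)))).
  by ring.
by rewrite D1 D2 subrr mulr0.
Qed.

(** For j != 0 the addition formula makes f x * f (x + j) + 1 a difference of two
    translates of one function, of sum 0; the value at j = 0 follows by summing
    over all j. *)
Lemma cot_conv f j : (forall j', j' != 0 -> exists t, forall x,
    f x * f (x + j') + 1 = t * (f x - f (x + j'))) ->
  \sum_x f x * f (x + j) = - #|Z|%:R + (j == 0)%:R * ((\sum_x f x) ^+ 2 + #|Z|%:R ^+ 2).
Proof.
move=> ft.
have conv0 j' : j' != 0 -> \sum_x f x * f (x + j') = - #|Z|%:R.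
  move=> /ft[t tP].
  transitivity (\sum_x (t * (f x - f (x + j')) - 1)).
    by apply: eq_bigr => x _; rewrite -tP addrK.
  rewrite sumrB sumr_const -mulr_sumr sumrB sum_translate subrr mulr0 sub0r.
  by rewrite cardT /= -cardT.
have [->|j0] := eqVneq j 0; last by rewrite conv0// mul0r addr0.
rewrite mul1r.
have : \sum_j' \sum_x f x * f (x + j') = (\sum_x f x) ^+ 2.
  rewrite exchange_big /= expr2 mulr_suml; apply: eq_bigr => x _.
  by rewrite -mulr_sumr; congr (_ * _); rewrite -(sum_translate f x); apply: eq_bigr => y _; rewrite addrC.
rewrite (bigD1 0) //= [X in _ + X](eq_bigr (fun=> - #|Z|%:R)) => [|i /conv0 //].
rewrite sumr_const => <-.
have -> : #|[pred i : Z | i != 0]| = #|Z|.-1 by rewrite -(cardC1 (0 : Z)).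
have Zn : (0 < #|Z|)%N by apply/card_gt0P; exists 0.
rewrite -[in RHS](prednK Zn) -[in X in _ = X + _](prednK Zn) -!natr1.
set n := #|Z|.-1; rewrite -[_ *+ n]mulr_natr; ring.
Qed.
End CyclicSums.

(** * Entries of tensor products *)

Section TensorEntries.
Variables (K : fieldType) (N : nat).
Implicit Types (X Y : 'M[K]_(N * N)) (i j k l a b c d : 'I_N).

Lemma sum_tens m p (F : 'I_(m * p) -> K) :
  \sum_k F k = \sum_i \sum_j F (mxtens_index (i, j)).
Proof.
rewrite pair_big /= (reindex (@mxtens_index m p)) /=.
  by apply: eq_bigr => -[i j] _.
by exists (@mxtens_unindex m p) => u _; rewrite ?mxtens_indexK ?mxtens_unindexK.
Qed.

Lemma sum_delta (I : finType) (F : I -> K) (a : I) : \sum_i F i * (a == i)%:R = F a.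
Proof.
rewrite (bigD1 a) //= eqxx mulr1 big1 ?addr0// => i ia.
by rewrite eq_sym (negbTE ia) mulr0.
Qed.

Lemma delta_mx_entry m p (i a : 'I_m) (j b : 'I_p) :
  delta_mx i j a b = (a == i)%:R * (b == j)%:R :> K.
Proof. by rewrite mxE -natrM mulnb. Qed.

Lemma tensmx_eq m p q s (X Y : 'M[K]_(m * p, q * s)) :
  (forall (i : 'I_m) (k : 'I_p) (j : 'I_q) (l : 'I_s), X (mxtens_index (i, k)) (mxtens_index (j, l)) =
     Y (mxtens_index (i, k)) (mxtens_index (j, l))) -> X = Y.
Proof.
by move=> h; apply/matrixP => u v; case: (mxtens_indexP u) => i k; case: (mxtens_indexP v).
Qed.

Lemma sum4_delta (F : 'I_N -> 'I_N -> 'I_N -> 'I_N -> K) a b c d :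
  \sum_i \sum_j \sum_k \sum_l
    F i j k l * ((a == i)%:R * (b == j)%:R * ((c == k)%:R * (d == l)%:R)) = F a b c d.
Proof.
transitivity (\sum_i \sum_j \sum_k \sum_l
    (((F i j k l * (d == l)%:R) * (c == k)%:R) * (b == j)%:R) * (a == i)%:R).
  by do 4 (apply: eq_bigr => ? _); ring.
rewrite -(sum_delta (fun i => F i b c d) a); apply: eq_bigr => i _.
rewrite -(sum_delta (fun j => F i j c d) b) mulr_suml; apply: eq_bigr => j _.
rewrite -(sum_delta (fun k => F i j k d) c) !mulr_suml; apply: eq_bigr => k _.
by rewrite -(sum_delta (F i j k) d) !mulr_suml.
Qed.

Lemma flip_mxE a b c d : flip_mx K N (mxtens_index (a, b)) (mxtens_index (c, d)) =
  (a == d)%:R * (b == c)%:R.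
Proof.
rewrite /flip_mx summxE -(sum_delta (fun i => (i == d)%:R * (b == c)%:R) a).
apply: eq_bigr => i _; rewrite summxE.
rewrite -(sum_delta (fun j => (i == d)%:R * (b == j)%:R * (a == i)%:R) c).
apply: eq_bigr => j _; rewrite tensmxE !delta_mx_entry [d == i]eq_sym; ring.
Qed.

Lemma tcoefZ (t : K) X a b c d : tcoef (t *: X) a c b d = t * tcoef X a c b d.
Proof. by rewrite /tcoef mxE. Qed.

Lemma leg21E X a b c d : tcoef (leg21 X) a c b d = tcoef X b d a c.
Proof.
rewrite /tcoef /leg21 mxE sum_tens.
rewrite -(sum_delta (fun i => X (mxtens_index (b, a)) (mxtens_index (i, c))) d).
apply: eq_bigr => i _.
rewrite -(sum_delta (fun j => X (mxtens_index (b, a)) (mxtens_index (i, j)) * (d == i)%:R) c).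
apply: eq_bigr => j _; rewrite flip_mxE mxE sum_tens.
have -> : \sum_k \sum_l flip_mx K N (mxtens_index (a, b)) (mxtens_index (k, l)) *
    X (mxtens_index (k, l)) (mxtens_index (i, j)) = X (mxtens_index (b, a)) (mxtens_index (i, j)).
  rewrite -(sum_delta (fun k => X (mxtens_index (k, a)) (mxtens_index (i, j))) b).
  apply: eq_bigr => k _.
  rewrite -(sum_delta (fun l => X (mxtens_index (k, l)) (mxtens_index (i, j)) * (b == k)%:R) a).
  by apply: eq_bigr => l _; rewrite flip_mxE; ring.
by rewrite [d == i]eq_sym [c == j]eq_sym; ring.
Qed.

Lemma trmx2E X a b c d : tcoef (trmx2 X) a c b d = tcoef X a c d b.
Proof.
rewrite {1}/tcoef /trmx2 summxE -(sum4_delta (tcoef X) a c d b).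
apply: eq_bigr => i _; rewrite summxE; apply: eq_bigr => j _; rewrite summxE.
apply: eq_bigr => k _; rewrite summxE; apply: eq_bigr => l _.
by rewrite mxE trmx_delta tensmxE !delta_mx_entry; ring.
Qed.

Lemma trmx2_leg21E X a b c d : tcoef (trmx2 (leg21 X)) a c b d = tcoef X d b a c.
Proof. by rewrite trmx2E leg21E. Qed.

Lemma tcoef_mul X Y a b c d : tcoef (X *m Y) a c b d = \sum_e \sum_f tcoef X a e b f * tcoef Y e c f d.
Proof. by rewrite /tcoef mxE sum_tens. Qed.

Lemma unitarity_entries X Y a b c d : tcoef (X *m leg21 Y) a c b d =
  \sum_e \sum_f tcoef X a e b f * tcoef Y f d e c.
Proof. by rewrite tcoef_mul; apply: eq_bigr => e _; apply: eq_bigr => f _; rewrite leg21E. Qed.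

Lemma crossing_entries X Y a b c d : tcoef (trmx2 X *m trmx2 (leg21 Y)) a c b d =
  \sum_e \sum_f tcoef X a e f b * tcoef Y d f e c.
Proof.
by rewrite tcoef_mul; apply: eq_bigr => e _; apply: eq_bigr => f _; rewrite trmx2E trmx2_leg21E.
Qed.

Lemma tcoef1 a b c d : tcoef (1%:M : 'M[K]_(N * N)) a c b d = (a == c)%:R * (b == d)%:R.
Proof.
rewrite /tcoef mxE (inj_eq (can_inj (@mxtens_indexK N N))) -pair_eqE /= -natrM mulnb.
by [].
Qed.

Local Notation idx3 a b c := (mxtens_index (a, mxtens_index (b, c))).

Lemma leg12E X a b c d e f : leg12_3 X (idx3 a b c) (idx3 d e f) = tcoef X a d b e * (c == f)%:R.
Proof.
rewrite /leg12_3 summxE -(sum4_delta (tcoef X) a d b e) mulr_suml.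
apply: eq_bigr => i _; rewrite summxE mulr_suml; apply: eq_bigr => j _; rewrite summxE mulr_suml.
apply: eq_bigr => k _; rewrite summxE mulr_suml; apply: eq_bigr => l _.
by rewrite mxE !tensmxE !delta_mx_entry mxE; ring.
Qed.

Lemma leg13E X a b c d e f : leg13_3 X (idx3 a b c) (idx3 d e f) = tcoef X a d c f * (b == e)%:R.
Proof.
rewrite /leg13_3 summxE -(sum4_delta (tcoef X) a d c f) mulr_suml.
apply: eq_bigr => i _; rewrite summxE mulr_suml; apply: eq_bigr => j _; rewrite summxE mulr_suml.
apply: eq_bigr => k _; rewrite summxE mulr_suml; apply: eq_bigr => l _.
by rewrite mxE !tensmxE !delta_mx_entry mxE; ring.
Qed.

Lemma leg23E X a b c d e f : leg23_3 X (idx3 a b c) (idx3 d e f) = tcoef X b e c f * (a == d)%:R.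
Proof.
rewrite /leg23_3 summxE -(sum4_delta (tcoef X) b e c f) mulr_suml.
apply: eq_bigr => i _; rewrite summxE mulr_suml; apply: eq_bigr => j _; rewrite summxE mulr_suml.
apply: eq_bigr => k _; rewrite summxE mulr_suml; apply: eq_bigr => l _.
by rewrite mxE !tensmxE !delta_mx_entry mxE; ring.
Qed.

Lemma leg12_mulE X (Y : 'M[K]_(N * (N * N))) a b c v :
  (leg12_3 X *m Y) (idx3 a b c) v = \sum_i \sum_j tcoef X a i b j * Y (idx3 i j c) v.
Proof.
rewrite mxE sum_tens; apply: eq_bigr => i _; rewrite sum_tens; apply: eq_bigr => j _.
rewrite -(sum_delta (fun k => tcoef X a i b j * Y (idx3 i j k) v) c).
by apply: eq_bigr => k _; rewrite leg12E; ring.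
Qed.

Lemma leg13_mulE X (Y : 'M[K]_(N * (N * N))) a b c v :
  (leg13_3 X *m Y) (idx3 a b c) v = \sum_i \sum_k tcoef X a i c k * Y (idx3 i b k) v.
Proof.
rewrite mxE sum_tens; apply: eq_bigr => i _; rewrite sum_tens exchange_big; apply: eq_bigr => k _.
rewrite -(sum_delta (fun j => tcoef X a i c k * Y (idx3 i j k) v) b).
by apply: eq_bigr => j _; rewrite leg13E; ring.
Qed.

Lemma leg23_mulE X (Y : 'M[K]_(N * (N * N))) a b c v :
  (leg23_3 X *m Y) (idx3 a b c) v = \sum_j \sum_k tcoef X b j c k * Y (idx3 a j k) v.
Proof.
rewrite mxE sum_tens -(sum_delta (fun i => \sum_j \sum_k tcoef X b j c k * Y (idx3 i j k) v) a).
apply: eq_bigr => i _; rewrite sum_tens mulr_suml; apply: eq_bigr => j _.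
by rewrite mulr_suml; apply: eq_bigr => k _; rewrite leg23E; ring.
Qed.

Lemma ybe_entries X Y W :
  (forall a b c d e f : 'I_N,
    \sum_i \sum_j tcoef X a i b j * (\sum_k tcoef Y i d c k * tcoef W j e k f) =
    \sum_i \sum_j tcoef W b i c j * (\sum_k tcoef Y a k j f * tcoef X k d i e)) ->
  leg12_3 X *m leg13_3 Y *m leg23_3 W = leg23_3 W *m leg13_3 Y *m leg12_3 X.
Proof.
move=> h; rewrite -!mulmxA; apply: tensmx_eq => a u d v.
case: (mxtens_indexP u) => b c; case: (mxtens_indexP v) => e f.
rewrite leg12_mulE leg23_mulE; transitivity (\sum_i \sum_j tcoef X a i b j *
    (\sum_k tcoef Y i d c k * tcoef W j e k f)); last rewrite h.
- apply: eq_bigr => i _; apply: eq_bigr => j _; congr (_ * _).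
  rewrite leg13_mulE exchange_big; apply: eq_bigr => k _.
  rewrite -(sum_delta (fun x => tcoef Y i x c k * tcoef W j e k f) d).
  by apply: eq_bigr => m _; rewrite leg23E [m == d]eq_sym mulrA.
- apply: eq_bigr => i _; apply: eq_bigr => j _; congr (_ * _).
  rewrite leg13_mulE; apply: eq_bigr => k _.
  rewrite -(sum_delta (fun x => tcoef Y a k j x * tcoef X k d i e) f).
  by apply: eq_bigr => m _; rewrite leg12E [m == f]eq_sym mulrA.
Qed.

Lemma tcoef_inj X Y : (forall a b c d, tcoef X a c b d = tcoef Y a c b d) -> X = Y.
Proof. by move=> h; apply: tensmx_eq => a b c d; exact: h. Qed.

End TensorEntries.

Section RMatrixEntries.
Variables (R : realType) (N : nat) (r : R[i]) (G : R[i] -> R[i]) (beta : R[i]).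

Lemma Rmx_entry (a b c d : 'I_N) : tcoef (Rmx N r G beta) a c b d =
  Rcoef r G beta a b c * (c + d == a + b %[mod N])%N%:R.
Proof.
rewrite /tcoef /Rmx summxE -[RHS](sum_delta (fun a : 'I_N => Rcoef r G beta a b c * (c + d == a + b %[mod N])%N%:R)).
apply: eq_bigr => a' _; rewrite summxE.
rewrite -(sum_delta (fun b : 'I_N => Rcoef r G beta a' b c * (c + d == a' + b %[mod N])%N%:R) b) mulr_suml.
apply: eq_bigr => b' _; rewrite summxE.
rewrite -(sum_delta (fun c : 'I_N => Rcoef r G beta a' b' c * (c + d == a' + b' %[mod N])%N%:R) c) !mulr_suml.
apply: eq_bigr => c' _; rewrite summxE big_mkcond /=.
rewrite -(sum_delta (fun d : 'I_N => Rcoef r G beta a' b' c' * (c' + d == a' + b' %[mod N])%N%:R) d) !mulr_suml.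
apply: eq_bigr => d' _; case: ifP => _; last by rewrite mulr0n !(mulr0, mul0r).
rewrite mulr1n mulr1 mxE tensmxE !delta_mx_entry; move: (Rcoef _ _ _ _ _ _) => x; ring.
Qed.
End RMatrixEntries.

(** * Identities between vertex weights *)

Section VertexWeights.
Variables (K : fieldType) (Z : finComNzRingType).
Implicit Types (f e : Z -> K) (a b c d : Z).

(** An entry of the R-matrix up to a scalar, where a and c are indices of the first
    factor, b and d indices of the second one, and a + b = c + d is conserved. *)
Definition weight f e a b c d : K := (f (b - c) + e (c - a)) * (a + b - c == d)%:R.

Lemma sum_weight f e a b c (F : Z -> K) :
  \sum_d weight f e a b c d * F d = (f (b - c) + e (c - a)) * F (a + b - c).
Proof.
rewrite -(sum_delta (fun d => (f (b - c) + e (c - a)) * F d) (a + b - c)).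
by apply: eq_bigr => d _; rewrite /weight; ring.
Qed.

Lemma weight_level f e a b c d : weight f e a b c d = (f (b - c) + e (c - a)) * (c + d - b == a)%:R.
Proof.
rewrite /weight; congr (_ * _%:R); apply: congr1.
by rewrite !subr_eq [LHS]eq_sym; congr eq_op; ring.
Qed.

Lemma weight_ybe (f12 f13 f23 e : Z -> K) (a1 a2 a3 d1 d2 d3 : Z) :
  cot_add f12 f23 f13 -> cot_level f12 e -> cot_level f23 e -> cot_level_sub e f13 ->
  \sum_b \sum_c weight f12 e a1 a2 b c * (\sum_d weight f13 e b a3 d1 d * weight f23 e c d d2 d3) =
  \sum_b \sum_c weight f23 e a2 a3 b c * (\sum_d weight f13 e a1 c d d3 * weight f12 e d b d1 d2).
Proof.
move=> A12 L12 L23 L13.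
transitivity ((a1 + a2 + a3 - d1 - d2 == d3)%:R * \sum_b (f12 (a2 - b) + e (b - a1)) * (f13 (a3 - d1) + e (d1 - b))
      * (f23 (b + a3 - d1 - d2) + e (b + d2 - a1 - a2))).
  rewrite mulr_sumr; apply: eq_bigr => b _.
  rewrite sum_weight sum_weight /weight.
  have -> : a1 + a2 - b + (b + a3 - d1) - d2 = a1 + a2 + a3 - d1 - d2 by ring.
  have -> : d2 - (a1 + a2 - b) = b + d2 - a1 - a2 by ring.
  by ring.
rewrite (ybe_sum _ _ _ _ _ A12 L12 L23 L13) mulr_sumr; apply: eq_bigr => b _.
rewrite sum_weight; under eq_bigr => d _ do rewrite (weight_level f12) mulrA.
rewrite (sum_delta (fun d => weight f13 e a1 (a2 + a3 - b) d d3 * (f12 (b - d1) + e (d1 - d))) (d1 + d2 - b)).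
rewrite /weight.
have -> : a1 + (a2 + a3 - b) - (d1 + d2 - b) = a1 + a2 + a3 - d1 - d2 by ring.
have -> : a2 + a3 - b - (d1 + d2 - b) = a2 + a3 - d1 - d2 by ring.
have -> : d1 - (d1 + d2 - b) = b - d2 by ring.
by ring.
Qed.

Definition cot_orth f (L : K) : Prop :=
  forall x, \sum_y f y * f (y + x) = - #|Z|%:R + (x == 0)%:R * L.

(** The sum consists of two convolutions, whose constant parts cancel, and of two
    mixed sums that are exchanged by a translation of the index. *)
Lemma weight_unitarity f e L M a b c d : cot_orth f L -> cot_orth e M ->
  \sum_a' \sum_b' weight f e a b a' b' * weight (fun x => - f (- x)) e b' a' d c =
  (M - L) * ((a == c)%:R * (b == d)%:R).
Proof.
move=> fL eM; transitivity (\sum_x (f (b - x) + e (x - a)) * (- f (d - x) + e (x + d - a - b))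
    * (a + b - d == c)%:R).
  apply: eq_bigr => x _; rewrite sum_weight /weight opprB.
  have -> : a + b - x + x - d = a + b - d by ring.
  have -> : d - (a + b - x) = x + d - a - b by ring.
  by ring.
have [E|E] := eqVneq (a + b - d) c; last first.
  rewrite big1 => [|x _]; last by rewrite mulr0.
  have [ac|] := eqVneq a c; last by rewrite mul0r mulr0.
  have [bd|] := eqVneq b d; last by rewrite !mulr0.
  by rewrite ac bd addrK eqxx in E.
have -> : d = b + (a - c) by rewrite -E; ring.
have -> : (a == c)%:R * (b == b + (a - c))%:R = (a - c == 0)%:R :> K.
  by rewrite -[X in X == b + _]addr0 (inj_eq (addrI b)) [0 == _]eq_sym subr_eq0 -natrM mulnb andbb.
have := fL (a - c); have := eM (a - c).
rewrite -(sum_translate _ (- a)) -(sum_reflect (fun y => f y * _) b) => h1 h2.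
transitivity (\sum_x e (x - a) * e (x - a + (a - c)) - \sum_x f (b - x) * f (b - x + (a - c))
   + (\sum_x f (b - x) * e (x - c) - \sum_x e (x - a) * f (b - x + (a - c)))).
  rewrite -!sumrB -big_split /=; apply: eq_bigr => x _.
  have -> : b + (a - c) - x = b - x + (a - c) by ring.
  have -> : x + (b + (a - c)) - a - b = x - c by ring.
  have -> : x - a + (a - c) = x - c by ring.
  by ring.
rewrite h1 h2 -(sum_translate (fun x => e (x - a) * _) (a - c)).
have -> : \sum_x e (x + (a - c) - a) * f (b - (x + (a - c)) + (a - c)) = \sum_x f (b - x) * e (x - c).
  apply: eq_bigr => x _; rewrite mulrC; congr (f _ * e _); ring.
by ring.
Qed.

(** Here f and g are evaluated at b - a only, so the sum is a quadratic polynomial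
    in them with coefficients the sum and the convolution of e; the hypothesis on
    f and g, an addition formula, cancels the constants. *)
Lemma weight_crossing f g e s M a b c d : cot_orth e M ->
  \sum_x e x = #|Z|%:R * s -> (forall x, f x * g x + 1 = s * (f x - g x)) ->
  \sum_a' \sum_b' weight f e a b' a' b * weight (fun x => - g (- x)) e d a' b' c =
  M * ((a == c)%:R * (b == d)%:R).
Proof.
move=> eM es fg.
transitivity (\sum_x (f (b - a) + e (x - a)) * (- g (b - a) + e (x - a + (b - d)))
    * (d + a - b == c)%:R).
  apply: eq_bigr => x _.
  transitivity (\sum_b' (f (b' - x) + e (x - a)) * weight (fun x => - g (- x)) e d x b' c * (b + x - a == b')%:R).
    apply: eq_bigr => b' _; rewrite {1}/weight.
    have -> : (a + b' - x == b) = (b + x - a == b').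
      by rewrite !subr_eq [LHS]eq_sym; congr eq_op; ring.
    by ring.
  rewrite (sum_delta (fun b' => _ * weight _ e d x b' c)) /weight opprB.
  have -> : b + x - a - x = b - a by ring.
  have -> : b + x - a - d = x - a + (b - d) by ring.
  have -> : d + x - (b + x - a) = d + a - b by ring.
  by ring.
rewrite -mulr_suml.
transitivity ((#|Z|%:R * (- (f (b - a) * g (b - a)) + s * (f (b - a) - g (b - a)))
   + \sum_x e x * e (x + (b - d))) * (d + a - b == c)%:R).
  congr (_ * _); rewrite -[X in _ = _ + X](sum_translate _ (- a)).
  have -> : #|Z|%:R * (- (f (b - a) * g (b - a)) + s * (f (b - a) - g (b - a))) =
    \sum_(x : Z) (- (f (b - a) * g (b - a))) + f (b - a) * (\sum_x e (x - a + (b - d))) - g (b - a) * \sum_x e (x - a).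
    have -> : \sum_x e (x - a + (b - d)) = \sum_x e x.
      by rewrite -(sum_translate e (b - d - a)); apply: eq_bigr => x _; congr e; ring.
    by rewrite sum_translate es sumr_const -mulr_natl; ring.
  rewrite !mulr_sumr -sumrN -!big_split /=; apply: eq_bigr => x _; ring.
rewrite eM -fg.
have [bd|bd] := eqVneq b d.
  have -> : d + a - b = a by rewrite bd; ring.
  by rewrite bd subrr eqxx; ring.
by rewrite subr_eq0 (negbTE bd) !mulr0n; ring.
Qed.
End VertexWeights.

(** * The cotangent on the residues modulo N *)

Section Cotangent.
Variable R : realType.
Local Notation C := R[i].
Local Notation pi := (piC R).
Implicit Types (u v x y z : C).

Definition cot z : C := cosC z / sinC z.

Lemma cotDpi z (k : nat) : cot (z + k%:R * pi) = cot z.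
Proof.
elim: k => [|k IH]; first by rewrite mul0r addr0.
by rewrite -natr1 mulrDl mul1r addrA /cot sinCDpi cosCDpi invrN mulrNN.
Qed.

Lemma cotN z : cot (- z) = - cot z.
Proof. by rewrite /cot cosCN sinCN invrN mulrN. Qed.

Lemma cotD_eq x y : sinC x != 0 -> sinC y != 0 -> sinC (x + y) != 0 ->
  cot x * cot y - 1 = cot (x + y) * (cot x + cot y).
Proof.
move=> hx hy; rewrite /cot sinCD cosCD => hxy; field.
by rewrite hx hy hxy.
Qed.

Lemma cot_sum x y : sinC x != 0 -> sinC y != 0 ->
  cot x + cot y = sinC (x + y) / (sinC x * sinC y).
Proof. by move=> hx hy; rewrite /cot sinCD; field; rewrite hx hy. Qed.

Lemma cot_prod x y : sinC x != 0 -> sinC y != 0 ->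
  cot x * cot y - 1 = cosC (x + y) / (sinC x * sinC y).
Proof. by move=> hx hy; rewrite /cot cosCD; field; rewrite hx hy. Qed.

Lemma sinCDpi_eq0 z (k : nat) : (sinC (z + k%:R * pi) == 0) = (sinC z == 0).
Proof.
elim: k => [|k IH]; first by rewrite mul0r addr0.
by rewrite -natr1 mulrDl mul1r addrA sinCDpi oppr_eq0.
Qed.

Lemma sin_piM (k : nat) : sinC (k%:R * pi) = 0.
Proof. by apply/eqP; rewrite -[_ * pi]add0r sinCDpi_eq0 sinC0. Qed.

(** (cot x * cot y - 1) / (cot x + cot y) is cot (x + y), which only depends on
    x + y modulo pi. *)
Lemma cot_level_eq x y x' y' : sinC x != 0 -> sinC y != 0 -> sinC x' != 0 -> sinC y' != 0 ->
  sinC (x + y - (x' + y')) = 0 ->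
  (cot x * cot y - 1) * (cot x' + cot y') = (cot x' * cot y' - 1) * (cot x + cot y).
Proof.
move=> hx hy hx' hy'; rewrite !cot_sum// !cot_prod// sinCD sinCN cosCN mulrN => h.
have E : cosC (x + y) * sinC (x' + y') = cosC (x' + y') * sinC (x + y).
  by apply/eqP; rewrite eq_sym -subr_eq0 mulrC h.
move: E hx hy hx' hy'; move: (cosC (x + y)) (sinC (x' + y')) (cosC (x' + y')) (sinC (x + y)) => A B A' B'.
move: (sinC x) (sinC y) (sinC x') (sinC y') => a b c d E a0 b0 c0 d0.
transitivity (A * B / (a * b * (c * d))); first by field; rewrite a0 b0 c0 d0.
by rewrite E; field; rewrite a0 b0 c0 d0.
Qed.

Lemma sinC_eq0_expC z : (sinC z == 0) = (expC ('i * z) ^+ 2 == 1).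
Proof.
have e0 := expC_neq0 ('i * z); rewrite /sinC expCN; move: (expC _) e0 => e e0.
have -> : e - e^-1 = (e ^+ 2 - 1) / e by field.
rewrite !mulf_eq0 !invr_eq0 mulf_eq0 (negbTE (i_neq0 R)) (negbTE e0) pnatr_eq0 !orbF.
by rewrite subr_eq0.
Qed.

Lemma cot_expC z : sinC z != 0 -> cot z = 'i + 2 * 'i / (expC ('i * z) ^+ 2 - 1).
Proof.
move=> hz; have := hz; rewrite sinC_eq0_expC => h1.
have e0 := expC_neq0 ('i * z).
rewrite /cot /cosC /sinC expCN; move: (expC _) e0 h1 => e e0 h1.
by field; rewrite subr_eq0 h1 e0 andbT; exact: i_neq0.
Qed.
End Cotangent.

Section CyclicCotangent.
Variables (R : realType) (n : nat).
Local Notation C := R[i].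
Local Notation N := n.+2.
Local Notation Z := 'I_n.+2.
Local Notation pi := (piC R).
Implicit Types (u v : C) (x y : Z).

Definition eps : C := pi / N%:R.

Lemma NC_neq0 : (N%:R : C) != 0. Proof. by rewrite pnatr_eq0. Qed.

Lemma N_eps : N%:R * eps = pi. Proof. by rewrite /eps mulrC divfK ?NC_neq0. Qed.

Definition ct u x : C := cot (u + x%:R * eps).

Lemma val_add x y : exists k : nat, (((x + y)%R : Z)%:R : C) = x%:R + y%:R - k%:R * N%:R.
Proof.
exists ((x + y) %/ N)%N.
have := congr1 (fun m => m%:R : C) (divn_eq (x + y) N).
by rewrite /= !natrD natrM => ->; rewrite addrAC subrr add0r.
Qed.

Lemma val_sub x y : exists k : nat, (((x - y)%R : Z)%:R : C) = x%:R - y%:R + k%:R * N%:R.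
Proof.
have [k] := val_add (x - y) y; rewrite subrK => E.
by exists k; rewrite E; ring.
Qed.

Lemma ctB u x y : ct u (x - y) = cot (u + (x%:R - y%:R) * eps).
Proof.
have [k E] := val_sub x y.
by rewrite -(cotDpi _ k) /ct E -N_eps; congr cot; ring.
Qed.

(** All the points u + k * pi / N, for k an integer, avoid the poles. *)
Definition sin_regular u : Prop := forall x y, sinC (u + (x%:R - y%:R) * eps) != 0.

Lemma sin_regular_nz u x : sin_regular u -> sinC (u + x%:R * eps) != 0.
Proof. by move=> /(_ x 0); rewrite /= subr0. Qed.

Lemma ct_add u v : sin_regular u -> sin_regular v -> sin_regular (u + v) ->
  cot_add (ct u) (ct v) (ct (u + v)).
Proof.
move=> hu hv huv x y; have E : ct (u + v) (x + y) = cot (u + x%:R * eps + (v + y%:R * eps)).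
  have [k E] := val_add x y.
  by rewrite /ct -[LHS](cotDpi _ k) E -N_eps; congr cot; ring.
have huv' : sinC (u + x%:R * eps + (v + y%:R * eps)) != 0.
  have h := huv x (- y); have [k E'] := val_sub 0 y.
  have -> : u + x%:R * eps + (v + y%:R * eps) = u + v + (x%:R - ((- y)%R : Z)%:R) * eps + k%:R * pi.
    by rewrite -[(- y : Z)]sub0r E' /= -N_eps; ring.
  by rewrite sinCDpi_eq0.
by rewrite E; apply: cotD_eq => //; exact: sin_regular_nz.
Qed.

Lemma ct_level u v : sin_regular u -> sin_regular v -> cot_level (ct u) (ct v).
Proof.
move=> hu hv x y x' y' E.
have [k Ek] := val_add x y; have [k' Ek'] := val_add x' y'.
apply: cot_level_eq; try exact: sin_regular_nz.
have -> : u + x%:R * eps + (v + y%:R * eps) - (u + x'%:R * eps + (v + y'%:R * eps)) =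
    k%:R * pi - k'%:R * pi.
  have e1 : (x%:R + y%:R : C) = ((x + y)%R : Z)%:R + k%:R * N%:R by rewrite Ek subrK.
  have e2 : (x'%:R + y'%:R : C) = ((x + y)%R : Z)%:R + k'%:R * N%:R by rewrite E Ek' subrK.
  transitivity ((x%:R + y%:R - (x'%:R + y'%:R)) * eps); first by ring.
  by rewrite e1 e2 -N_eps; ring.
by rewrite sinCD sinCN !sin_piM oppr0 mulr0 mul0r addr0.
Qed.

Lemma ct_level_sub u v : sin_regular u -> sin_regular v -> cot_level_sub (ct u) (ct v).
Proof.
move=> hu hv x y m.
have [k Ek] := val_add y m; have [k' Ek'] := val_sub x m.
pose a := u + y%:R * eps; pose b := - (u + ((y + m)%R : Z)%:R * eps).
pose c := v + ((x - m)%R : Z)%:R * eps; pose d := - (v + x%:R * eps).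
have h : (cot a * cot b - 1) * (cot c + cot d) = (cot c * cot d - 1) * (cot a + cot b).
  apply: cot_level_eq; rewrite /a /b /c /d ?sinCN ?oppr_eq0; try exact: sin_regular_nz.
  rewrite Ek Ek' (_ : _ - _ = k%:R * pi - k'%:R * pi); last by rewrite -N_eps; ring.
  by rewrite sinCD sinCN !sin_piM oppr0 mulr0 mul0r addr0.
move: h; rewrite /b /d !cotN -/(ct u y) -/(ct u (y + m)) -/(ct v (x - m)) -/(ct v x).
move: (ct u y) (ct u (y + m)) (ct v (x - m)) (ct v x) => A B A' B' h.
have -> : (A * B + 1) * (A' - B') = - ((A * - B - 1) * (A' - B')) by ring.
by rewrite h; ring.
Qed.

(** cot a * cot b + 1 = cot (b - a) * (cot a - cot b), where b - a is fixed. *)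
Lemma ct_translate u x' : sin_regular u -> x' != 0 -> exists t, forall x,
  ct u x * ct u (x + x') + 1 = t * (ct u x - ct u (x + x')).
Proof.
move=> hu x0; exists (cot (x'%:R * eps)) => x.
have [k Ek] := val_add x x'.
have hx : sinC (u + x%:R * eps) != 0 by exact: sin_regular_nz.
have hx' : sinC (u + ((x + x')%R : Z)%:R * eps) != 0 by exact: sin_regular_nz.
have hs : sinC (x'%:R * eps) != 0.
  rewrite /eps /piC -[(x'%:R : C)](rmorph_nat (real_complex R)) -[(N%:R : C)](rmorph_nat (real_complex R)).
  rewrite -fmorphV -!rmorphM sinC_real; apply/eqP => /(congr1 (@complex.Re R))/=/eqP.
  rewrite gt_eqF// sin_gt0_pi// mulr_gt0 ?divr_gt0 ?pi_gt0 ?ltr0n ?lt0n//=.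
  by rewrite mulrCA gtr_pMr ?pi_gt0// ltr_pdivrMr ?ltr0n// mul1r ltr_nat.
have xx : - (u + x%:R * eps) + (u + ((x + x')%R : Z)%:R * eps) + k%:R * pi = x'%:R * eps.
  by rewrite Ek -N_eps; ring.
have hs' : sinC (- (u + x%:R * eps) + (u + ((x + x')%R : Z)%:R * eps)) != 0.
  by rewrite -(sinCDpi_eq0 _ k) xx.
have := cotD_eq (x := - (u + x%:R * eps)) _ hx' hs'.
rewrite sinCN oppr_eq0 => /(_ hx); rewrite -(cotDpi (- _ + _) k) xx cotN -/(ct u x) -/(ct u (x + x')).
move: (ct u x) (ct u (x + x')) => A B; rewrite mulNr => h.
have -> : A * B + 1 = - (- (A * B) - 1) by ring.
by rewrite h; ring.
Qed.

Lemma expC_step u (k : nat) :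
  expC ('i * (u + k%:R * eps)) ^+ 2 = expC ('i * u) ^+ 2 * omega R N ^+ k.
Proof.
rewrite -!expC_nat -expCD; congr expC; rewrite /eps.
by move: NC_neq0; move: (N%:R : C) => v v0; field.
Qed.

(** If sin (N u) = 0, then exp (2 i u) is an N-th root of unity omega^j, and
    u + (N - j) pi / N is a zero of the sine. *)
Lemma sinN_neq0 u : sin_regular u -> sinC (N%:R * u) != 0.
Proof.
move=> hu; rewrite sinC_eq0_expC mulrCA expC_nat exprAC; apply/negP => /eqP zN.
have [i zi] := prim_rootP (omega_prim R (isT : (0 < N)%N)) zN.
have := sin_regular_nz (inZp (N - i) : Z) hu; rewrite sinC_eq0_expC expC_step /=.
rewrite (prim_expr_mod (omega_prim R (isT : (0 < N)%N))) zi -exprD subnKC ?(ltnW (ltn_ord i))//.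
by rewrite omega_expn// eqxx.
Qed.

(** With z = exp (2 i u), cot u is i + 2 i / (z - 1), and the sum of the
    1 / (z omega^x - 1) is N / (z^N - 1), as the expansion of
    (z^N - 1) / (z omega^x - 1) shows. *)
Lemma sum_ct u : sin_regular u -> \sum_x ct u x = N%:R * cot (N%:R * u).
Proof.
move=> hu; have hN := sinN_neq0 hu.
rewrite (cot_expC hN) mulrCA [expC (_ * _)]expC_nat.
have zN : expC ('i * u) ^+ N ^+ 2 - 1 != 0.
  by have := hN; rewrite sinC_eq0_expC mulrCA expC_nat subr_eq0.
rewrite exprAC in zN *; set z := expC ('i * u) ^+ 2 in zN *.
have wN (k : nat) : (omega R N ^+ k) ^+ N = 1.
  by rewrite exprAC omega_expn// expr1n.
have yE (x : Z) : (z * omega R N ^+ x - 1)^-1 = (\sum_(j < N) (z * omega R N ^+ x) ^+ j) / (z ^+ N - 1).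
  have y0 : z * omega R N ^+ x - 1 != 0.
    by rewrite subr_eq0 -expC_step -sinC_eq0_expC sin_regular_nz.
  by apply: (mulfI y0); rewrite divff// mulrA -subrX1 exprMn wN mulr1 divff.
under eq_bigr => x _ do rewrite /ct (cot_expC (sin_regular_nz x hu)) expC_step -/z yE.
rewrite big_split /= sumr_const card_ord -mulr_sumr -mulr_suml exchange_big /=.
have -> : \sum_(j < N) \sum_(i < N) (z * omega R N ^+ i) ^+ j = N%:R.
  rewrite (bigD1 ord0)//= [X in _ + X]big1 ?addr0 => [|j j0].
    by under eq_bigr do rewrite expr0; rewrite sumr_const card_ord.
  under eq_bigr => i _ do rewrite exprMn [(omega R N ^+ _) ^+ _]exprAC.
  rewrite -mulr_sumr sum_unity_root ?mulr0//.
  by rewrite omega_neq1// ltn_ord andbT lt0n.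
by rewrite -mulr_natl; ring.
Qed.

(** cot_conv gives the value N^2 cot^2 (N u) + N^2 at x = 0. *)
Lemma ct_conv u x : sin_regular u -> \sum_y ct u y * ct u (y + x) =
  - N%:R + (x == 0)%:R * (N%:R ^+ 2 / sinC (N%:R * u) ^+ 2).
Proof.
move=> hu; rewrite (cot_conv _ (fun x' => ct_translate (x' := x') hu)) card_ord sum_ct//.
congr (_ + _ * _); have hN := sinN_neq0 hu.
rewrite exprMn -[X in _ + X]mulr1 -mulrDr; congr (_ * _).
rewrite /cot expr_div_n; move: (cos2Dsin2C (N%:R * u)) hN.
move: (cosC _) (sinC _) => c s h s0.
rewrite [RHS](_ : _ = (c ^+ 2 + s ^+ 2) / s ^+ 2); last by rewrite h mul1r.
by field.
Qed.
End CyclicCotangent.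

(** * The identities of the R-matrix *)

Section RMatrixIdentities.
Variables (R : realType) (n : nat) (r : R[i]) (G : R[i] -> R[i]).
Hypothesis r0 : 0 < Re r.
Local Notation C := R[i].
Local Notation N := n.+2.
Local Notation NC := (N%:R : C).
Local Notation Z := 'I_n.+2.
Local Notation pi := (piC R).
Local Notation reg := (Rmx_regular N r).
Local Notation S0 := (S0 N r G).
Implicit Types (b : C).

Let rn : r != 0. Proof. exact: Re_neq0 r0. Qed.
Let Nn : NC != 0. Proof. exact: NC_neq0. Qed.

Ltac field_N := move: (Nn) (rn); move: (NC) (pi) => ? ? ? ?; field; do ?[apply/andP; split]; by [].

(** The spectral parameter and the anisotropy in the scale where a unit of the
    index is eps = pi / N. *)
Definition angle b : C := 'i * b / (NC * r).
Definition anisotropy : C := pi / (NC * r).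
Local Notation eta := anisotropy.
Local Notation W b := (weight (ct (angle b)) (ct eta)).

Definition kappa b : C :=
  - (1 / NC) * S0 b * (sinC ('i * b / r) * sinC (pi / r) / sinC (('i * b + pi) / r)).

Lemma N_angle b : NC * angle b = 'i * b / r.
Proof. by rewrite /angle; field_N. Qed.

Lemma N_eta : NC * eta = pi / r.
Proof. by rewrite /anisotropy; field_N. Qed.

Lemma regular_angle b : reg b -> sin_regular n (angle b).
Proof.
move=> [_ h _ _] x y; have := h x y; congr (sinC _ != 0); rewrite /angle /eps.
by field_N.
Qed.

Lemma regular_eta b : reg b -> sin_regular n eta.
Proof.
move=> [_ _ h _] x y; have := h y x; congr (sinC _ != 0); rewrite /anisotropy /eps.
by field_N.
Qed.

(** cot s + cot t = sin (s + t) / (sin s * sin t), where the index z cancels in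
    s + t. *)
Lemma Rcoef_cot b (x y z : Z) : reg b ->
  Rcoef r G b x y z = kappa b * (ct (angle b) (y - z) + ct eta (z - x)).
Proof.
move=> hb; have h1 := regular_angle hb y z; have h2 := regular_eta hb z x.
rewrite !ctB cot_sum// /Rcoef /kappa.
have -> : ('i * b + pi + (y%:R - x%:R) * pi * r) / (NC * r) =
   angle b + (y%:R - z%:R) * eps R n + (eta + (z%:R - x%:R) * eps R n).
  by rewrite /angle /anisotropy /eps; field_N.
have -> : ('i * b + (y%:R - z%:R) * pi * r) / (NC * r) = angle b + (y%:R - z%:R) * eps R n.
  by rewrite /angle /eps; field_N.
have -> : (pi - (x%:R - z%:R) * pi * r) / (NC * r) = eta + (z%:R - x%:R) * eps R n.
  by rewrite /anisotropy /eps; field_N.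
by ring.
Qed.

Lemma Rmx_weight b (x y z t : Z) : reg b ->
  tcoef (Rmx N r G b) x z y t = kappa b * W b x y z t.
Proof.
move=> hb; rewrite Rmx_entry Rcoef_cot// /weight -mulrA; congr (_ * (_ * _%:R)).
by rewrite subr_eq [t + z]addrC eq_sym.
Qed.

Lemma cot_orth_ct u : sin_regular n u ->
  cot_orth (ct u : Z -> C) (NC ^+ 2 / sinC (NC * u) ^+ 2).
Proof. by move=> hu x; rewrite ct_conv// card_ord. Qed.

Lemma eq_weight (f f' e : Z -> C) x y z t : f =1 f' -> weight f e x y z t = weight f' e x y z t.
Proof. by move=> E; rewrite /weight E. Qed.

Lemma ctN u (x : Z) : ct (- u) x = - ct u (- x) :> C.
Proof.
have := ctB (- u) x 0; have := ctB u 0 x; rewrite subr0 sub0r => -> ->.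
by rewrite -cotN; congr cot; rewrite /=; ring.
Qed.

Lemma Rmx_ybe b1 b2 b3 : reg (b1 - b2) -> reg (b1 - b3) -> reg (b2 - b3) ->
  leg12_3 (Rmx N r G (b1 - b2)) *m leg13_3 (Rmx N r G (b1 - b3))
       *m leg23_3 (Rmx N r G (b2 - b3))
  = leg23_3 (Rmx N r G (b2 - b3)) *m leg13_3 (Rmx N r G (b1 - b3))
       *m leg12_3 (Rmx N r G (b1 - b2)).
Proof.
move=> h12 h13 h23.
have a13 : angle (b1 - b3) = angle (b1 - b2) + angle (b2 - b3).
  by rewrite /angle -mulrDl -mulrDr addrA subrK.
have hv := regular_eta h12; have s12 := regular_angle h12; have s23 := regular_angle h23.
have s13 := regular_angle h13.
apply: ybe_entries => a1 a2 a3 d1 d2 d3.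
set k12 := kappa (b1 - b2); set k13 := kappa (b1 - b3); set k23 := kappa (b2 - b3).
have E := @weight_ybe _ Z (ct (angle (b1 - b2))) (ct (angle (b1 - b3))) (ct (angle (b2 - b3)))
  (ct eta) a1 a2 a3 d1 d2 d3.
transitivity (k12 * k13 * k23 * \sum_b \sum_c W (b1 - b2) a1 a2 b c *
   (\sum_d W (b1 - b3) b a3 d1 d * W (b2 - b3) c d d2 d3)).
  rewrite mulr_sumr; apply: eq_bigr => i _; rewrite mulr_sumr; apply: eq_bigr => j _.
  rewrite Rmx_weight// !mulr_sumr; apply: eq_bigr => d _.
  by rewrite !Rmx_weight// -/k12 -/k13 -/k23; ring.
rewrite E; first last.
- exact: ct_level_sub.
- exact: ct_level.
- exact: ct_level.
- by rewrite a13 in s13 *; apply: ct_add.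
rewrite mulr_sumr; apply: eq_bigr => i _; rewrite mulr_sumr; apply: eq_bigr => j _.
rewrite Rmx_weight// !mulr_sumr; apply: eq_bigr => d _.
by rewrite !Rmx_weight// -/k12 -/k13 -/k23; ring.
Qed.

Lemma sin_sub_mul (x y : C) : sinC (x + y) * sinC (x - y) = sinC x ^+ 2 - sinC y ^+ 2.
Proof.
have := cos2Dsin2C x; have := cos2Dsin2C y; rewrite !sinCD sinCN cosCN.
move: (sinC x) (sinC y) (cosC x) (cosC y) => s t c d h1 h2.
transitivity (s ^+ 2 * (d ^+ 2 + t ^+ 2) - (c ^+ 2 + s ^+ 2) * t ^+ 2); first by ring.
by rewrite h1 h2 mulr1 mul1r.
Qed.

Hypothesis HG : is_double_gamma r NC G.

(** The scalar is N^2 / sin^2 (N eta) - N^2 / sin^2 (N u), whose numerator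
    sin^2 (N u) - sin^2 (N eta) factors as the denominators of kappa. *)
Lemma Rmx_unitarity b : reg b -> reg (- b) ->
  Rmx N r G b *m leg21 (Rmx N r G (- b)) = 1%:M.
Proof.
move=> hb hb'; have hu := regular_angle hb; have hv := regular_eta hb.
have su := sinN_neq0 hu; have sv := sinN_neq0 hv.
have scal : kappa b * kappa (- b) *
    (NC ^+ 2 / sinC (NC * eta) ^+ 2 - NC ^+ 2 / sinC (NC * angle b) ^+ 2) = 1.
  have hS := S0_mulN (isT : (0 < N)%N) r0 HG hb.
  move: hb hb' => [_ _ _ p1] [_ _ _ p2].
  have := sin_sub_mul (NC * eta) (NC * angle b).
  have e1 : ('i * b + pi) / r = NC * eta + NC * angle b.
    by rewrite N_eta N_angle -mulrDl [_ + pi]addrC.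
  have e2 : ('i * - b + pi) / r = NC * eta - NC * angle b.
    by rewrite N_eta N_angle -mulrBl mulrN [_ + pi]addrC.
  have e3 : sinC ('i * - b / r) = - sinC (NC * angle b) by rewrite -sinCN N_angle mulrN mulNr.
  rewrite /kappa e1 e2 e3 -N_angle -N_eta.
  rewrite e1 in p1; rewrite e2 in p2; move: p1 p2 su sv.
  move: (sinC (_ + _)) (sinC (_ - _)) (sinC (NC * eta)) (sinC (NC * angle b)) => p q s t p0 q0 t0 s0 E.
  transitivity (S0 b * S0 (- b) * ((s ^+ 2 - t ^+ 2) / (p * q))).
    by move: (S0 b) (S0 (- b)) (NC) (Nn) => A B v v0; field; rewrite ?p0 ?q0 ?s0 ?t0 ?v0.
  by rewrite hS mul1r -E divff// mulf_neq0.
apply: tcoef_inj => x y z t; rewrite unitarity_entries tcoef1.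
transitivity (kappa b * kappa (- b) * \sum_x' \sum_y' W b x y x' y' *
     weight (fun x => - ct (angle b) (- x)) (ct eta) y' x' t z).
  rewrite mulr_sumr; apply: eq_bigr => i _; rewrite mulr_sumr; apply: eq_bigr => j _.
  rewrite !Rmx_weight// (eq_weight (f := ct (angle (- b))) (f' := fun x => - ct (angle b) (- x))).
    by ring.
  by move=> k; rewrite -ctN /angle mulrN mulNr.
rewrite (weight_unitarity _ _ _ _ (cot_orth_ct hu) (cot_orth_ct hv)).
by rewrite [LHS]mulrA scal mul1r.
Qed.

(** Crossing maps the angle u to - (u + N eta), so the addition formula relates
    cot (N eta) to the two cotangents. *)
Lemma Rmx_crossing b (b' := - b + NC * 'i * pi) : reg b -> reg b' ->
  trmx2 (Rmx N r G b) *m trmx2 (leg21 (Rmx N r G b')) = 1%:M.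
Proof.
move=> hb hb'; have hu := regular_angle hb; have hv := regular_eta hb.
have hu' := regular_angle hb'.
have su := sinN_neq0 hu; have sv := sinN_neq0 hv; have su' := sinN_neq0 hu'.
have ii := @sqr_i R.
have ub : angle b' = - (angle b + NC * eta).
  rewrite /b' N_eta /angle mulrDr (_ : 'i * (NC * 'i * pi) = 'i * 'i * NC * pi); last by ring.
  by rewrite ii; field_N.
have scal : kappa b * kappa b' * (NC ^+ 2 / sinC (NC * eta) ^+ 2) = 1.
  have hS := S0_crossing (isT : (0 < N)%N) r0 HG hb hb'.
  move: hb hb' => [_ _ _ p1] [_ _ _ p2]; rewrite -/b' in hS.
  rewrite N_eta in sv; rewrite N_angle in su; rewrite N_angle in su'.
  rewrite /kappa N_eta; move: p1 p2 su su' sv hS.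
  move: (sinC ((_ + pi) / r)) (sinC (('i * b' + pi) / r)) (sinC (pi / r)) (sinC ('i * b / r))
    (sinC ('i * b' / r)) => p q s t t' p0 q0 t0 t'0 s0 hS.
  transitivity (S0 b * S0 b' * (t * t') / (p * q)).
    by move: (S0 b) (S0 b') (NC) (Nn) => A B v v0; field; rewrite ?p0 ?q0 ?s0 ?t0 ?t'0 ?v0.
  by rewrite hS divff// mulf_neq0.
clearbody b'; apply: tcoef_inj => x y z t; rewrite crossing_entries tcoef1.
transitivity (kappa b * kappa b' * \sum_x' \sum_y' W b x y' x' y *
     weight (fun x => - ct (angle b + NC * eta) (- x)) (ct eta) t x' y' z).
  rewrite mulr_sumr; apply: eq_bigr => i _; rewrite mulr_sumr; apply: eq_bigr => j _.
  rewrite (Rmx_weight _ _ _ _ hb). rewrite (Rmx_weight _ _ _ _ hb'). rewrite (eq_weight (f := ct (angle b')) (f' := fun x => - ct (angle b + NC * eta) (- x))).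
    by ring.
  by move=> k; rewrite -ctN ub.
rewrite (weight_crossing (s := cot (NC * eta)) _ _ _ _ (cot_orth_ct hv)).
- by rewrite [LHS]mulrA scal mul1r.
- by rewrite sum_ct// card_ord.
move=> k; rewrite /ct.
have k1 := sin_regular_nz k hu.
have k2 : sinC (angle b + NC * eta + k%:R * eps R n) != 0.
  have := hu' 0 k; rewrite ub -oppr_eq0 -sinCN; congr (sinC _ != 0); rewrite /=; ring.
move: k1 k2 sv; have -> : angle b + NC * eta + k%:R * eps R n = angle b + k%:R * eps R n + NC * eta by ring.
move: (angle b + _) => x1; rewrite /cot sinCD cosCD; move: (NC * eta) => w.
have := cos2Dsin2C x1; move: (sinC x1) (cosC x1) (sinC w) (cosC w) => s c s' c' E s0 s1 s2.
transitivity ((c ^+ 2 + s ^+ 2) * c' / (s * (s * c' + c * s'))).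
  by field; rewrite s0 s1.
transitivity (c' / s' * ((c ^+ 2 + s ^+ 2) * s' / (s * (s * c' + c * s')))).
  by rewrite E; field; rewrite s0 s1 s2.
by field; rewrite s0 s1 s2.
Qed.

Lemma ct_eps u (x : Z) : ct (u + eps R n) x = ct u (x + 1).
Proof.
have [k E] := val_add R x (1 : Z); rewrite /ct -[RHS](cotDpi _ k) E -(N_eps R n).
by rewrite /= [(1 %% _)%N]modn_small//; congr cot; ring.
Qed.

Lemma shift_mxE (x y : Z) : shift_mx C N x y = (x + 1 == y)%:R.
Proof. by rewrite mxE; congr (nat_of_bool _)%:R; rewrite -addn1 -[in RHS]val_eqE /= modnDmr [(y %% _)%N]modn_small. Qed.

Lemma shift_mx_unit : shift_mx C N \in unitmx.
Proof.
suff /mulmx1_unit[] : shift_mx C N *m (shift_mx C N)^T = 1%:M by [].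
apply/matrixP => x y; rewrite !mxE -(inj_eq (addIr (1 : Z))) eq_sym.
rewrite -(sum_delta (fun z => (y + 1 == z)%:R) (x + 1)); apply: eq_bigr => z _.
by rewrite ![_^T _ _]mxE !shift_mxE mulrC.
Qed.

Lemma shift1E (x y z t : Z) : tcoef (shift_mx C N *t 1%:M) x z y t = (x + 1 == z)%:R * (y == t)%:R.
Proof. by rewrite /tcoef tensmxE shift_mxE mxE. Qed.

Lemma shift_mulE (X : 'M[C]_(N * N)) x y z t :
  tcoef ((shift_mx C N *t 1%:M) *m X) x z y t = tcoef X (x + 1) z y t.
Proof.
rewrite tcoef_mul -(sum_delta (fun a : Z => tcoef X a z y t) (x + 1)); apply: eq_bigr => a _.
rewrite -(sum_delta (fun e : Z => tcoef X a z e t * (x + 1 == a)%:R) y); apply: eq_bigr => b _.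
by rewrite shift1E; ring.
Qed.

Lemma mul_shiftE (X : 'M[C]_(N * N)) x y z t :
  tcoef (X *m (shift_mx C N *t 1%:M)) x z y t = tcoef X x (z - 1) y t.
Proof.
rewrite tcoef_mul -(sum_delta (fun a : Z => tcoef X x a y t) (z - 1)); apply: eq_bigr => a _.
rewrite -(sum_delta (fun e : Z => tcoef X x a y e * (z - 1 == a)%:R) t); apply: eq_bigr => b _.
by rewrite shift1E [t == b]eq_sym subr_eq [z == _]eq_sym; ring.
Qed.

Lemma invmx_mul1 m (A B : 'M[C]_m) : A *m B = 1%:M -> B \in unitmx /\ invmx B = A.
Proof.
move=> AB; have [_ Bu] := mulmx1_unit AB; split=> //.
by rewrite -[A]mulmx1 -(mulmxV Bu) mulmxA AB mul1mx.
Qed.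

Lemma leg21Z (c : C) (X : 'M[C]_(N * N)) : leg21 (c *: X) = c *: leg21 X.
Proof. by rewrite /leg21 -scalemxAr -scalemxAl. Qed.

(** By unitarity the inverse of leg21 R(- b) is R(b).  Shifting b by - i pi r adds
    eps to the angle, that is, 1 to b - c; conjugating by the cyclic shift of the
    first factor has the same effect on the indices, and S0_shift matches the
    scalars. *)
Lemma Rhat_shift b (b' := b - 'i * pi * r) : reg b -> reg (- b) -> reg b' ->
  sinC ('i * b / NC) != 0 -> sinC ('i * b' / NC) != 0 -> sinC ((pi + 'i * b) / NC) != 0 ->
  leg21 (Rhat N r G (- b)) \in unitmx /\
  Rhat N r G b' = invmx (shift_mx C N *t 1%:M) *m invmx (leg21 (Rhat N r G (- b)))
       *m (shift_mx C N *t 1%:M).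
Proof.
move=> hb hNb hb' n1 n2 n3; have [hS n4] := S0_shift (isT : (0 < N)%N) r0 HG hb hb'.
rewrite -/b' in hS n4.
have ii := @sqr_i R.
have ub : angle b' = angle b + eps R n.
  rewrite /b' /angle mulrBr (_ : 'i * ('i * pi * r) = 'i * 'i * pi * r); last by ring.
  by rewrite ii /eps; field_N.
have kb : kappa b' * S0 b = kappa b * S0 b'.
  rewrite /kappa -!N_angle.
  have e1 : NC * angle b' = NC * angle b + pi by rewrite ub mulrDr N_eps.
  have e2 : ('i * b + pi) / r = NC * angle b + pi / r by rewrite N_angle mulrDl.
  have e3 : ('i * b' + pi) / r = NC * angle b + pi / r + pi.
    by rewrite mulrDl -N_angle e1; ring.
  by rewrite e1 e2 e3 !sinCDpi invrN; ring.
pose s c := sinC ((pi - 'i * c) / NC) / sinC ('i * c / NC).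
have sN : s (- b) = - (sinC ((pi + 'i * b) / NC) / sinC ('i * b / NC)).
  by rewrite /s mulrN opprK mulNr sinCN invrN mulrN.
have sNn : s (- b) != 0 by rewrite sN oppr_eq0 mulf_neq0 ?invr_eq0.
have S0n : S0 b != 0.
  have := S0_mulN (isT : (0 < N)%N) r0 HG hb; apply: contra_eqN => /eqP ->.
  by rewrite mul0r eq_sym oner_eq0.
have sS : s (- b) * s b' * S0 b' = S0 b.
  rewrite sN /s; move: hS n1 n2; rewrite mulNr sinCN.
  move: (sinC (_ / NC)) (sinC (('i * b') / NC)) (sinC ((pi + _) / NC)) (sinC ('i * b / NC)).
  move: (S0 b) (S0 b') => A B p q s' t E t0 q0.
  transitivity (- (B * (s' * p)) / (t * q)); first by field; rewrite t0 q0.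
  by rewrite E; field; rewrite t0 q0.
have scal : s (- b) * s b' * kappa b' = kappa b.
  apply: (mulIf S0n); rewrite -[LHS]mulrA kb -[in RHS]sS; ring.
have U : ((s (- b))^-1 *: Rmx N r G b) *m leg21 (Rhat N r G (- b)) = 1%:M.
  rewrite /Rhat -/(s (- b)) leg21Z -scalemxAl -scalemxAr scalerA mulVf// scale1r.
  exact: Rmx_unitarity.
have [-> ->] := invmx_mul1 U; split=> //.
have Tu : (shift_mx C N *t (1%:M : 'M[C]_N)) \in unitmx.
  by apply: tensmx_unit => //; [exact: shift_mx_unit | exact: unitmx1].
rewrite -mulmxA; apply: (can_inj (mulKmx Tu)); rewrite mulKVmx//.
apply: tcoef_inj => x y z t; rewrite shift_mulE mul_shiftE /Rhat -/(s b').
rewrite !tcoefZ (Rmx_weight _ _ _ _ hb) (Rmx_weight _ _ _ _ hb') -scal.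
have -> : W b' (x + 1) y z t = W b x y (z - 1) t.
  rewrite /weight ub ct_eps.
  have -> : y - z + 1 = y - (z - 1) by ring.
  have -> : z - (x + 1) = z - 1 - x by ring.
  by have -> : x + 1 + y - z = x + y - (z - 1) by ring.
move: (weight _ _ _ _ _ _) => W; move: (s _) sNn (s b') (kappa b') => p p0 q k.
by rewrite -!mulrA mulKf.
Qed.

End RMatrixIdentities.

Theorem theorem1 (R : realType) (N : nat) (hN : (2 <= N)%N)
  (r : R[i]) (hr : 0 < complex.Re r) (hrZ : forall k : int, r^-1 != k%:~R)
  (G : R[i] -> R[i]) (hG : is_double_gamma r N%:R G) :
  (* Yang--Baxter equation *)
  (forall b1 b2 b3 : R[i],
     Rmx_regular N r (b1 - b2) -> Rmx_regular N r (b1 - b3) ->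
     Rmx_regular N r (b2 - b3) ->
     leg12_3 (Rmx N r G (b1 - b2)) *m leg13_3 (Rmx N r G (b1 - b3))
       *m leg23_3 (Rmx N r G (b2 - b3))
     = leg23_3 (Rmx N r G (b2 - b3)) *m leg13_3 (Rmx N r G (b1 - b3))
       *m leg12_3 (Rmx N r G (b1 - b2))) /\
  (* Unitarity *)
  (forall b : R[i], Rmx_regular N r b -> Rmx_regular N r (- b) ->
     Rmx N r G b *m leg21 (Rmx N r G (- b)) = 1%:M) /\
  (* Crossing-symmetry *)
  (forall b : R[i],
     Rmx_regular N r b -> Rmx_regular N r (- b + N%:R * 'i * piC R) ->
     trmx2 (Rmx N r G b) *m trmx2 (leg21 (Rmx N r G (- b + N%:R * 'i * piC R)))
     = 1%:M) /\
  (* Quasi-periodicity *)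
  (forall b : R[i],
     Rmx_regular N r b -> Rmx_regular N r (- b) ->
     Rmx_regular N r (b - 'i * piC R * r) ->
     sinC ('i * b / N%:R) != 0 ->
     sinC ('i * (b - 'i * piC R * r) / N%:R) != 0 ->
     sinC ((piC R + 'i * b) / N%:R) != 0 ->
     leg21 (Rhat N r G (- b)) \in unitmx /\
     Rhat N r G (b - 'i * piC R * r)
     = invmx (shift_mx _ N *t 1%:M) *m invmx (leg21 (Rhat N r G (- b)))
       *m (shift_mx _ N *t 1%:M)).
Proof.
case: N hN hG => [//|[//|n]] _ hG.
split; first exact: Rmx_ybe.
split; first exact: Rmx_unitarity.
split; first exact: Rmx_crossing.
by move=> b h1 h2 h3 n1 n2 n3; apply: Rhat_shift.
Qed.
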